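(* Let $\Gamma$ be a subgroup of $\mathrm{GL}_2(F_\infty)$ which is either commensurable with $\mathrm{GL}_2(A)$, or discrete and cocompact in $\mathrm{GL}_2(F_\infty)$; in the latter case assume also that $Z(\Gamma)$ consists of the scalar matrices in $\Gamma$ and that $\det(\Gamma)\subseteq\mathbb{F}_q^\times$. Let $$f(z)=\sum_{[\gamma]\in H\backslash\Gamma}(\det\gamma)^l\prod_{i=1}^ru(z;\gamma^{-1}a_i,\gamma^{-1}b_i)^{k_i}$$ be a Poincaré series for $\Gamma$ that satisfies condition (P), and let $k=\sum_{i=1}^rk_i$. Then $f$ is a cusp form of weight $2k$ and type $k+l$ for the group $\Gamma$.
   Context: $q$ is an odd prime power, $A=\mathbb{F}_q[T]$, $F=\mathbb{F}_q(T)$, $\pi=1/T$, $F_\infty=\mathbb{F}_q((\pi))$, $\mathcal{O}_\infty=\mathbb{F}_q[[\pi]]$, $\mathbb{C}_\infty$ is the completion of an algebraic closure of $F_\infty$, $\Omega=\mathbb{C}_\infty\setminus F_\infty$ with $\mathrm{GL}_2(F_\infty)$ acting by linear fractional transformations, $j_\gamma(z)=cz+d$ for $\gamma=\begin{pmatrix}a&b\\c&d\end{pmatrix}$, $|z|_i=\inf_{x\in F_\infty}|z-x|$. Commensurable means the intersection has finite index in both groups. $u(z;a,b)=\frac1{z-b}-\frac1{z-a}$ with $\frac1{z-\infty}=0$. Poincaré series data: $r\geqslant1$, $k_1,\dots,k_r\geqslant1$, $l\in\mathbb{Z}$, $H\leqslant\Gamma$ with $\det(h)^l=1$ for all $h\in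 H$, and $a_i,b_i\in\mathbb{P}^1(F_\infty)$ with $a_i\ne b_i$, $\{a_i,b_i\}\ne\{a_j,b_j\}$ for $i\neq j$, every $h\in H$ fixing all $a_i,b_i$. Condition (P): for all vertices $v$ of $\mathcal{T}$ and all $N\geqslant0$ the set $\{[\gamma]\in H\backslash\Gamma:d(\gamma v,[a_i\to b_i])\leqslant N\ \forall i\}$ is finite. (Under (P), the series converges locally uniformly to a holomorphic function on $\Omega$.) Here $\mathcal{T}$ is the Bruhat–Tits tree of $\mathrm{PGL}_2(F_\infty)$: vertices are homothety classes $[L]$ of rank-two $\mathcal{O}_\infty$-lattices in the row space $F_\infty^2$, adjacent if they have representatives with $\pi L\subset L'\subset L$ (strict); $\gamma[L]=[L\gamma^{-1}]$; ends are identified equivariantly with $\mathbb{P}^1(F_\infty)$ so that, with $v_n=[\pi^n\mathcal{O}_\infty f_1+\mathcal{O}_\infty f_2]$, $(v_n)_{n\geqslant0}$ represents $\infty$ and $(v_{-n})_{n\geqslant0}$ represents $0$; $[a\to b]$ is the geodesic from $a$ to $b$, $d$ the path distance. Modular forms. Let $d(\Gamma)=\#\det(\Gamma)$. For weight $w\geqslant0$ and type $m\in\mathbb{Z}/d(\Gamma)\mathbb{Z}$ put $(f|_{w,m}\gamma)(z)=\frac{(\det\gamma)^m}{j_\gamma(z)^w}f(\gamma z)$. A Drinfeld modular form of weight $w$ and type $m$ for $\Gamma$ is a rigid holomorphic $f\colon\Omega\to\mathbb{C}_\infty$ with $f|_{w,m}\gamma=f$ for all $\gamma\in\Gamma$ that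 is holomorphic at all cusps; it is a cusp form if it vanishes to order $\geqslant1$ at all cusps. If $\Gamma$ is cocompact there are no cusps and these conditions are vacuous. If $\Gamma$ is commensurable with $\mathrm{GL}_2(A)$, the cusps are the $\Gamma$-orbits in $\mathbb{P}^1(F)$; for a cusp $\nu\infty$, $\nu\in\mathrm{GL}_2(F)$, let $\mathfrak{b}\subset F$ be the group of upper-right entries of the upper unipotent matrices in $\nu^{-1}\Gamma\nu$, $e_{\mathfrak{b}}(z)=z\prod_{b\in\mathfrak{b}\setminus\{0\}}(1-z/b)$, $t=1/e_{\mathfrak{b}}$. Then $f$ is holomorphic (resp. vanishes to order $\geqslant n$) at $\nu\infty$ if $f|_{w,m}\nu=\sum_{j\geqslant0}c_jt^j$ for $|z|_i$ large, with positive radius of convergence (resp. with moreover $c_0=\cdots=c_{n-1}=0$). These conditions are independent of the choices (including an integer lift of $m$). *)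

(* Defs.v *)
From HB Require Import structures.
From mathcomp Require Import all_boot all_order all_algebra.
From mathcomp Require Import finmap.
From mathcomp Require Import all_classical all_reals all_analysis.

Set Implicit Arguments.
Unset Strict Implicit.
Unset Printing Implicit Defensive.

Import Order.TTheory GRing.Theory Num.Theory.
Local Open Scope classical_set_scope.
Local Open Scope ring_scope.

(** [fps K] is [K[[pi]]] with the Cauchy product; [laurent K] is its field of
    fractions, i.e. [K((pi))]. *)

(* A record rather than an alias of [nat -> K], on which the library already
   has a pointwise ring structure. *)
Record fps (K : fieldType) := Fps { fcoef :> nat -> K }.

Lemma fpsP (K : fieldType) (a b : fps K) : (forall n, a n = b n) -> a = b.
Proof. by case: a b => [a] [b] /= ab; congr Fps; apply/funext. Qed.

Section FpsRing.
Variable K : fieldType.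
Implicit Types a b c : fps K.

HB.instance Definition _ := gen_eqMixin (fps K).
HB.instance Definition _ := gen_choiceMixin (fps K).

Definition fps_const (x : K) : fps K := Fps (fun n => if n == 0%N then x else 0).
Definition fps_add a b : fps K := Fps (fun n => a n + b n).
Definition fps_opp a : fps K := Fps (fun n => - a n).
Definition fps_mul a b : fps K := Fps (fun n => \sum_(i < n.+1) a i * b (n - i)%N).

Fact fps_addA : associative fps_add.
Proof. by move=> a b c; apply: fpsP => n /=; rewrite addrA. Qed.
Fact fps_addC : commutative fps_add.
Proof. by move=> a b; apply: fpsP => n /=; rewrite addrC. Qed.
Fact fps_add0 : left_id (fps_const 0) fps_add.
Proof. by move=> a; apply: fpsP => n /=; case: ifP => _; rewrite add0r. Qed.
Fact fps_addN : left_inverse (fps_const 0) fps_opp fps_add.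
Proof. by move=> a; apply: fpsP => n /=; case: ifP => _; rewrite addNr. Qed.

HB.instance Definition _ :=
  GRing.isZmodule.Build (fps K) fps_addA fps_addC fps_add0 fps_addN.

Let trunc N a : {poly K} := \poly_(i < N) a i.

Let trunc_mul N a b n : (n < N)%N -> fps_mul a b n = (trunc N a * trunc N b)`_n.
Proof.
move=> nN; rewrite coefM; apply: eq_bigr => i _.
by rewrite !coef_poly (leq_ltn_trans _ nN) ?(leq_ltn_trans (leq_subr _ _) nN) // -ltnS.
Qed.

Fact fps_mulA : associative fps_mul.
Proof.
move=> a b c; apply: fpsP => n.
transitivity ((trunc n.+1 a * (trunc n.+1 b * trunc n.+1 c))`_n).
  rewrite coefM; apply: eq_bigr => i _.
  by rewrite coef_poly ltn_ord (@trunc_mul n.+1) // ltnS leq_subr.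
rewrite mulrA coefM; apply: eq_bigr => i _.
by rewrite coef_poly ltnS leq_subr (@trunc_mul n.+1).
Qed.

Fact fps_mulC : commutative fps_mul.
Proof. by move=> a b; apply: fpsP => n; rewrite !(@trunc_mul n.+1) // mulrC. Qed.

Fact fps_mul1 : left_id (fps_const 1) fps_mul.
Proof.
move=> a; apply: fpsP => n /=.
by rewrite big_ord_recl /= mul1r subn0 big1 ?addr0 // => i _; rewrite mul0r.
Qed.

Fact fps_mulD : left_distributive fps_mul fps_add.
Proof.
move=> a b c; apply: fpsP => n /=.
by rewrite -big_split; apply: eq_bigr => i _; rewrite mulrDl.
Qed.

Fact fps_1_neq0 : fps_const 1 != 0 :> fps K.
Proof.
apply/eqP => /(congr1 (fun a : fps K => a 0%N)) /= /eqP.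
by rewrite oner_eq0.
Qed.

HB.instance Definition _ := GRing.Zmodule_isComNzRing.Build (fps K)
  fps_mulA fps_mulC fps_mul1 fps_mulD fps_1_neq0.

Definition fps_unit : {pred fps K} := fun a => `[< exists b, b * a = 1 >].
Definition fps_inv a : fps K :=
  if fps_unit a then xget 0 [set b | b * a = 1] else a.

Fact fps_mulVr : {in fps_unit, left_inverse 1 fps_inv *%R}.
Proof.
move=> a ua; have {}ua : fps_unit a := ua.
rewrite /fps_inv ua; have [b ba] : exists b, b * a = 1 by apply/asboolP.
by apply: (@xgetPex _ 0 [set b | b * a = 1]); exists b.
Qed.
Fact fps_unitP a b : b * a = 1 -> fps_unit a.
Proof. by move=> ba; apply/asboolP; exists b. Qed.
Fact fps_inv_out : {in [predC fps_unit], fps_inv =1 id}.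
Proof.
by move=> a na; have /negbTE {}na : ~~ fps_unit a := na; rewrite /fps_inv na.
Qed.

HB.instance Definition _ := GRing.ComNzRing_hasMulInverse.Build (fps K)
  fps_mulVr fps_unitP fps_inv_out.

Let low a : a != 0 -> exists n, a n != 0 /\ forall i, (i < n)%N -> a i = 0.
Proof.
move=> a0; have [|n an lt_n] := @ex_minnP (fun n => a n != 0).
  apply: contrapT => /forallNP a_0; move/eqP: a0; apply; apply: fpsP => n /=.
  by case: ifP => _; have /negP := a_0 n; rewrite negbK => /eqP.
exists n; split=> // i; case: (eqVneq (a i) 0) => // ai.
by rewrite ltnNge lt_n.
Qed.

Fact fps_idom a b : a * b = 0 -> (a == 0) || (b == 0).
Proof.
move=> ab0; apply/norP => -[/low[m [am ltm]] /low[n [bn ltn]]].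
have := congr1 (fun a : fps K => a (m + n)%N) ab0.
rewrite /= (_ : (if _ then _ else _) = 0); last by case: ifP.
rewrite (bigD1 (Ordinal (leq_addr n m : (m < (m + n).+1)%N))) //= big1 ?addr0.
  by rewrite addKn => /eqP; rewrite mulf_eq0 (negbTE am) (negbTE bn).
move=> i; rewrite -val_eqE /= neq_ltn => /orP[im|mi].
  by rewrite ltm ?mul0r.
rewrite ltn ?mulr0 //; have := ltn_ord i; rewrite ltnS => il.
by rewrite ltn_subLR // ltn_add2r.
Qed.

HB.instance Definition _ := GRing.ComUnitRing_isIntegral.Build (fps K) fps_idom.

End FpsRing.

Definition laurent (K : fieldType) := {fraction (fps K)}.

HB.instance Definition _ (K : fieldType) := GRing.Field.on (laurent K).

Definition lpi (K : fieldType) : laurent K :=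
  tofrac (Fps (fun n => (n == 1%N)%:R)).

Definition lconst (K : fieldType) (c : K) : laurent K := tofrac (fps_const c).

(* The valuation ring [K[[pi]]] inside [K((pi))]. *)
Definition Oinf (K : fieldType) : set (laurent K) := range (@tofrac (fps K)).

(* The pi-adic valuation: the integer [n] such that [x] is [pi ^ n] times a
   unit of [K[[pi]]] (junk value [0] at [x = 0]). *)
Definition lval (K : fieldType) (x : laurent K) : int :=
  xget 0 [set n : int | exists2 v : fps K, v \is a GRing.unit &
                          x = tofrac v * lpi K ^ n].

(** The pi-adic topology on [K((pi))]; it induces the topology of
    ['M[laurent K]_2] through the library's instances for matrices. *)

Section LaurentTopology.
Variable K : fieldType.
Local Open Scope relation_scope.

Definition lball (n : nat) : set (laurent K * laurent K) :=
  [set xy | exists v : fps K, xy.1 - xy.2 = tofrac v * lpi K ^+ n].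

Definition lent : set_system (laurent K * laurent K) := filter_from setT lball.

Fact lent_filter : Filter lent.
Proof.
apply: filter_from_filter; first by exists 0%N.
move=> n m _ _; exists (n + m)%N => // xy [v xyv]; split.
  exists (v * Fps (fun n => (n == 1%N)%:R) ^+ m).
  by rewrite xyv addnC exprD mulrA tofracM tofracXn.
exists (v * Fps (fun n => (n == 1%N)%:R) ^+ n).
by rewrite xyv exprD mulrA tofracM tofracXn.
Qed.

Fact lent_diag A : lent A -> diagonal `<=` A.
Proof.
move=> [n _ nA] [x y] /= xy; apply: nA; exists 0.
by move: xy; rewrite /diagonal /= => ->; rewrite subrr tofrac0 mul0r.
Qed.

Fact lent_inv A : lent A -> lent A^-1.
Proof.
move=> [n _ nA]; exists n => // -[x y] [v /= xyv]; apply: nA; exists (- v) => /=.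
by rewrite tofracN mulNr -xyv opprB.
Qed.

Fact lent_split A : lent A -> exists2 B, lent B & B \; B `<=` A.
Proof.
move=> [n _ nA]; exists (lball n); first by exists n.
move=> [x z] [y [v /= xy] [w /= yz]]; apply: nA; exists (v + w) => /=.
by rewrite tofracD mulrDl -xy -yz addrA subrK.
Qed.

HB.instance Definition _ := isUniform.Build (laurent K)
  lent_filter lent_diag lent_inv lent_split.

End LaurentTopology.

Section Groups.
Variable Fq : finFieldType.
Local Notation Finf := (laurent Fq).
Local Notation M2 := 'M[Finf]_2.
Implicit Types G H : set M2.

(* The embedding of [A = Fq[T]] into [F_infty], with [T = 1/pi]. *)
Definition Ainf (p : {poly Fq}) : Finf :=
  \sum_(i < size p) lconst p`_i * (lpi Fq)^-1 ^+ i.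

(* [F = Fq(T)] inside [F_infty]. *)
Definition Fsub : set Finf :=
  [set x | exists p q : {poly Fq}, q != 0 /\ x = Ainf p / Ainf q].

Definition GL2inf : set M2 := [set g | g \in unitmx].
Definition GL2F : set M2 := [set g | g \in unitmx /\ forall i j, Fsub (g i j)].
Definition GL2A : set M2 :=
  [set map_mx Ainf g | g in [set g : 'M[{poly Fq}]_2 | g \in unitmx]].

Definition is_subgroup G : Prop :=
  [/\ G `<=` GL2inf, G 1%:M, forall g h, G g -> G h -> G (g *m h)
    & forall g, G g -> G (invmx g)].

Definition rcoset2 H (g : M2) : set M2 := [set h *m g | h in H].

Definition rcosets2 H G : set (set M2) := [set rcoset2 H g | g in G].

Definition finite_index H G : Prop := finite_set (rcosets2 H G).

Definition commensurable G H : Prop :=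
  finite_index (G `&` H) G /\ finite_index (G `&` H) H.

(* [GL_2(F_infty)] carries the subspace topology of the 2x2 matrices; a
   subgroup is discrete iff the identity is isolated in it. *)
Definition discrete_subgroup G : Prop :=
  \forall g \near (1%:M : M2), G g -> g = 1%:M.

(* Compactness of [G\GL_2(F_infty)/Z], [Z] the group of scalar matrices.
   Cocompactness is understood modulo the centre: a subgroup whose determinants
   are units of [Fq] is never cocompact in [GL_2(F_infty)] itself, because
   [F_infty^*/Fq^*] is not compact. Cocompactness in [GL_2(F_infty)] implies
   the present condition. *)
Definition cocompact G : Prop :=
  exists S : set M2, [/\ compact S, S `<=` GL2inf &
    forall g, GL2inf g -> exists h c s,
      [/\ G h, c != 0, S s & g = c *: (h *m s)]].

Definition center2 G : set M2 :=
  [set z | G z /\ forall g, G g -> z *m g = g *m z].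

Definition det_set G : set Finf := [set \det g | g in G].

(* The number of determinants (0 if there are infinitely many). *)
Definition det_card G : nat := #|` fset_set (det_set G)|.

(* [P^1(F_infty)]; [None] is the point at infinity. *)
Definition P1 := option Finf.

Definition mobius (g : M2) (x : P1) : P1 :=
  let a := g 0 0 in let b := g 0 1 in let c := g 1 0 in let d := g 1 1 in
  match x with
  | None => if c == 0 then None else Some (a / c)
  | Some y => if c * y + d == 0 then None else Some ((a * y + b) / (c * y + d))
  end.

Definition lattice_type := set 'rV[Finf]_2.

(* The lattice spanned by the rows of [g]. *)
Definition row_lattice (g : M2) : lattice_type :=
  [set v *m g | v in [set v : 'rV[Finf]_2 | forall j, Oinf (v 0 j)]].

Definition is_lattice (L : lattice_type) : Prop :=
  exists2 g, GL2inf g & L = row_lattice g.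

Definition scale_lattice (c : Finf) (L : lattice_type) : lattice_type :=
  [set c *: v | v in L].

(* A vertex is the homothety class of a lattice, as a set of lattices. *)
Definition vertex_type := set lattice_type.

Definition homothety_class (L : lattice_type) : vertex_type :=
  [set scale_lattice c L | c in [set c | c != 0]].

Definition is_vertex (v : vertex_type) : Prop :=
  exists2 L, is_lattice L & v = homothety_class L.

Definition adjacent (v w : vertex_type) : Prop :=
  [/\ is_vertex v, is_vertex w & exists L L' : lattice_type,
    [/\ v L, w L', scale_lattice (lpi Fq) L `<` L' & L' `<` L]].

Definition act_vertex (g : M2) (v : vertex_type) : vertex_type :=
  [set [set x *m invmx g | x in L] | L in v].

(* The class of [pi^n O f_1 + O f_2]. *)
Definition std_vertex (n : int) : vertex_type :=
  homothety_class (row_lattice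
    (\matrix_(i, j) if i != j then 0 else if i == 0 then lpi Fq ^ n else 1)).

Fixpoint walk (n : nat) (v w : vertex_type) : Prop :=
  if n is n'.+1 then exists2 u, adjacent v u & walk n' u w else v = w.

(* [d(v, S) <= N], for the path distance [d] and a set [S] of vertices. *)
Definition dist_le (v : vertex_type) (S : set vertex_type) (N : nat) : Prop :=
  exists2 w, S w & exists2 n, (n <= N)%N & walk n v w.

Definition same_end (s t : nat -> vertex_type) : Prop :=
  exists m m', forall n, s (n + m)%N = t (n + m')%N.

(* The ray [s] represents the end attached to [x]. By equivariance, the end
   attached to [g oo] is the one represented by [(g v_n)_(n >= 0)]; for [g] the
   antidiagonal matrix with entries 1, [g oo = 0] and [g v_n = v_(-n)]. *)
Definition represents (s : nat -> vertex_type) (x : P1) : Prop :=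
  exists g, [/\ GL2inf g, mobius g None = x
    & same_end s (fun n => act_vertex g (std_vertex n%:Z))].

(* A bi-infinite path without backtracking, from the end [a] to the end [b]. *)
Definition line_from_to (w : int -> vertex_type) (a b : P1) : Prop :=
  [/\ forall n, adjacent (w n) (w (n + 1)), forall n, w n <> w (n + 2),
      represents (fun n => w (- n%:Z)) a & represents (fun n => w n%:Z) b].

(* The vertices of [a -> b]. *)
Definition geodesic (a b : P1) : set vertex_type :=
  [set v | exists w n, line_from_to w a b /\ v = w n].

Record poincare_data G H (r : nat) (k : 'I_r -> nat) (l : int)
    (a b : 'I_r -> P1) : Prop := PoincareData {
  pd_r : (1 <= r)%N;
  pd_k : forall i, (1 <= k i)%N;
  pd_group : is_subgroup H;
  pd_sub : H `<=` G;
  pd_det : forall h, H h -> (\det h) ^ l = 1;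
  pd_ab : forall i, a i <> b i;
  pd_distinct : forall i j, i != j -> [set a i; b i] <> [set a j; b j];
  pd_fix : forall h i, H h -> mobius h (a i) = a i /\ mobius h (b i) = b i }.

Definition conditionP G H (r : nat) (a b : 'I_r -> P1) : Prop :=
  forall (v : vertex_type) (N : nat), is_vertex v ->
    finite_set (rcosets2 H [set g | G g /\
      forall i, dist_le (act_vertex g v) (geodesic (a i) (b i)) N]).

End Groups.

Arguments GL2A Fq : clear implicits.

(* The absolute value of [F_infty], normalized by [|pi| = 1/q]. *)
Definition absinf (R : realType) (Fq : finFieldType) (x : laurent Fq) : R :=
  if x == 0 then 0 else (#|Fq|%:R : R) ^ (- lval x).

Record is_absval (R : realType) (L : fieldType) (N : L -> R) : Prop := IsAbsval {
  absval_ge0 : forall x, 0 <= N x;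
  absval_eq0 : forall x, N x = 0 <-> x = 0;
  absvalM : forall x y, N (x * y) = N x * N y;
  absval_ultra : forall x y, N (x + y) <= Num.max (N x) (N y) }.

Definition abs_cvg (R : realType) (L : fieldType) (N : L -> R)
    (s : nat -> L) (x : L) : Prop :=
  forall e : R, 0 < e -> exists n0, forall n, (n0 <= n)%N -> N (s n - x) < e.

Definition abs_cauchy (R : realType) (L : fieldType) (N : L -> R)
    (s : nat -> L) : Prop :=
  forall e : R, 0 < e ->
    exists n0, forall m n, (n0 <= m)%N -> (n0 <= n)%N -> N (s m - s n) < e.

(* A completion [Csort] of an algebraic closure [Falg] of [F_infty], for the
   absolute value extending that of [F_infty]; this determines [Csort] up to
   isometric isomorphism over [F_infty]. *)
Record Cinfty (R : realType) (Fq : finFieldType) := MkCinfty {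
  Falg : fieldType;
  Falg_emb : {rmorphism laurent Fq -> Falg};
  Falg_algebraic : forall x : Falg, algebraicOver Falg_emb x;
  Falg_closed : GRing.closed_field_axiom Falg;
  Csort :> fieldType;
  Cabs : Csort -> R;
  Cabs_absval : is_absval Cabs;
  Calg_emb : {rmorphism Falg -> Csort};
  Cabs_ext : forall x : laurent Fq, Cabs (Calg_emb (Falg_emb x)) = absinf R x;
  Calg_dense : forall (z : Csort) (e : R), 0 < e ->
    exists x : Falg, Cabs (z - Calg_emb x) < e;
  Ccomplete : forall s : nat -> Csort,
    abs_cauchy Cabs s -> exists z, abs_cvg Cabs s z }.

Section ModularForms.
Variables (R : realType) (Fq : finFieldType) (C : Cinfty R Fq).
Local Notation Finf := (laurent Fq).
Local Notation M2 := 'M[Finf]_2.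

Definition Cemb (x : Finf) : C := Calg_emb C (Falg_emb C x).

Definition Omega : set C := ~` range Cemb.

Definition imabs (z : C) : R := inf (range (fun x : Finf => Cabs (z - Cemb x))).

(* The affinoids [|z| <= q^n, |z|_i >= q^(-n)], which form an admissible
   covering of [Omega]. *)
Definition Omega_n (n : nat) : set C :=
  [set z | Cabs z <= (#|Fq|%:R : R) ^+ n /\ (#|Fq|%:R : R) ^- n <= imabs z].

(* Functions on [Omega] are represented by functions on [C], whose values
   outside [Omega] are irrelevant. Rigid holomorphic: on each of the above
   affinoids, a uniform limit of rational functions without poles there. *)
Definition rigid_holomorphic (f : C -> C) : Prop :=
  forall (n : nat) (e : R), 0 < e -> exists p q : {poly C},
    forall z, Omega_n n z -> q.[z] != 0 /\ Cabs (f z - p.[z] / q.[z]) < e.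

Definition jfactor (g : M2) (z : C) : C := Cemb (g 1 0) * z + Cemb (g 1 1).

Definition cmobius (g : M2) (z : C) : C :=
  (Cemb (g 0 0) * z + Cemb (g 0 1)) / jfactor g z.

Definition slash (w : nat) (m : int) (f : C -> C) (g : M2) (z : C) : C :=
  Cemb (\det g) ^ m / jfactor g z ^+ w * f (cmobius g z).

(* The limit of [phi S] along the finite subsets [S] of [D] (0 if there is
   none), used for unordered infinite sums and products. *)
Definition fin_lim (I : choiceType) (D : set I) (phi : {fset I} -> C) : C :=
  xget 0 [set s : C | forall e : R, 0 < e ->
    exists S0 : {fset I}, [set` S0] `<=` D /\
      forall S : {fset I}, (S0 `<=` S)%fset -> [set` S] `<=` D ->
        Cabs (phi S - s) < e].

Definition usum (I : choiceType) (D : set I) (t : I -> C) : C :=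
  fin_lim D (fun S => \sum_(i <- S) t i).

Definition uprod (I : choiceType) (D : set I) (t : I -> C) : C :=
  fin_lim D (fun S => \prod_(i <- S) t i).

Definition unip (x : Finf) : M2 :=
  \matrix_(i, j) if i == j then 1 else if i == 0 then x else 0.

Definition cusp_translations (G : set M2) (nu : M2) : set Finf :=
  [set x | [set invmx nu *m g *m nu | g in G] (unip x)].

Definition eexp (B : set Finf) (z : C) : C :=
  z * uprod (B `\ 0) (fun x => 1 - z / Cemb x).

Definition cusp_parameter (G : set M2) (nu : M2) (z : C) : C :=
  (eexp (cusp_translations G nu) z)^-1.

Definition csum (s : nat -> C) (x : C) : Prop :=
  abs_cvg (@Cabs _ _ C) (fun n => \sum_(j < n) s j) x.

(* [f] vanishes to order at least [n] at the cusp [nu oo]; for [n = 0], [f] is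
   holomorphic there. *)
Definition order_at_cusp_ge (n : nat) (G : set M2) (w : nat) (m : int)
    (f : C -> C) (nu : M2) : Prop :=
  exists (c : nat -> C) (rho M : R),
    [/\ 0 < rho,
        forall x : C, Cabs x < rho -> exists s, csum (fun j => c j * x ^+ j) s,
        forall z, Omega z -> M < imabs z ->
          csum (fun j => c j * cusp_parameter G nu z ^+ j) (slash w m f nu z)
      & forall j, (j < n)%N -> c j = 0].

(* There are cusps only if [G] is commensurable with [GL_2(A)]; as [nu] ranges
   over [GL_2(F)], [nu oo] ranges over [P^1(F)]. *)
Definition order_at_cusps_ge (n : nat) (G : set M2) (w : nat) (m : int)
    (f : C -> C) : Prop :=
  commensurable G (GL2A Fq) ->
  forall nu, GL2F nu -> order_at_cusp_ge n G w m f nu.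

(* The type, a class modulo [det_card G], is given by an integer lift [m]. *)
Definition modular_form (G : set M2) (w : nat) (m : int) (f : C -> C) : Prop :=
  [/\ rigid_holomorphic f,
      forall g z, G g -> Omega z -> slash w m f g z = f z
    & order_at_cusps_ge 0 G w m f].

Definition cusp_form (G : set M2) (w : nat) (m : int) (f : C -> C) : Prop :=
  modular_form G w m f /\ order_at_cusps_ge 1 G w m f.

(* [1/(z - x)], with value 0 at infinity. *)
Definition cinv_sub (z : C) (x : P1 Fq) : C :=
  if x is Some y then (z - Cemb y)^-1 else 0.

Definition ufun (z : C) (a b : P1 Fq) : C := cinv_sub z b - cinv_sub z a.

Definition poincare_term (r : nat) (k : 'I_r -> nat) (l : int)
    (a b : 'I_r -> P1 Fq) (g : M2) (z : C) : C :=
  Cemb (\det g) ^ l *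
  \prod_(i < r) ufun z (mobius (invmx g) (a i)) (mobius (invmx g) (b i)) ^+ k i.

(* The summand of a coset is computed on an arbitrary representative; for
   Poincare series data it does not depend on the choice. *)
Definition poincare_series (G H : set M2) (r : nat) (k : 'I_r -> nat) (l : int)
    (a b : 'I_r -> P1 Fq) (z : C) : C :=
  usum (rcosets2 H G) (fun c => poincare_term k l a b (xget 1%:M c) z).

End ModularForms.

Arguments poincare_series {R Fq} C G H {r} k l a b z.

(* Main.v *)
(** The argument avoids the structure theory of the tree. For normalized
    homogeneous coordinates, let chord(a, b) be their determinant; then
    u(z; a, b) is, up to sign, chord(a, b) divided by two linear forms that are
    bounded below on each affinoid, and walking along explicit lattices shows
    d(g v, [a -> b]) <= n as soon as |chord(g^-1 a, g^-1 b)| >= q^-n at the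
    standard vertex v. So condition (P) leaves only finitely many cosets with
    all chords >= q^-n, the other terms being O(q^-n) uniformly on affinoids:
    the series is a uniform limit of rational functions, and it may be
    reindexed by Gamma, which together with the transformation rule of 1/(z - x)
    gives its invariance. Determinants of elements of Gamma are units because
    Gamma is commensurable with GL_2(A) (or by hypothesis), and their
    #det(Gamma)-th powers are 1.

    At a cusp, the translations b form a discrete cocompact group B. It acts
    freely on the cosets, and the sum over a B-orbit of a term is, by partial
    fractions, a combination of Eisenstein sums over b of (z - x + b)^-j. With
    e = e_B additive, e times such a sum is a combination of those of lower
    order (Goss), so these are power series in t = 1/e without constant term.
    The whole series is a limit of such sums, uniformly on the points zeta y,
    where zeta is a root of unity of order prime to p and |y| is large and
    outside the value group of F_infty; these have the same |t| = r and
    distances r in the coordinate t. Interpolating at many of them bounds the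
    coefficients by the values there, so the limit is again such a power
    series. *)

From HB Require Import structures.
Require Import Defs.
From mathcomp Require Import separable.
From mathcomp Require Import all_boot all_order all_algebra finmap.
From mathcomp Require Import all_classical all_reals all_analysis.
From mathcomp Require Import ring lra zify.
Set Implicit Arguments.
Unset Strict Implicit.
Unset Printing Implicit Defensive.
Import Order.TTheory GRing.Theory Num.Theory.
Local Open Scope classical_set_scope.
Local Open Scope ring_scope.

(** * Ultrametric absolute values *)

(** The affinoids bound |z| as well as |z|_i, whereas |z| is unbounded on the neighbourhood |t| <= r
    of a cusp; the estimate O(q^-n) therefore gives no uniform bound there. It is uniform on each
    single affinoid, and all the circle points lie in one. What passes from them to the whole disc
    is a bound on coefficients, not on values: interpolation plays the part of the maximum
    principle. The radius r must satisfy |e(x)| r < 1 for every x in F_infty. This is possible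
    because F_infty/B is compact and e is B-periodic, and it is what lets 1/e(z - x) be expanded in
    powers of t = 1/e(z). The constant implied in O(q^-n) is uniform over cosets only because |det
    g| = 1 on Gamma; otherwise the factors (det g)^l could grow. Sums are handled by a notion of
    unordered convergence under which injective reindexing and disjoint unions need no further
    estimate. The same term, shifted on the right by a matrix nu, then serves for the series itself
    (nu = 1), for invariance (nu in Gamma) and for the cusps (nu in GL_2(F)). *)

Section Ultrametric.
Variables (R : realType) (L : fieldType) (N : L -> R).
Hypothesis hN : is_absval N.
Implicit Types (x y : L) (e : R).

Lemma nv_ge0 x : 0 <= N x. Proof. exact: absval_ge0 hN x. Qed.
Lemma nvM x y : N (x * y) = N x * N y. Proof. exact: absvalM hN x y. Qed.
Lemma nv0 : N 0 = 0. Proof. by apply/(absval_eq0 hN). Qed.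
Lemma nv_eq0 x : (N x == 0) = (x == 0).
Proof. by apply/eqP/eqP => /(absval_eq0 hN). Qed.
Lemma nv_gt0 x : (0 < N x) = (x != 0).
Proof. by rewrite lt_def nv_ge0 andbT nv_eq0. Qed.

Lemma nv1 : N 1 = 1.
Proof.
have n1 : N 1 != 0 by rewrite nv_eq0 oner_eq0.
by apply: (mulfI n1); rewrite -nvM !mulr1.
Qed.

Lemma nvX x n : N (x ^+ n) = N x ^+ n.
Proof. by elim: n => [|n IH]; rewrite ?expr0 ?nv1 // !exprS nvM IH. Qed.

Lemma nv_root1 x n : x ^+ n.+1 = 1 -> N x = 1.
Proof.
move=> xn; apply/eqP; rewrite -(@pexpr_eq1 _ _ n.+1) ?nv_ge0 //.
by rewrite -nvX xn nv1.
Qed.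

Lemma nvN x : N (- x) = N x.
Proof.
rewrite -mulN1r nvM (_ : N (-1) = 1) ?mul1r //.
by apply: (@nv_root1 _ 1); rewrite sqrrN expr1n.
Qed.

Lemma nvBC x y : N (x - y) = N (y - x).
Proof. by rewrite -nvN opprB. Qed.

Lemma nvV x : N x^-1 = (N x)^-1.
Proof.
have [->|x0] := eqVneq x 0; first by rewrite invr0 nv0 invr0.
have nx : N x != 0 by rewrite nv_eq0.
by apply: (mulfI nx); rewrite -nvM !divff ?nv1.
Qed.

Lemma nvf x y : N (x / y) = N x / N y.
Proof. by rewrite nvM nvV. Qed.

Lemma nvXz x (n : int) : N (x ^ n) = N x ^ n.
Proof. by case: n => n; rewrite ?NegzE -?exprnN -?exprnP ?nvV nvX. Qed.

Lemma nv_prod (I : Type) (s : seq I) (P : pred I) (F : I -> L) :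
  N (\prod_(i <- s | P i) F i) = \prod_(i <- s | P i) N (F i).
Proof. exact: (big_morph N nvM nv1). Qed.

Lemma nvD_le x y e : N x <= e -> N y <= e -> N (x + y) <= e.
Proof.
by move=> xe ye; apply: le_trans (absval_ultra hN _ _) _; rewrite ge_max xe ye.
Qed.
Lemma nvD_lt x y e : N x < e -> N y < e -> N (x + y) < e.
Proof.
by move=> xe ye; apply: le_lt_trans (absval_ultra hN _ _) _; rewrite gt_max xe ye.
Qed.
Lemma nvB_le x y e : N x <= e -> N y <= e -> N (x - y) <= e.
Proof. by move=> xe ye; apply: nvD_le; rewrite ?nvN. Qed.
Lemma nvT_le x y z e : N (x - y) <= e -> N (y - z) <= e -> N (x - z) <= e.
Proof. by move=> xe ye; rewrite -(subrK y x) -addrA; apply: nvD_le. Qed.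
Lemma nvT_lt x y z e : N (x - y) < e -> N (y - z) < e -> N (x - z) < e.
Proof. by move=> xe ye; rewrite -(subrK y x) -addrA; apply: nvD_lt. Qed.

Lemma nvDl x y : N y < N x -> N (x + y) = N x.
Proof.
move=> yx; apply/eqP; rewrite eq_le (nvD_le (lexx _) (ltW yx)) /=.
have := absval_ultra hN (x + y) (- y); rewrite addrK nvN le_max.
by case/orP => // /(lt_le_trans yx); rewrite ltxx.
Qed.
Lemma nvBl x y : N y < N x -> N (x - y) = N x.
Proof. by move=> yx; rewrite nvDl ?nvN. Qed.
Lemma nvBr x y : N x < N y -> N (x - y) = N y.
Proof. by move=> yx; rewrite nvBC nvBl. Qed.

Lemma nv_sum_le (I : Type) (s : seq I) (P : pred I) (F : I -> L) e :
  0 <= e -> (forall i, P i -> N (F i) <= e) -> N (\sum_(i <- s | P i) F i) <= e.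
Proof.
by move=> e0 Fe; elim/big_ind: _ => //; rewrite ?nv0 // => x y; apply: nvD_le.
Qed.

Lemma nv_sum_le_in (I : eqType) (s : seq I) (F : I -> L) e :
  0 <= e -> (forall i, i \in s -> N (F i) <= e) -> N (\sum_(i <- s) F i) <= e.
Proof. by move=> e0 Fe; rewrite big_seq; apply: nv_sum_le. Qed.

Lemma nv_sum_lt_in (I : eqType) (s : seq I) (F : I -> L) e :
  0 < e -> (forall i, i \in s -> N (F i) < e) -> N (\sum_(i <- s) F i) < e.
Proof.
move=> e0 Fe; rewrite big_seq.
by elim/big_ind: _ => //; rewrite ?nv0 // => x y; apply: nvD_lt.
Qed.

Local Notation cvg := (abs_cvg N).
Implicit Types s : nat -> L.

Lemma abs_cvg_cst x : cvg (fun=> x) x.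
Proof. by move=> e e0; exists 0%N => n _; rewrite subrr nv0. Qed.

Lemma abs_cvg_uniq s x y : cvg s x -> cvg s y -> x = y.
Proof.
move=> sx sy; apply/eqP; rewrite -subr_eq0 -nv_eq0; apply: contraT.
rewrite neq_lt ltNge nv_ge0 /= => e0.
have [n xn] := sx _ e0; have [m ym] := sy _ e0.
have: N (x - y) < N (x - y).
  apply: (@nvT_lt _ (s (n + m)%N)); last by apply: ym; rewrite leq_addl.
  by rewrite nvBC; apply: xn; rewrite leq_addr.
by rewrite ltxx.
Qed.

Lemma abs_cvg_ext s s' x : (forall n, s n = s' n) -> cvg s x -> cvg s' x.
Proof. by move=> /funext ->. Qed.

Lemma abs_cvgD s s' x y : cvg s x -> cvg s' y -> cvg (fun n => s n + s' n) (x + y).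
Proof.
move=> sx sy e e0; have [n xn] := sx _ e0; have [m ym] := sy _ e0.
exists (n + m)%N => k nmk; rewrite opprD addrACA; apply: nvD_lt.
  by apply: xn; apply: leq_trans nmk; rewrite leq_addr.
by apply: ym; apply: leq_trans nmk; rewrite leq_addl.
Qed.

Lemma abs_cvgZ a s x : cvg s x -> cvg (fun n => a * s n) (a * x).
Proof.
move=> sx e e0; have a0 : 0 < N a + 1 by rewrite ltr_wpDl ?nv_ge0.
have [n xn] := sx (e / (N a + 1)) (divr_gt0 e0 a0).
exists n => k nk; rewrite -mulrBr nvM.
have /= := xn k nk; rewrite ltr_pdivlMr // => h.
apply: le_lt_trans h; rewrite mulrC; apply: ler_wpM2l; rewrite ?nv_ge0 //; lra.
Qed.

Lemma abs_cvgB s s' x y : cvg s x -> cvg s' y -> cvg (fun n => s n - s' n) (x - y).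
Proof.
move=> sx sy; apply: abs_cvgD => //; rewrite -mulN1r.
by apply: abs_cvg_ext (abs_cvgZ (-1) sy) => n; rewrite mulN1r.
Qed.

Lemma abs_cvg_le s x y e n0 :
  cvg s x -> (forall n, (n0 <= n)%N -> N (s n - y) <= e) -> N (x - y) <= e.
Proof.
move=> sx se; rewrite leNgt; apply/negP => ex.
have e0 : 0 < N (x - y).
  by apply: le_lt_trans ex; apply: le_trans (nv_ge0 _) (se n0 (leqnn _)).
have [n xn] := sx _ e0.
have: N (x - y) < N (x - y).
  apply: (@nvT_lt _ (s (n + n0)%N)); first by rewrite nvBC xn ?leq_addr.
  by apply: le_lt_trans ex; apply: se; rewrite leq_addl.
by rewrite ltxx.
Qed.

Lemma abs_cvg_ge s x e : 0 < e -> cvg s x ->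
  (exists n0, forall n, (n0 <= n)%N -> e <= N (s n)) -> e <= N x.
Proof.
move=> e0 sx [n0 se]; rewrite leNgt; apply/negP => xe.
have [n h] := sx _ e0.
have := h (n + n0)%N (leq_addr _ _).
rewrite ltNge nvBl ?se ?leq_addl //; apply: lt_le_trans xe _.
by rewrite se ?leq_addl.
Qed.

Lemma abs_cvg_bounded s x : cvg s x ->
  exists n0, forall n, (n0 <= n)%N -> N (s n) <= N x + 1.
Proof.
move=> sx; have [n0 h] := sx 1 ltr01; exists n0 => n nn.
rewrite -(subrK x (s n)); apply: nvD_le; last by rewrite ler_wpDr.
by have := h _ nn; have := nv_ge0 x; lra.
Qed.

Lemma abs_cvgM s s' x y : cvg s x -> cvg s' y -> cvg (fun n => s n * s' n) (x * y).
Proof.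
move=> sx sy e e0; have a0 : 0 < N x + 1 by rewrite ltr_wpDl ?nv_ge0.
have b0 : 0 < N y + 1 by rewrite ltr_wpDl ?nv_ge0.
have [n xn] := sx _ (divr_gt0 e0 b0).
have [m ym] := sy _ (divr_gt0 e0 a0).
have [p yp] := abs_cvg_bounded sx.
exists (n + m + p)%N => k nk.
rewrite (_ : _ - _ = s k * (s' k - y) + (s k - x) * y); last by ring.
apply: nvD_lt; rewrite nvM.
  have /= := ym k (leq_trans (leq_trans (leq_addl _ _) (leq_addr _ _)) nk).
  rewrite ltr_pdivlMr // => h; apply: le_lt_trans h.
  rewrite mulrC; apply: ler_wpM2l; rewrite ?nv_ge0 // yp //.
  exact: leq_trans (leq_addl _ _) nk.
have /= := xn k (leq_trans (leq_trans (leq_addr _ _) (leq_addr _ _)) nk).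
rewrite ltr_pdivlMr // => h; apply: le_lt_trans h.
apply: ler_wpM2l; rewrite ?nv_ge0 //; lra.
Qed.

Lemma abs_cvg_shift s x : cvg s x -> cvg (fun n => s n.+1) x.
Proof.
by move=> sx e /sx[n0 h]; exists n0 => n nn; apply: h; rewrite (leq_trans nn).
Qed.

Lemma abs_cvg_sum (I : eqType) (r : seq I) (F : nat -> I -> L) (G : I -> L) :
  (forall i, i \in r -> cvg (F^~ i) (G i)) ->
  cvg (fun n => \sum_(i <- r) F n i) (\sum_(i <- r) G i).
Proof.
elim: r => [|i r IH] h.
  by rewrite big_nil; apply: abs_cvg_ext (abs_cvg_cst 0) => n; rewrite big_nil.
rewrite big_cons; apply: (@abs_cvg_ext (fun n => F n i + \sum_(j <- r) F n j)).
  by move=> n; rewrite big_cons.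
apply: abs_cvgD; first by apply: h; rewrite mem_head.
by apply: IH => j jr; apply: h; rewrite in_cons jr orbT.
Qed.

Hypothesis complete : forall s, abs_cauchy N s -> exists z, cvg s z.

(** Telescoping costs nothing under the ultrametric inequality, so small consecutive differences
    already give a Cauchy sequence. *)
Lemma cauchy_step s : (forall e, 0 < e -> exists n0, forall n, (n0 <= n)%N ->
    N (s n.+1 - s n) < e) -> abs_cauchy N s.
Proof.
move=> h e /h[n0 hn].
have key m : N (s (n0 + m)%N - s n0) < e.
  elim: m => [|m IH].
    have := hn n0 (leqnn _); rewrite addn0 subrr nv0; exact: le_lt_trans (nv_ge0 _).
  apply: nvT_lt IH; rewrite addnS; apply: hn; exact: leq_addr.
exists n0 => m n /subnKC <- /subnKC <-; apply: (nvT_lt (key _)).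
by rewrite nvBC key.
Qed.

Lemma series_cvg (c : nat -> L) :
  (forall e, 0 < e -> exists n0, forall n, (n0 <= n)%N -> N (c n) < e) ->
  exists x, cvg (fun n => \sum_(j < n) c j) x.
Proof.
move=> h; apply: complete; apply: cauchy_step => e /h[n0 hn].
by exists n0 => n nn; rewrite big_ord_recr /= addrAC subrr add0r hn.
Qed.

Lemma sum_tail_le (c : nat -> L) n m e : 0 <= e ->
  (forall k, (n <= k)%N -> N (c k) <= e) -> (n <= m)%N ->
  N (\sum_(j < m) c j - \sum_(j < n) c j) <= e.
Proof.
move=> e0 h /subnKC <-; elim: (m - n)%N => [|k IH].
  by rewrite addn0 subrr nv0.
rewrite addnS; apply: nvT_le IH; rewrite big_ord_recr /= addrAC subrr add0r h //.
exact: leq_addr.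
Qed.

Lemma series_tail_le (c : nat -> L) x n e : 0 <= e ->
  cvg (fun n => \sum_(j < n) c j) x ->
  (forall k, (n <= k)%N -> N (c k) <= e) -> N (x - \sum_(j < n) c j) <= e.
Proof.
by move=> e0 cx h; apply: (abs_cvg_le (n0 := n) cx) => m; apply: sum_tail_le.
Qed.

End Ultrametric.

(** * Power series and Laurent series *)

Section PowerSeries.
Variable K : fieldType.
Implicit Types v w : fps K.

Definition fpsX : fps K := Fps (fun n => (n == 1%N)%:R).

Lemma fps_coef0 n : (0 : fps K) n = 0. Proof. by rewrite /=; case: ifP. Qed.
Lemma fps_coef1 n : (1 : fps K) n = (n == 0%N)%:R.
Proof. by rewrite /=; case: ifP. Qed.
Lemma fps_coefM v w n : (v * w) n = \sum_(i < n.+1) v i * w (n - i)%N.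
Proof. by []. Qed.
Lemma fps_coefD v w n : (v + w) n = v n + w n. Proof. by []. Qed.
Lemma fps_coefB v w n : (v - w) n = v n - w n. Proof. by []. Qed.
Lemma fpsX_coefS v n : (fpsX * v) n.+1 = v n.
Proof.
rewrite fps_coefM big_ord_recl /= mul0r add0r big_ord_recl /= mul1r subn1 /=.
by rewrite big1 ?addr0 // => i _; rewrite mul0r.
Qed.

Lemma fpsX_coef0 v : (fpsX * v) 0%N = 0.
Proof. by rewrite fps_coefM big_ord_recl big_ord0 /= mul0r addr0. Qed.

Lemma fpsX_divP v : v 0%N = 0 -> v = fpsX * Fps (fun n => v n.+1).
Proof.
by move=> v0; apply: fpsP => -[|n]; rewrite ?fpsX_coef0 ?fpsX_coefS.
Qed.

Lemma fpsX_pow_coef v n i : (i < n)%N -> (fpsX ^+ n * v) i = 0.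
Proof.
elim: n i => // n IH [|i] ilt; rewrite exprS -mulrA ?fpsX_coef0 //.
by rewrite fpsX_coefS IH.
Qed.

Lemma fps_pow_coef v n i : v 0%N = 0 -> (i < n)%N -> (v ^+ n) i = 0.
Proof.
by move=> v0 ilt; rewrite (fpsX_divP v0) exprMn fpsX_pow_coef.
Qed.

Lemma fps_constM a b : fps_const (a * b) = fps_const a * fps_const b :> fps K.
Proof.
apply: fpsP => n; rewrite fps_coefM big_ord_recl subn0 /= big1 ?addr0.
  by case: ifP => _; rewrite ?mulr0.
by move=> i _; rewrite mul0r.
Qed.

Lemma fps_unitE v : (v \is a GRing.unit) = (v 0%N != 0).
Proof.
apply/idP/idP => [/mulVr/(congr1 (fun w : fps K => w 0%N))|v0].
  rewrite fps_coefM big_ord_recl big_ord0 /= addr0 => vv; apply/eqP => h.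
  by move/eqP: vv; rewrite h mulr0 eq_sym oner_eq0.
pose w := 1 - fps_const (v 0%N)^-1 * v.
have w0 : w 0%N = 0.
  rewrite /w fps_coefB fps_coefM big_ord_recl big_ord0 /= mulVf //.
  by rewrite addr0 subrr.
(* The geometric series of [w], truncated degree by degree: [w ^+ i] has no coefficient below i
   because [w] has none at 0. *)
pose b := Fps (fun n => (\sum_(i < n.+1) w ^+ i) n).
have bE n d : (\sum_(i < (n + d).+1) w ^+ i) n = b n.
  elim: d => [|d IH]; first by rewrite addn0.
  by rewrite addnS big_ord_recr fps_coefD IH fps_pow_coef ?addr0 //= ltnS leq_addr.
have wb : (1 - w) * b = 1.
  apply: fpsP => n; transitivity (((1 - w) * \sum_(i < n.+1) w ^+ i) n).
    rewrite !fps_coefM; apply: eq_bigr => -[i /= ilt] _; congr (_ * _).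
    by have := bE (n - i)%N i; rewrite subnK.
  have -> : (1 - w) * (\sum_(i < n.+1) w ^+ i) = 1 - w ^+ n.+1.
    by rewrite -opprB mulNr -subrX1 opprB.
  by rewrite fps_coefB fps_pow_coef // subr0.
have {}wb : fps_const (v 0%N)^-1 * v * b = 1 by rewrite -[RHS]wb /w subKr.
apply/unitrP; exists (fps_const (v 0%N)^-1 * b).
by split; rewrite -[RHS]wb; ring.
Qed.

Lemma fps_unit_mod v : v != 0 ->
  exists n w, w \is a GRing.unit /\ v = fpsX ^+ n * w.
Proof.
move=> v0; have [n vn] : exists n, v n != 0.
  apply: contrapT => /forallNP h; case/eqP: v0; apply: fpsP => n.
  by rewrite fps_coef0; apply/eqP/negbNE/negP; exact: h.
elim: n v vn v0 => [|n IH] v vn v0.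
  by exists 0%N, v; rewrite expr0 mul1r fps_unitE.
have [v00|v00] := eqVneq (v 0%N) 0; last first.
  by exists 0%N, v; rewrite expr0 mul1r fps_unitE.
have [|m [w [uw vw]]] := IH (Fps (fun n => v n.+1)) vn.
  by apply: contraNneq vn => /(congr1 (fun w : fps K => w n)); rewrite fps_coef0 /= => ->.
by exists m.+1, w; split=> //; rewrite (fpsX_divP v00) vw exprS mulrA.
Qed.

Lemma lpiE : lpi K = tofrac fpsX. Proof. by []. Qed.

Lemma lpi_neq0 : lpi K != 0.
Proof.
rewrite lpiE tofrac_eq0; apply/eqP => /(congr1 (fun w : fps K => w 1%N)) /eqP.
by rewrite fps_coef0 /= oner_eq0.
Qed.

Lemma laurent_frac (x : laurent K) : exists v w : fps K,
  w != 0 /\ x = tofrac v / tofrac w.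
Proof.
have [v [w [w0 xw]]] : exists v w : fps K, w != 0 /\ x * tofrac w = tofrac v.
  (* A representative of the class [x] in the quotient of pairs supplies numerator and
     denominator. *)
  rewrite -[x]generic_quotient.reprK; set r := generic_quotient.repr x.
  exists (frac r).1, (frac r).2; split; first exact: denom_ratioP.
  change (FracField.mul (generic_quotient.pi (laurent K) r) (tofrac (frac r).2)
    = tofrac (frac r).1).
  rewrite !generic_quotient.piE; apply/eqP.
  rewrite generic_quotient.piE FracField.equivfE.
  rewrite /FracField.mulf !numden_Ratio ?(oner_eq0, mulf_neq0, denom_ratioP) //.
  by rewrite !mulr1 mulrC.
exists v, w; split=> //; rewrite -xw mulfK //.
by rewrite tofrac_eq0.
Qed.

Lemma laurent_unit_mod (x : laurent K) : x != 0 ->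
  exists (n : int) (w : fps K), w \is a GRing.unit /\ x = tofrac w * lpi K ^ n.
Proof.
have [v [w [w0 ->]]] := laurent_frac x => x0.
have v0 : v != 0 by apply: contraNneq x0 => ->; rewrite tofrac0 mul0r.
have [n [v' [uv ->]]] := fps_unit_mod v0.
have [m [w' [uw ->]]] := fps_unit_mod w0.
exists (n%:Z - m%:Z), (v' / w'); split; first by rewrite unitrM unitrV uv uw.
have w'0 : tofrac w' != 0 by rewrite tofrac_eq0; apply: contraTneq uw => ->; rewrite unitr0.
rewrite expfzDr ?lpi_neq0 // -exprnP -exprnN !tofracM !tofracXn -lpiE.
rewrite (_ : tofrac w'^-1 = (tofrac w')^-1); last first.
  by apply: (mulfI w'0); rewrite divff // -tofracM divrr // tofrac1.
by rewrite invfM mulrACA mulrC.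
Qed.

(** After cancelling [lpi K ^ n], the constant coefficients differ: that of a unit is nonzero. Hence
    the integer chosen in [lval] is unique. *)
Lemma laurent_unit_gt (v w : fps K) (n m : int) : w \is a GRing.unit -> n < m ->
  tofrac w * lpi K ^ n <> tofrac v * lpi K ^ m.
Proof.
move=> uw nm e; have [d dE] : exists d : nat, m - n = d.+1%:Z.
  by exists (`|m - n|%N).-1; lia.
have : w = fpsX ^+ d.+1 * v.
  apply/eqP; rewrite -tofrac_eq tofracM tofracXn -lpiE; apply/eqP.
  have pn : lpi K ^ n != 0 by rewrite expfz_neq0 // lpi_neq0.
  apply: (mulIf pn); rewrite e -(subrK n m) dE expfzDr ?lpi_neq0 // -exprnP.
  by rewrite mulrA [tofrac v * _]mulrC.
by move: uw => /[swap] ->; rewrite fps_unitE fpsX_pow_coef // eqxx.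
Qed.

Lemma lval_unit (w : fps K) (n : int) : w \is a GRing.unit ->
  lval (tofrac w * lpi K ^ n) = n.
Proof.
move=> uw; apply: xget_unique; first by exists w.
move=> m [v uv]; case: (ltgtP n m) => // nm.
  by move/(laurent_unit_gt uw nm).
by move=> /esym/(laurent_unit_gt uv nm).
Qed.

Lemma lval_decomp (x : laurent K) : x != 0 ->
  exists2 w : fps K, w \is a GRing.unit & x = tofrac w * lpi K ^ lval x.
Proof.
move=> /laurent_unit_mod[n [w [uw ->]]]; exists w => //.
by rewrite lval_unit.
Qed.

Lemma laurent_Oinf (x : laurent K) : x = 0 \/ 0 <= lval x -> Oinf x.
Proof.
move=> [->|]; first by exists 0 => //; rewrite tofrac0.
have [->|x0] := eqVneq x 0; first by exists 0 => //; rewrite tofrac0.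
have [w _ xw] := lval_decomp x0 => n0; exists (w * fpsX ^+ `|lval x|) => //.
by rewrite [RHS]xw tofracM tofracXn -lpiE exprnP gez0_abs.
Qed.

Lemma lval_tofrac (v : fps K) : 0 <= lval (tofrac v : laurent K).
Proof.
have [->|v0] := eqVneq v 0.
  rewrite tofrac0; apply/negbNE/negP; rewrite -ltNge /lval.
  case: xgetP => // n _ [w uw /esym/eqP]; rewrite mulf_eq0 => /orP[].
    by rewrite tofrac_eq0 => /eqP w0; rewrite w0 unitr0 in uw.
  by rewrite expfz_eq0 (negbTE lpi_neq0) andbF.
have [n [w [uw ->]]] := fps_unit_mod v0.
by rewrite tofracM tofracXn -lpiE mulrC exprnP lval_unit.
Qed.

End PowerSeries.

(** * The absolute value of F_infty *)

Section AbsInf.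
Variables (R : realType) (Fq : finFieldType) (C : Cinfty R Fq).
Local Notation q := (#|Fq|%:R : R).
Local Notation N := (@absinf R Fq).

Lemma cardq_gt1 : 1 < q.
Proof. by rewrite ltr1n card_finNzRing_gt1. Qed.
Lemma cardq_gt0 : 0 < q.
Proof. exact: lt_trans cardq_gt1. Qed.
Hint Resolve cardq_gt1 cardq_gt0 : core.

Lemma Cemb_is_rmorph : exists f : {rmorphism laurent Fq -> C}, forall x, Cemb C x = f x.
Proof. by exists (Calg_emb C \o Falg_emb C : {rmorphism _ -> _}). Qed.

(** The axioms are pulled back along the embedding into [C], whose [Cabs] extends [absinf]. This is
    why later statements about F_infty alone carry the parameter [C]. *)
Lemma absinf_absval : is_absval N.
Proof.
have h := Cabs_absval C; have [f fE] := Cemb_is_rmorph.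
have e x : N x = Cabs (f x) by rewrite -fE; symmetry; exact: Cabs_ext.
split=> [x|x|x y|x y]; rewrite ?e; first exact: absval_ge0 h _.
- split=> [/(absval_eq0 h)/eqP|->]; first by rewrite fmorph_eq0 => /eqP.
  by rewrite rmorph0; apply/(absval_eq0 h).
- by rewrite rmorphM (absvalM h).
- by rewrite rmorphD; exact: absval_ultra h _ _.
Qed.

Lemma absinf_neq0 (x : laurent Fq) : x != 0 -> N x = q ^ (- lval x).
Proof. by rewrite /absinf => /negbTE ->. Qed.

Lemma absinf_unit (w : fps Fq) (n : int) : w \is a GRing.unit ->
  N (tofrac w * lpi Fq ^ n) = q ^ (- n).
Proof.
move=> uw; rewrite absinf_neq0 ?lval_unit // mulf_neq0 ?expfz_neq0 ?lpi_neq0 //.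
by rewrite tofrac_eq0; apply: contraTneq uw => ->; rewrite unitr0.
Qed.

Lemma absinf_lpi : N (lpi Fq) = q^-1.
Proof. by rewrite -[lpi _]mul1r -tofrac1 -[lpi _]expr1z absinf_unit ?unitr1. Qed.

Lemma absinf_lconst (c : Fq) : c != 0 -> N (lconst c) = 1.
Proof.
move=> c0; rewrite -[lconst c]mulr1 -(expr0z (lpi Fq)) absinf_unit ?expr0z //.
by rewrite fps_unitE.
Qed.

Lemma absinf_tofrac (v : fps Fq) : N (tofrac v) <= 1.
Proof.
have [->|v0] := eqVneq v 0; first by rewrite tofrac0 /absinf eqxx.
rewrite absinf_neq0 ?tofrac_eq0 //.
have : 0 <= lval (tofrac v : laurent Fq) := lval_tofrac v.
case: lval => // n _; rewrite -exprnN.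
by rewrite invf_le1 ?exprn_gt0 // exprn_ege1 // ltW.
Qed.

Lemma absinf_le1 (x : laurent Fq) : N x <= 1 -> Oinf x.
Proof.
have [->|x0] := eqVneq x 0; first by move=> _; apply: laurent_Oinf; left.
rewrite absinf_neq0 // => h; apply: laurent_Oinf; right; move: h.
case: lval => // n; rewrite NegzE opprK -exprnP => h.
by move: h; rewrite leNgt exprn_egt1 ?cardq_gt1.
Qed.

Lemma absinf_le_pow (x : laurent Fq) n : N x <= q ^- n ->
  exists v, x = tofrac (fpsX Fq ^+ n * v).
Proof.
move=> h; have hN := absinf_absval.
have [|v _ vx] := @absinf_le1 (x / lpi Fq ^+ n).
  rewrite (nvf hN) (nvX hN) absinf_lpi exprVn invrK.
  by rewrite -(@ler_pdivlMr _ (q ^+ n)) ?exprn_gt0 // div1r.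
exists v; rewrite tofracM tofracXn -lpiE vx mulrC divfK //.
by rewrite expf_neq0 // lpi_neq0.
Qed.

End AbsInf.

(** * Unordered sums *)

Lemma big_fset_sub (I : choiceType) (K : Type) (idx : K) (op : Monoid.com_law idx)
    (F : I -> K) (S S' : {fset I}) : (S `<=` S')%fset ->
  \big[op/idx]_(i <- S') F i =
    op (\big[op/idx]_(i <- S) F i) (\big[op/idx]_(i <- (S' `\` S)%fset) F i).
Proof.
move=> SS'; rewrite -big_cat; apply: perm_big; apply: uniq_perm.
- exact: fset_uniq.
- rewrite cat_uniq !fset_uniq /= andbT; apply/hasPn => i.
  by rewrite in_fsetD => /andP[].
- move=> i; rewrite mem_cat in_fsetD.
  by case: (boolP (i \in S)) => //= /(fsubsetP SS') ->.
Qed.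

Section UnorderedLimits.
Variables (R : realType) (Fq : finFieldType) (C : Cinfty R Fq).
Local Notation N := (@Cabs R Fq C).
Let hN : is_absval N := Cabs_absval C.
Variable I : choiceType.
Implicit Types (D : set I) (S : {fset I}) (t : I -> C) (s x : C) (e : R).

Lemma fin_lim_eq D (phi : {fset I} -> C) s :
  (forall e, 0 < e -> exists S0, [set` S0] `<=` D /\
     forall S, (S0 `<=` S)%fset -> [set` S] `<=` D -> N (phi S - s) < e) ->
  fin_lim D phi = s.
Proof.
move=> hs; apply: xget_unique => // s' hs'.
apply/eqP; rewrite -subr_eq0 -(nv_eq0 hN); apply: contraT.
rewrite neq_lt ltNge (nv_ge0 hN) /= => e0.
have [S0 [S0D h0]] := hs _ e0; have [S1 [S1D h1]] := hs' _ e0.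
have SD : [set` (S0 `|` S1)%fset] `<=` D.
  by move=> i /=; rewrite in_fsetU => /orP[/S0D|/S1D].
have: N (s' - s) < N (s' - s).
  apply: (nvT_lt hN (y := phi (S0 `|` S1)%fset)).
    by rewrite (nvBC hN); apply: h1 => //; exact: fsubsetUr.
  by apply: h0 => //; exact: fsubsetUl.
by rewrite ltxx.
Qed.

(** Convergence along finite subsets, with the smallness of all remaining terms built in. By the
    ultrametric inequality a single [S] then controls every larger finite sum. *)
Definition has_usum D t s := forall e, 0 < e -> exists S, [/\ [set` S] `<=` D,
  N (\sum_(i <- S) t i - s) < e & forall i, D i -> i \notin S -> N (t i) < e].

Lemma has_usum_fset D t s e : 0 < e -> has_usum D t s ->
  exists S0, [set` S0] `<=` D /\
    forall S, (S0 `<=` S)%fset -> [set` S] `<=` D -> N (\sum_(i <- S) t i - s) < e.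
Proof.
move=> e0 /(_ e e0)[S0 [S0D h0 h1]]; exists S0; split=> // S S0S SD.
rewrite (big_fset_sub _ t S0S) /= addrAC; apply: (nvD_lt hN) => //.
apply: (nv_sum_lt_in hN) => // i; rewrite in_fsetD => /andP[iS0 iS].
by apply: h1 => //; exact: SD.
Qed.

Lemma has_usumP D t s : has_usum D t s -> usum D t = s.
Proof. by move=> h; apply: fin_lim_eq => e e0; exact: has_usum_fset h. Qed.

Lemma has_usum_uniq D t s s' : has_usum D t s -> has_usum D t s' -> s = s'.
Proof. by move=> /has_usumP <- /has_usumP. Qed.

Lemma has_usum_seq D t s (V : nat -> {fset I}) : has_usum D t s ->
  (forall n, [set` V n] `<=` D) ->
  (forall i, D i -> exists n0, forall n, (n0 <= n)%N -> i \in V n) ->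
  abs_cvg N (fun n => \sum_(i <- V n) t i) s.
Proof.
move=> h VD Vex e e0; have [S0 [S0D h0]] := has_usum_fset e0 h.
have [n0 hn0] : exists n0, forall n, (n0 <= n)%N -> (S0 `<=` V n)%fset.
  suff [n0 hn0] : exists n0, forall n i, i \in (S0 : seq I) -> (n0 <= n)%N -> i \in V n.
    by exists n0 => n nn; apply/fsubsetP => i iS; exact: hn0 nn.
  have: forall i, i \in (S0 : seq I) -> D i by move=> i; exact: S0D.
  elim: (S0 : seq I) => [|j r IH] h'; first by exists 0%N.
  have [|n1 h1] := IH; first by move=> i ir; apply: h'; rewrite in_cons ir orbT.
  have [n2 h2] := Vex j (h' j (mem_head _ _)).
  exists (n1 + n2)%N => n i; rewrite in_cons => /orP[/eqP ->|ir] nn.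
    by apply: h2; apply: leq_trans nn; rewrite leq_addl.
  by apply: h1 => //; apply: leq_trans nn; rewrite leq_addr.
by exists n0 => n /hn0 ?; apply: h0.
Qed.

Definition vanishing D t := forall e, 0 < e -> finite_set [set i | D i /\ e <= N (t i)].

(** In a complete ultrametric field it suffices that the terms tend to zero. The finite sets [V n]
    collect the terms of absolute value at least 1/(n+1), so their sums form a Cauchy sequence. *)
Lemma has_usum_ex D t : vanishing D t -> exists s, has_usum D t s.
Proof.
move=> ht; pose V n := fset_set [set i | D i /\ n.+1%:R^-1 <= N (t i)].
have inV n i : (i \in V n) = `[< D i /\ n.+1%:R^-1 <= N (t i) >].
  by rewrite in_fset_set ?in_setE //; apply: ht; rewrite invr_gt0 ltr0Sn.
have VD n : [set` V n] `<=` D by move=> i; rewrite /= inV => /asboolP[].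
have Vmono m n : (m <= n)%N -> (V m `<=` V n)%fset.
  move=> mn; apply/fsubsetP => i; rewrite !inV => /asboolP[Di h].
  apply/asboolP; split=> //; apply: le_trans h.
  by rewrite lef_pV2 ?posrE ?ltr0Sn // ler_nat.
have small n i : D i -> i \notin V n -> N (t i) < n.+1%:R^-1.
  move=> Di; rewrite inV => /asboolPn h; rewrite ltNge; apply/negP => h'.
  by apply: h.
have ex_n e : 0 < e -> exists n : nat, n.+1%:R^-1 < e.
  move=> e0; have [n] := ltr_add_invr e0; rewrite add0r => h; by exists n.
have diff n m : (n <= m)%N -> N (\sum_(i <- V m) t i - \sum_(i <- V n) t i) < n.+1%:R^-1.
  move=> nm; rewrite (big_fset_sub _ _ (Vmono _ _ nm)) /= addrAC subrr add0r.
  apply: (nv_sum_lt_in hN); first by rewrite invr_gt0 ltr0Sn.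
  move=> i; rewrite in_fsetD => /andP[iV iVm]; apply: small => //.
  exact: VD iVm.
have [s hs] : exists s, abs_cvg N (fun n => \sum_(i <- V n) t i) s.
  apply: (@Ccomplete _ _ C) => e /ex_n[n0 hn]; exists n0 => m n m0 n0'.
  apply: (lt_trans _ hn); apply: (nvT_lt hN (diff _ _ m0)).
  by rewrite (nvBC hN) diff.
exists s => e e0; have [n0 h0] := hs _ e0; have [n1 h1] := ex_n _ e0.
exists (V (n0 + n1)%N); split=> //; first by apply: h0; rewrite leq_addr.
move=> i Di iV; apply: lt_trans h1; apply: small => //.
by apply: contra iV => /(fsubsetP (Vmono _ _ (leq_addl n0 n1))).
Qed.

Lemma has_usum_vanishing D t s : has_usum D t s -> vanishing D t.
Proof.
move=> h e /h[S [_ _ hS]]; apply: (@sub_finite_set _ _ [set` S]) => //.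
move=> i [Di ei] /=; apply: contraT => /(hS i Di); by rewrite ltNge ei.
Qed.

Lemma has_usum_le D t s e : 0 <= e -> has_usum D t s ->
  (forall i, D i -> N (t i) <= e) -> N s <= e.
Proof.
move=> e0 h te; rewrite leNgt; apply/negP => es.
have [S [SD hS _]] := h _ (le_lt_trans e0 es).
have : N (\sum_(i <- S) t i) <= e.
  by apply: (nv_sum_le_in hN) => // i iS; apply: te; exact: SD.
by move=> h'; move: hS; rewrite (nvBr hN) ?ltxx // (le_lt_trans h').
Qed.

Lemma has_usumD D t t' s s' : has_usum D t s -> has_usum D t' s' ->
  has_usum D (fun i => t i + t' i) (s + s').
Proof.
move=> h h' e e0; have [S [SD hS1 hS2]] := h _ e0; have [S' [SD' hS1' hS2']] := h' _ e0.
exists (S `|` S')%fset; split.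
- by move=> i /=; rewrite in_fsetU => /orP[/SD|/SD'].
- rewrite big_split /= opprD addrACA; apply: (nvD_lt hN).
    rewrite (big_fset_sub _ _ (fsubsetUl S S')) /= addrAC; apply: (nvD_lt hN) => //.
    apply: (nv_sum_lt_in hN) => // i; rewrite in_fsetD in_fsetU.
    by case/andP => iS /orP[|/SD']; [rewrite (negbTE iS)|move=> Di; apply: hS2].
  rewrite (big_fset_sub _ _ (fsubsetUr S S')) /= addrAC; apply: (nvD_lt hN) => //.
  apply: (nv_sum_lt_in hN) => // i; rewrite in_fsetD in_fsetU.
  by case/andP => iS /orP[/SD|]; [move=> Di; apply: hS2'|rewrite (negbTE iS)].
- move=> i Di; rewrite in_fsetU negb_or => /andP[iS iS'].
  by apply: (nvD_lt hN); [apply: hS2|apply: hS2'].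
Qed.

Lemma has_usumZ D t s a : has_usum D t s -> has_usum D (fun i => a * t i) (a * s).
Proof.
move=> h e e0; have a0 : 0 < N a + 1 by rewrite ltr_wpDl ?(nv_ge0 hN).
have [S [SD h1 h2]] := h _ (divr_gt0 e0 a0).
have key x : N x < e / (N a + 1) -> N (a * x) < e.
  rewrite (nvM hN) ltr_pdivlMr // => h'; apply: le_lt_trans h'.
  by rewrite mulrC; apply: ler_wpM2l; rewrite ?(nv_ge0 hN) // ler_wpDr.
exists S; split=> //; first by rewrite -mulr_sumr -mulrBr; exact: key.
by move=> i Di iS; apply: key; exact: h2.
Qed.

Lemma has_usum_ext D t t' s : (forall i, D i -> t i = t' i) ->
  has_usum D t s -> has_usum D t' s.
Proof.
move=> tt' h e /h[S [SD h1 h2]]; exists S; split=> //.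
  rewrite (_ : \sum_(i <- S) t' i = \sum_(i <- S) t i) // !big_seq.
  by apply: eq_bigr => i /SD /tt'.
by move=> i Di iS; rewrite -tt' // h2.
Qed.

Lemma has_usum0 D : has_usum D (fun=> 0) 0.
Proof.
move=> e e0; exists fset0; split; first by move=> i /=; rewrite in_fset0.
  by rewrite big_seq_fset0 subrr (nv0 hN).
by move=> *; rewrite (nv0 hN).
Qed.

Lemma has_usum_set0 t : has_usum set0 t 0.
Proof. by apply: has_usum_ext (has_usum0 _) => i []. Qed.

Lemma has_usumU D D' t s s' : D `&` D' = set0 -> has_usum D t s ->
  has_usum D' t s' -> has_usum (D `|` D') t (s + s').
Proof.
move=> DD' h h' e e0; have [S [SD hS1 hS2]] := h _ e0; have [S' [SD' hS1' hS2']] := h' _ e0.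
exists (S `|` S')%fset; split.
- by move=> i /=; rewrite in_fsetU => /orP[/SD|/SD']; [left|right].
- rewrite (big_fset_sub _ _ (fsubsetUl S S')) /=.
  rewrite (_ : (S `|` S') `\` S = S')%fset.
    by rewrite opprD addrACA; apply: (nvD_lt hN).
  apply/fsetP => i; rewrite in_fsetD in_fsetU; case: (boolP (i \in S)) => //= iS.
  apply/esym/negP => iS'.
  have : (D `&` D') i by split; [exact: SD|exact: SD'].
  by rewrite DD'.
- move=> i Di; rewrite in_fsetU negb_or => /andP[iS iS'].
  by case: Di => Di; [apply: hS2|apply: hS2'].
Qed.

End UnorderedLimits.

Section Reindex.
Variables (R : realType) (Fq : finFieldType) (C : Cinfty R Fq).
Local Notation N := (@Cabs R Fq C).
Let hN : is_absval N := Cabs_absval C.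

(** Serves both for reindexing the series by Gamma and for passing from the translation group to one
    of its orbits of cosets. *)
Lemma has_usum_image (I J : choiceType) (D : set I) (h : I -> J) (t : J -> C) s :
  {in D &, injective h} -> has_usum D (t \o h) s -> has_usum (h @` D) t s.
Proof.
move=> hi hs e /hs[S [SD h1 h2]]; exists [fset h i | i in S]%fset; split.
- by move=> j /= /imfsetP[i /= iS ->]; exists i => //; exact: SD.
- rewrite big_imfset //= => i j iS jS; apply: hi; rewrite in_setE; exact: SD.
- move=> _ [i Di <-] iS; apply: h2 => //; apply: contra iS => iS.
  by apply/imfsetP; exists i.
Qed.

End Reindex.

(** * The half-plane *)

Lemma fpsX_pow_divP (K : fieldType) (v : fps K) n : (forall i, (i < n)%N -> v i = 0) ->
  exists w, v = fpsX K ^+ n * w.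
Proof.
elim: n v => [|n IH] v h; first by exists v; rewrite expr0 mul1r.
have [|w vw] := IH (Fps (fun i => v i.+1)); first by move=> i ilt; apply: h.
by exists w; rewrite (fpsX_divP (h 0%N isT)) vw mulrA exprS.
Qed.

Section HalfPlane.
Variables (R : realType) (Fq : finFieldType) (C : Cinfty R Fq).
Local Notation q := (#|Fq|%:R : R).
Local Notation Finf := (laurent Fq).
Local Notation N := (@Cabs R Fq C).
Let hN : is_absval N := Cabs_absval C.
Let hF : is_absval (@absinf R Fq) := absinf_absval C.

HB.instance Definition _ := GRing.RMorphism.copy (Cemb C)
  (Calg_emb C \o Falg_emb C).

Lemma Cabs_emb (x : Finf) : N (Cemb C x) = absinf R x.
Proof. exact: Cabs_ext. Qed.

Lemma card_pow_gt (x : R) : exists n, x < q ^+ n.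
Proof.
exists (Num.bound `|x|); apply: (le_lt_trans (ler_norm x)).
apply: (lt_le_trans (archi_boundP (normr_ge0 x))).
rewrite -natrX ler_nat ltnW // ltn_expl //.
exact: card_finNzRing_gt1.
Qed.

Lemma card_powN_lt (e : R) : 0 < e -> exists n, q ^- n < e.
Proof.
move=> e0; have [n h] := card_pow_gt e^-1; exists n.
by rewrite invf_plt ?posrE // exprn_gt0 // cardq_gt0.
Qed.

Lemma absinf_pow_tofrac n (w : fps Fq) : absinf R (tofrac (fpsX Fq ^+ n * w)) <= q ^- n.
Proof.
rewrite tofracM tofracXn -lpiE (nvM hF) (nvX hF) (absinf_lpi R) exprVn.
rewrite ler_piMr ?invr_ge0 ?exprn_ge0 ?ler0n //; exact: (absinf_tofrac R).
Qed.

Lemma imabs_le (z : C) (x : Finf) : imabs z <= N (z - Cemb C x).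
Proof.
apply: ge_inf; last by exists x.
by exists 0 => _ [y _ <-]; exact: (nv_ge0 hN).
Qed.

Lemma imabs_ge (z : C) e : (forall x : Finf, e <= N (z - Cemb C x)) -> e <= imabs z.
Proof.
move=> h; apply: lb_le_inf; first by exists (N (z - Cemb C 0)), 0.
by move=> _ [x _ <-].
Qed.

Lemma Omega_neq (z : C) (x : Finf) : Omega z -> z - Cemb C x != 0.
Proof.
by move=> Oz; rewrite subr_eq0; apply/eqP => zx; apply: Oz; exists x.
Qed.

Lemma OmegaP (z : C) : (forall x : Finf, z - Cemb C x != 0) -> Omega z.
Proof. by move=> h [x _ xz]; have := h x; rewrite xz subrr eqxx. Qed.

Lemma Omega_addr (z : C) (x : Finf) : Omega z -> Omega (z + Cemb C x).
Proof.
move=> Oz; apply: OmegaP => y; rewrite (_ : _ - _ = z - Cemb C (y - x)).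
  exact: (Omega_neq _ Oz).
by rewrite rmorphB opprB addrA.
Qed.

(* F_infty is complete, hence closed in C_infty. *)
Lemma imabs_gt0 (z : C) : Omega z -> 0 < imabs z.
Proof.
move=> Oz; rewrite lt_def imabs_ge ?andbT; last by move=> x; exact: (nv_ge0 hN).
apply/eqP => z0.
have [x hx] : {x : nat -> Finf & forall n, N (z - Cemb C (x n)) < q ^- n}.
  apply: (@choice _ _ (fun n x => N (z - Cemb C x) < q ^- n)) => n.
  have qn : 0 < q ^- n by rewrite invr_gt0 exprn_gt0 // cardq_gt0.
  have hi : has_inf (range (fun x : Finf => N (z - Cemb C x))).
    split; first by exists (N (z - Cemb C 0)), 0.
    by exists 0 => _ [y _ <-]; exact: (nv_ge0 hN).
  have [_ [y _ <-]] := inf_adherent qn hi.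
  by rewrite -/(imabs z) z0 add0r => h; exists y.
have dx m n : (n <= m)%N -> absinf R (x m - x n) <= q ^- n.
  move=> nm; rewrite -Cabs_emb rmorphB (nvBC hN).
  apply: (nvT_le hN (y := z)); first by rewrite (nvBC hN) (ltW (hx _)).
  apply: (le_trans (ltW (hx m))); rewrite lef_pV2 ?posrE ?exprn_gt0 ?cardq_gt0 //.
  by rewrite ler_eXn2l ?cardq_gt1.
have [v hv] : {v : nat -> fps Fq & forall n, x n - x 0%N = tofrac (v n)}.
  apply: (@choice _ _ (fun n v => x n - x 0%N = tofrac v)) => n.
  have [|v vx] := absinf_le_pow C (x := x n - x 0%N) (n := 0%N); first exact: dx.
  by exists v; rewrite vx expr0 mul1r.
have dv m n i : (n <= m)%N -> (i < n)%N -> v m i = v n i.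
  move=> nm ilt; have [w] := absinf_le_pow C (dx _ _ nm).
  rewrite -(subrKA (x 0%N)) hv -opprB hv -tofracB => /eqP; rewrite tofrac_eq => /eqP.
  move=> /(congr1 (fun a : fps Fq => a i)); rewrite fpsX_pow_coef // fps_coefB.
  by move/eqP; rewrite subr_eq0 => /eqP.
(* Coefficient i of [v n] no longer changes once n > i, whence the index i + 1. *)
pose w := Fps (fun i => v i.+1 i).
apply: Oz; exists (x 0%N + tofrac w) => //; apply/eqP.
rewrite eq_sym -subr_eq0 -(nv_eq0 hN); apply: contraT => h.
have {h} : 0 < N (z - Cemb C (x 0%N + tofrac w)) by rewrite lt_def h (nv_ge0 hN).
move=> /card_powN_lt[n]; rewrite ltNge => /negP[].
apply: (nvT_le hN (y := Cemb C (x n))) ; first exact: ltW (hx _).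
rewrite -rmorphB Cabs_emb opprD addrA hv -tofracB.
have [i ilt|u ->] := @fpsX_pow_divP _ (v n - w) n; last exact: absinf_pow_tofrac.
by rewrite fps_coefB /= (dv n i.+1) ?subrr.
Qed.

Lemma Omega_nW n (z : C) : Omega_n n z -> Omega z.
Proof.
move=> [_ h]; apply: OmegaP => x; rewrite -(nv_gt0 hN).
apply: lt_le_trans (imabs_le z x); apply: lt_le_trans h.
by rewrite invr_gt0 exprn_gt0 // cardq_gt0.
Qed.

Lemma Omega_n_ex (z : C) : Omega z -> exists n, Omega_n n z.
Proof.
move=> /imabs_gt0/card_powN_lt[n hn]; have [m hm] := card_pow_gt (N z).
exists (n + m)%N; split.
  apply: (le_trans (ltW hm)); rewrite ler_eXn2l ?cardq_gt1 // leq_addl //.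
apply: le_trans (ltW hn); rewrite lef_pV2 ?posrE ?exprn_gt0 ?cardq_gt0 //.
by rewrite ler_eXn2l ?cardq_gt1 // leq_addr.
Qed.

End HalfPlane.

Lemma scaled_card_powN_lt (R : realType) (Fq : finFieldType) (A d : R) : 0 <= A -> 0 < d ->
  exists n0, forall n, (n0 <= n)%N -> A * (#|Fq|%:R : R) ^- n < d.
Proof.
move=> A0 d0; have A1 : 0 < A + 1 by rewrite ltr_wpDl.
have [n0 hn0] := card_powN_lt Fq (divr_gt0 d0 A1); exists n0 => n nn.
rewrite ltr_pdivlMr // in hn0; apply: le_lt_trans hn0.
rewrite mulrC; apply: ler_pM => //.
- by rewrite lef_pV2 ?posrE ?exprn_gt0 ?cardq_gt0 // ler_eXn2l ?cardq_gt1.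
- by rewrite lerDl.
Qed.

(** * Lattice exponentials *)

Section FiniteSubgroup.
Variables (L : fieldType) (V : seq L).
Hypotheses (uV : uniq V) (V0 : 0 \in V).
Hypothesis VB : forall u v, u \in V -> v \in V -> u - v \in V.

Definition fexp (z : L) : L := z * \prod_(v <- V | v != 0) (1 - z / v).

Let P : {poly L} := \prod_(v <- V) ('X - v%:P).
Let k : L := (\prod_(v <- V | v != 0) - v)^-1.
Let E : {poly L} := k *: P.

Let PE : P = 'X * \prod_(v <- V | v != 0) ('X - v%:P).
Proof. by rewrite /P (bigD1_seq 0) //= polyC0 subr0. Qed.

Let k0 : \prod_(v <- V | v != 0) - v != 0.
Proof. by rewrite prodf_seq_neq0; apply/allP => v vV; apply/implyP; rewrite oppr_eq0. Qed.

Let kE z : k * \prod_(v <- V | v != 0) (z - v) = \prod_(v <- V | v != 0) (1 - z / v).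
Proof.
rewrite /k -prodfV -big_split /=; apply: eq_bigr => v v0.
by rewrite invrN mulNr mulrBr mulVf // opprB mulrC.
Qed.

Let EE z : E.[z] = fexp z.
Proof.
rewrite hornerZ PE hornerM hornerX horner_prod mulrCA.
by congr (_ * _); rewrite -kE; congr (_ * _); apply: eq_bigr => v _; rewrite !hornerE.
Qed.

Let VN v : v \in V -> - v \in V.
Proof. by move=> vV; rewrite -sub0r VB. Qed.
Let VD u v : u \in V -> v \in V -> u + v \in V.
Proof. by move=> uV' vV; rewrite -[v]opprK VB ?VN. Qed.

Let shift_perm u : u \in V -> perm_eq [seq v - u | v <- V] V.
Proof.
move=> uV'; apply: uniq_perm => //; first by rewrite map_inj_uniq //; exact: addIr.
move=> v; apply/mapP/idP => [[w wV ->]|vV]; first exact: VB.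
by exists (v + u); rewrite ?VD // addrK.
Qed.

Let sizeE : size E = (size V).+1.
Proof. by rewrite size_scale ?size_prod_XsubC // invr_eq0. Qed.

Let EperV z u : u \in V -> E.[z + u] = E.[z].
Proof.
move=> uV'; rewrite !hornerZ; congr (_ * _); rewrite /P !horner_prod.
rewrite -[RHS](perm_big _ (shift_perm uV')) /= big_map; apply: eq_bigr => v _.
by rewrite !hornerXsubC opprB addrA addrAC.
Qed.

Let rootV v : v \in V -> E.[v] = 0.
Proof. by move=> vV; rewrite -[v]add0r EperV // EE /fexp mul0r. Qed.

(** The difference of the two sides vanishes on [V], and it has degree below #V because the leading
    terms cancel. *)
Let E_add y : E \Po ('X + y%:P) = E + (E.[y])%:P.
Proof.
apply/eqP; rewrite -subr_eq0; apply/eqP; apply: (@roots_geq_poly_eq0 _ _ V) => //.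
  apply/allP => v vV; rewrite /root !(hornerD, hornerN, horner_comp, hornerC, hornerX).
  by rewrite [v + y]addrC EperV // (rootV vV) add0r subrr.
have sP (Q : {poly L}) : Q \is monic -> size Q = (size V).+1 ->
    forall c, (size V <= c)%N -> Q`_c = (c == size V)%:R.
  move=> mQ sQ c; rewrite leq_eqVlt => /orP[/eqP <-|lt].
    by move/monicP: mQ; rewrite /lead_coef sQ eqxx.
  by rewrite nth_default ?sQ // gtn_eqF.
have EyE : E \Po ('X + y%:P) = k *: \prod_(v <- V) ('X - (v - y)%:P).
  rewrite comp_polyZ; congr (_ *: _); rewrite /P rmorph_prod /=.
  apply: eq_bigr => v _; rewrite comp_polyB comp_polyX comp_polyC polyCB opprB.
  by rewrite -addrA; congr (_ + _); rewrite addrC.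
apply/leq_sizeP => c cV; rewrite EyE !coefE !sP ?monic_prod_XsubC ?size_prod_XsubC //.
have -> : (c == 0%N) = false.
  by apply/eqP => c0; move: cV V0; rewrite c0 leqn0 => /nilP ->.
by rewrite addr0 subrr.
Qed.

Lemma fexpD x y : fexp (x + y) = fexp x + fexp y.
Proof.
have := congr1 (horner^~ x) (E_add y).
by rewrite /= !(hornerD, hornerN, horner_comp, hornerC, hornerX) !EE.
Qed.

Lemma fexp_root v : v \in V -> fexp v = 0.
Proof. by move=> vV; rewrite -EE rootV. Qed.

(** Differentiating the addition formula at 0 gives E'(y) = E'(0), and [k] is the normalization for
    which E'(0) = 1. *)
Let E'1 y : E^`().[y] = 1.
Proof.
have := congr1 (fun p => p^`().[0]) (E_add y).
rewrite deriv_comp derivD derivC addr0 derivD derivX derivC addr0 mulr1.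
rewrite /= !(hornerD, hornerN, horner_comp, hornerC, hornerX) add0r => ->.
rewrite derivZ PE derivM derivX mul1r !hornerE horner_prod.
rewrite -[RHS](mulVf k0); congr (_ * _); apply: eq_bigr => v _.
by rewrite !hornerE.
Qed.

(* With E = fexp as a polynomial, E(X) - E(z) = k prod_v (X - z - v) and E' = 1,
   so the quotients of E(X) - E(z) by the X - z - v sum to 1: compare
   coefficients. *)
Lemma fexp_Goss : exists al : nat -> L, forall z a,
  (forall v, v \in V -> z + v != 0) ->
  fexp z * \sum_(v <- V) (z + v)^-1 ^+ a.+1 =
  (a == 0%N)%:R + \sum_(i < a) al i * \sum_(v <- V) (z + v)^-1 ^+ (a - i).
Proof.
exists (fun i => E`_i.+1) => z a hz.
have zE v : v \in V -> root (E - (fexp z)%:P) (z + v).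
  by move=> vV; rewrite /root !(hornerD, hornerN, horner_comp, hornerC, hornerX) EperV // EE subrr.
have [D hD] : {D : L -> {poly L} &
    forall v, v \in V -> E - (fexp z)%:P = D v * ('X - (z + v)%:P)}.
  apply: (@choice _ _ (fun v d => v \in V -> E - (fexp z)%:P = d * ('X - (z + v)%:P))).
  move=> v; case: (boolP (v \in V)) => [/zE/factor_theorem[d ->]|_]; last by exists 0.
  by exists d.
have sumD : \sum_(v <- V) D v = 1.
  apply/eqP; rewrite -subr_eq0; apply/eqP.
  (* The difference has degree below #V. At z + u every quotient [D v] with v != u vanishes, while
     [D u] takes the value E'(z + u) = 1. *)
  apply: (@roots_geq_poly_eq0 _ _ [seq z + v | v <- V]).
  - apply/allP => _ /mapP[u uV' ->]; rewrite /root !hornerE horner_sum.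
    rewrite (bigD1_seq u) //= big_seq_cond big1 => [|v /andP[vV vu]].
      have := congr1 (fun p => p^`().[z + u]) (hD _ uV').
      rewrite derivB derivC subr0 E'1 derivM derivXsubC mulr1 !hornerE subrr.
      by rewrite mulr0 add0r => <-; rewrite subrr.
    have /eqP := congr1 (horner^~ (z + u)) (hD _ vV).
    have /eqP -> := zE _ uV'; rewrite hornerM hornerXsubC eq_sym mulf_eq0.
    rewrite opprD addrACA subrr add0r subr_eq0 [u == v]eq_sym (negbTE vu) orbF.
    by move/eqP.
  - by rewrite map_inj_uniq //; exact: addrI.
  - rewrite size_map; apply: leq_trans (size_polyD _ _) _; rewrite geq_max.
    rewrite size_polyN size_poly1; apply/andP; split; last by case: (V) V0.
    rewrite big_seq; apply: (big_ind (fun p : {poly L} => size p <= size V)%N).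
    + by rewrite size_poly0.
    + by move=> p p' sp sp'; apply: leq_trans (size_polyD _ _) _; rewrite geq_max sp.
    + move=> v vV; have [->|dv0] := eqVneq (D v) 0; first by rewrite size_poly0.
      have : (size (E - (fexp z)%:P)%R <= (size V).+1)%N.
        apply: leq_trans (size_polyD _ _) _; rewrite geq_max sizeE leqnn.
        by rewrite size_polyN (leq_trans (size_polyC_leq1 _)).
      by rewrite (hD _ vV) size_Mmonic ?monicXsubC // size_XsubC addn2.
have E0 : E`_0 = 0 by rewrite -horner_coef0 EE /fexp mul0r.
(* Division of E(X) - E(z) by X - (z + v), starting from the lowest coefficient: each coefficient of
   the quotient is the previous one minus a coefficient of E, divided by z + v. *)
have dE v : v \in V -> forall b, (D v)`_b = fexp z * (z + v)^-1 ^+ b.+1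
     - \sum_(i < b) E`_i.+1 * (z + v)^-1 ^+ (b - i).
  move=> vV; have y0 := hz _ vV; elim=> [|b IH].
    have := congr1 (fun p : {poly L} => p`_0) (hD _ vV).
    rewrite coefB E0 coefC /= mulrBr coefB coefMX coefMC /= => h.
    rewrite big_ord0 subr0 expr1; apply: (mulIf y0); rewrite divfK //.
    by move: h; rewrite !sub0r => /oppr_inj ->.
  have := congr1 (fun p : {poly L} => p`_b.+1) (hD _ vV).
  rewrite coefB coefC /= subr0 mulrBr coefB coefMX coefMC /= IH => h.
  apply: (mulIf y0); rewrite big_ord_recr /= subSnn expr1.
  have -> : \sum_(i < b) E`_i.+1 * (z + v)^-1 ^+ (b.+1 - i)
      = (\sum_(i < b) E`_i.+1 * (z + v)^-1 ^+ (b - i)) / (z + v).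
    rewrite mulr_suml; apply: eq_bigr => -[i ib] _ /=.
    by rewrite subSn ?(ltnW ib) // exprSr mulrA.
  move: h; rewrite [_ ^+ b.+2]exprSr => h.
  rewrite mulrBl mulrDl mulrA !divfK // h; ring.
have := congr1 (fun p : {poly L} => p`_a) sumD.
rewrite coef1 coef_sum => <-; rewrite mulr_sumr; apply/eqP; rewrite -subr_eq.
under [X in _ - X]eq_bigr do rewrite mulr_sumr.
rewrite exchange_big /= -sumrB; apply/eqP; rewrite big_seq [RHS]big_seq.
by apply: eq_bigr => v vV; rewrite dE.
Qed.

End FiniteSubgroup.

Lemma seq_argmin (R : realType) (T : eqType) (f : T -> R) (s : seq T) x : x \in s ->
  exists2 m, m \in s & forall y, y \in s -> f m <= f y.
Proof.
elim: s x => // y s IH x _; case: s IH => [|z s] IH.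
  by exists y; rewrite ?mem_head // => w; rewrite inE => /eqP ->.
have [m ms hm] := IH z (mem_head _ _).
have [fmy|fym] := leP (f m) (f y).
  exists m; first by rewrite in_cons ms orbT.
  by move=> w; rewrite in_cons => /orP[/eqP ->|/hm].
exists y; first exact: mem_head.
move=> w; rewrite in_cons => /orP[/eqP ->|/hm]; rewrite ?lexx //.
exact: le_trans (ltW fym).
Qed.

Section LatticeExponential.
Variables (R : realType) (Fq : finFieldType) (C : Cinfty R Fq).
Local Notation Finf := (laurent Fq).
Local Notation N := (@Cabs R Fq C).
Local Notation Nf := (@absinf R Fq).
Local Notation emb := (Cemb C).
Let hN : is_absval N := Cabs_absval C.
Let hF : is_absval Nf := absinf_absval C.
Variable B : set Finf.
Hypotheses (B0 : B 0) (BB : forall x y, B x -> B y -> B (x - y)).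
Hypothesis Bdisc : forall M : R, finite_set [set x | B x /\ Nf x <= M].

(** Balls of a discrete subgroup are finite, and they are subgroups by the ultrametric inequality;
    so e is approximated by additive polynomials. *)
Let V n : {fset Finf} := fset_set [set x | B x /\ Nf x <= n%:R].
Let sV n : seq C := [seq emb x | x <- V n].

Let inV n x : (x \in V n) = `[< B x /\ Nf x <= n%:R >].
Proof. by rewrite in_fset_set ?in_setE //; exact: Bdisc. Qed.
Let VB n x : x \in V n -> B x.
Proof. by rewrite inV => /asboolP[]. Qed.
Let V0 n : 0 \in V n.
Proof. by rewrite inV; apply/asboolP; rewrite (nv0 hF) ler0n. Qed.
Let notV n x : B x -> x \notin V n -> n%:R < Nf x.
Proof.
move=> Bx; rewrite inV ltNge => /asboolPn h; apply/negP => h'; exact: h.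
Qed.
Let Vmono m n : (m <= n)%N -> (V m `<=` V n)%fset.
Proof.
move=> mn; apply/fsubsetP => x; rewrite !inV => /asboolP[Bx h]; apply/asboolP.
by split=> //; apply: le_trans h _; rewrite ler_nat.
Qed.

Let usV n : uniq (sV n).
Proof. by rewrite map_inj_uniq ?fset_uniq //; exact: fmorph_inj. Qed.
Let sV0 n : 0 \in sV n.
Proof. by apply/mapP; exists 0; rewrite ?rmorph0 //; exact: V0. Qed.
Let sVB n u v : u \in sV n -> v \in sV n -> u - v \in sV n.
Proof.
move=> /mapP[x xV ->] /mapP[y yV ->]; apply/mapP; exists (x - y); rewrite ?rmorphB //.
move: xV yV; rewrite !inV => /asboolP[Bx hx] /asboolP[By hy]; apply/asboolP.
by split; [exact: BB | apply: (nvB_le hF)].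
Qed.

Let P (S : {fset Finf}) (z : C) := \prod_(x <- S) (1 - z / emb x).

Let fexpE n z : fexp (sV n) z = z * P (V n) z.
Proof.
rewrite /fexp /P big_mkcond big_map; congr (_ * _); apply: eq_bigr => x _.
by case: eqP => // ->; rewrite invr0 mulr0 subr0.
Qed.

Let factor_far z x : N z < Nf x -> N (1 - z / emb x) = 1.
Proof.
move=> zx; have x0 : 0 < Nf x by apply: le_lt_trans zx; exact: (nv_ge0 hN).
rewrite (nvBl hN) (nv1 hN) // (nvf hN) Cabs_emb ltr_pdivrMr // mul1r //.
Qed.

(** Enlarging a ball that already contains all x with |x| <= |z| multiplies by factors 1 - z/x of
    absolute value 1. *)
Let fexp_stab m n z : N z < m%:R -> (m <= n)%N ->
  N (fexp (sV n) z) = N (fexp (sV m) z).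
Proof.
move=> zm mn; rewrite !fexpE !(nvM hN); congr (_ * _).
rewrite /P (big_fset_sub _ _ (Vmono mn)) /= (nvM hN) [X in _ * X](nv_prod hN).
rewrite [X in _ * X]big_seq [X in _ * X]big1 ?mulr1 // => x.
rewrite in_fsetD => /andP[xm /VB Bx]; apply: factor_far.
exact: lt_trans zm (notV Bx xm).
Qed.

Let prod_near1 (S : seq Finf) (F : Finf -> C) e : e <= 1 ->
  (0 <= e) -> (forall x, x \in S -> N (F x) <= e) ->
  N (\prod_(x <- S) (1 - F x) - 1) <= e.
Proof.
move=> e1 e0; elim: S => [|x S IH] h.
  by rewrite big_nil subrr (nv0 hN).
have {}IH : N (\prod_(y <- S) (1 - F y) - 1) <= e.
  by apply: IH => y yS; apply: h; rewrite in_cons yS orbT.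
rewrite big_cons (_ : _ - _ = \prod_(y <- S) (1 - F y) - 1 -
   F x * (1 + (\prod_(y <- S) (1 - F y) - 1))); last by ring.
apply: (nvB_le hN) => //; rewrite (nvM hN) -[e]mulr1; apply: ler_pM.
- exact: (nv_ge0 hN).
- exact: (nv_ge0 hN).
- by apply: h; exact: mem_head.
- by apply: (nvD_le hN); rewrite ?(nv1 hN) // (le_trans IH).
Qed.

Let P_D0 S z : 0 \in S -> P S z = P (S `\ 0)%fset z.
Proof.
by move=> S0; rewrite /P (big_fsetD1 0 S0) /= rmorph0 invr0 mulr0 subr0 mul1r.
Qed.

Lemma eexp_cvg z : abs_cvg N (fun n => fexp (sV n) z) (eexp B z).
Proof.
have [m0 hm0] : exists m0, N z < m0%:R.
  by exists (Num.bound (N z)); apply: archi_boundP; exact: (nv_ge0 hN).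
have m00 : (0 < m0)%N by rewrite -(ltr0n R) (le_lt_trans _ hm0) // (nv_ge0 hN).
pose c := N (P (V m0) z).
(* Each factor beyond the ball of radius m is 1 - z/x with |x| > m, so the extra product is within
   |z|/m of 1; [c] is the common absolute value of the products over balls. *)
have key m S : (m0 <= m)%N -> ((V m `\ 0) `<=` S)%fset -> [set` S] `<=` B `\ 0 ->
    N (P S z - P (V m) z) <= c * (N z / m%:R).
  move=> mm VS SB; have m0' : 0 < m%:R :> R by rewrite ltr0n (leq_trans m00).
  rewrite (P_D0 z (V0 m)) /P (big_fset_sub _ _ VS) /=.
  rewrite -[X in _ - X]mulr1 -mulrBr (nvM hN).
  have -> : N (\prod_(i <- (V m `\ 0)%fset) (1 - z / emb i)) = c.
    rewrite -[X in N X]/(P (V m `\ 0)%fset z) -P_D0 //.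
    have [z0|z0] := eqVneq z 0.
      by rewrite /c z0 /P !big1 // => x _; rewrite mul0r subr0.
    have nz : N z != 0 by rewrite (nv_eq0 hN).
    by apply: (mulfI nz); rewrite -!(nvM hN) -!fexpE (fexp_stab hm0 mm).
  apply: ler_wpM2l; first exact: (nv_ge0 hN).
  apply: prod_near1.
  - rewrite ler_pdivrMr // mul1r (le_trans (ltW hm0)) // ler_nat //.
  - by rewrite divr_ge0 ?(nv_ge0 hN) // ltW.
  - move=> x; rewrite in_fsetD in_fsetD1 negb_and negbK => /andP[xV xS].
    have [Bx x0] := SB _ xS; move/eqP: x0 => x0.
    rewrite (negbTE x0) /= in xV.
    have mx := notV Bx xV; rewrite (nvf hN) Cabs_emb ler_wpM2l ?(nv_ge0 hN) //.
    by rewrite lef_pV2 ?posrE ?(ltW mx) // (lt_trans m0').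
have VDB m : [set` (V m `\ 0)%fset] `<=` B `\ 0.
  by move=> x /=; rewrite in_fsetD1 => /andP[/eqP x0 /VB].
have small e : 0 < e -> exists m, (m0 <= m)%N /\ c * (N z / m%:R) < e.
  move=> e0; pose d := c * N z; exists (m0 + (Num.bound (d / e)).+1)%N; split.
    exact: leq_addr.
  have d0 : 0 <= d / e by rewrite !mulr_ge0 ?(nv_ge0 hN) // invr_ge0 ltW.
  rewrite mulrA ltr_pdivrMr ?ltr0n ?addnS // -ltr_pdivrMl // [_^-1 * _]mulrC.
  apply: lt_le_trans (archi_boundP d0) _; rewrite ler_nat.
  by rewrite ?addnS; apply: leqW; exact: leq_addl.
have [s hs] : exists s, abs_cvg N (fun n => P (V n) z) s.
  apply: (@Ccomplete _ _ C) => e /small[m [mm hm]]; exists m => i j mi mj.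
  have h k : (m <= k)%N -> N (P (V k) z - P (V m) z) < e.
    move=> mk; apply: le_lt_trans hm; rewrite (P_D0 z (V0 k)); apply: key => //.
    by apply: fsetSD; exact: Vmono.
  by apply: (nvT_lt hN (h _ mi)); rewrite (nvBC hN) h.
have -> : eexp B z = z * s.
  congr (_ * _); apply: fin_lim_eq => e e0.
  have [m1 h1] := hs _ e0; have [m2 [h2 h3]] := small _ e0.
  exists (V (m1 + m2) `\ 0)%fset; split=> // S VS SB.
  apply: (nvT_lt hN (y := P (V (m1 + m2)%N) z)); last by apply: h1; exact: leq_addr.
  apply: le_lt_trans (key _ _ _ VS SB) _; first by rewrite (leq_trans h2) // leq_addl.
  apply: le_lt_trans h3; apply: ler_wpM2l; first exact: (nv_ge0 hN).
  apply: ler_wpM2l; first exact: (nv_ge0 hN).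
  by rewrite lef_pV2 ?posrE ?ltr0n ?ler_nat ?leq_addl // ?(leq_trans m00) // (leq_trans h2) // leq_addl.
by apply: abs_cvg_ext (abs_cvgZ hN z hs) => n; rewrite fexpE.
Qed.

Let ex_nat (x : R) : 0 <= x -> exists m : nat, x < m%:R.
Proof. by exists (Num.bound x); apply: archi_boundP. Qed.

Let eexp_norm m z : N z < m%:R -> N (eexp B z) = N (fexp (sV m) z).
Proof.
move=> zm; have h := eexp_cvg z; apply/eqP; rewrite eq_le; apply/andP; split.
  rewrite -[eexp B z]subr0; apply: (abs_cvg_le (n0 := m) hN h) => n mn.
  by rewrite subr0 (fexp_stab zm mn).
have [->|] := eqVneq (fexp (sV m) z) 0; first by rewrite (nv0 hN) (nv_ge0 hN).
rewrite -(nv_gt0 hN) => n0.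
by apply: (abs_cvg_ge hN n0 h); exists m => n mn; rewrite (fexp_stab zm mn).
Qed.

Lemma eexpD (x y : C) : eexp B (x + y) = eexp B x + eexp B y.
Proof.
apply: (abs_cvg_uniq hN (eexp_cvg (x + y))).
apply: abs_cvg_ext (abs_cvgD hN (eexp_cvg x) (eexp_cvg y)) => n.
by rewrite (fexpD (usV n) (sV0 n) (@sVB n)).
Qed.

Lemma eexp_root x : B x -> eexp B (emb x) = 0.
Proof.
move=> Bx; have [m hm] := ex_nat (nv_ge0 hN (emb x)).
apply/eqP; rewrite -(nv_eq0 hN) (eexp_norm hm) (fexp_root (usV m) (sV0 m) (@sVB m)) ?(nv0 hN) //.
apply/mapP; exists x => //; rewrite inV; apply/asboolP; split=> //.
by rewrite -(Cabs_emb C) ltW.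
Qed.

Lemma eexpB (x y : C) : eexp B (x - y) = eexp B x - eexp B y.
Proof. by apply/eqP; rewrite eq_sym subr_eq -eexpD subrK. Qed.

(** Subtract from z a nearest element b of [B], which does not change e. For w = z - b every factor
    satisfies |1 - w/x| >= 1: if |x| <= |w|, minimality gives |w - x| >= |w| >= |x|. Hence |e(z)| >=
    |w|. So e has no zero on Omega, and t is small where |z|_i is large. *)
Lemma eexp_ge_imabs z : imabs z <= N (eexp B z).
Proof.
have [n hn] := ex_nat (nv_ge0 hN z).
have [b bV hb] := seq_argmin (fun x => N (z - emb x)) (V0 n).
have Bb := VB bV; pose w := z - emb b.
have wmin x : B x -> N w <= N (w - emb x).
  move=> Bx; rewrite /w -addrA -opprD -rmorphD.
  have Bxb : B (b + x) by rewrite -[x]opprK -[- x]sub0r; apply: BB => //; exact: BB.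
  case: (boolP (b + x \in V n)) => [/hb //|/(notV Bxb) h].
  have zx : N z < N (emb (b + x)) by rewrite Cabs_emb (lt_trans hn).
  rewrite (nvBr hN zx); apply: (le_trans _ (ltW zx)).
by have := hb 0 (V0 n); rewrite rmorph0 subr0.
have -> : eexp B z = eexp B w by rewrite eexpB eexp_root // subr0.
apply: le_trans (imabs_le z b) _; rewrite -/w.
have [m hm] := ex_nat (nv_ge0 hN w); rewrite (eexp_norm hm) fexpE (nvM hN).
rewrite ler_peMr ?(nv_ge0 hN) // (nv_prod hN) big_seq; apply: (big_ind (fun x : R => 1 <= x)) => //.
  by move=> x y; exact: mulr_ege1.
move=> x /VB Bx; have [wx|xw] := ltP (N w) (Nf x); first by rewrite factor_far.
have [->|x0] := eqVneq x 0; first by rewrite rmorph0 invr0 mulr0 subr0 (nv1 hN).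
have ex0 : emb x != 0 by rewrite fmorph_eq0.
rewrite (_ : 1 - w / emb x = (emb x - w) / emb x); last by rewrite [RHS]mulrBl divff.
rewrite (nvf hN) Cabs_emb ler_pdivlMr ?(nv_gt0 hF) // mul1r (nvBC hN).
exact: le_trans xw (wmin _ Bx).
Qed.

(** By periodicity x may be taken in the ball of radius [K], where |e| is given by a fixed finite
    product with factors at most 1 + [K]/|y|. *)
Lemma eexp_bounded K : (forall x : Finf, exists2 b, B b & Nf (x - b) <= K) ->
  exists K', forall x : Finf, N (eexp B (emb x)) <= K'.
Proof.
move=> hK; have K0 : 0 <= K.
  by have [b _] := hK 0; apply: le_trans; exact: (nv_ge0 hF).
have [m hm] := ex_nat K0.
exists (K * \prod_(x <- V m) (1 + K / Nf x)) => x.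
have [b Bb xb] := hK x.
have -> : eexp B (emb x) = eexp B (emb (x - b)).
  by rewrite rmorphB eexpB (eexp_root Bb) subr0.
have hm' : N (emb (x - b)) < m%:R by rewrite Cabs_emb (le_lt_trans xb).
rewrite (eexp_norm hm') fexpE (nvM hN) (nv_prod hN).
apply: ler_pM; rewrite ?(nv_ge0 hN) ?Cabs_emb //.
  by rewrite -(nv_prod hN) (nv_ge0 hN).
apply: ler_prod => y _; rewrite (nv_ge0 hN) /=.
have h : 0 <= K / Nf y by rewrite divr_ge0 ?(nv_ge0 hF).
apply: (nvB_le hN); first by rewrite (nv1 hN) lerDl.
apply: (@le_trans _ _ (K / Nf y)); last by rewrite lerDr.
by rewrite (nvf hN) !Cabs_emb ler_wpM2r // invr_ge0 (nv_ge0 hF).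
Qed.

(** Since |1 - z/x| = |z - x|/|x|, the absolute value of e(z) sees only the distances from z to
    F_infty. *)
Lemma eexp_norm_eq (z w : C) : (forall x : Finf, N (z - emb x) = N (w - emb x)) ->
  N (eexp B z) = N (eexp B w).
Proof.
move=> zw; have nzw : N z = N w by have := zw 0; rewrite rmorph0 !subr0.
have [m hm] := ex_nat (nv_ge0 hN z); rewrite (eexp_norm hm).
rewrite nzw in hm; rewrite (eexp_norm hm) !fexpE !(nvM hN) nzw; congr (_ * _).
rewrite !(nv_prod hN); apply: eq_bigr => x _.
have [->|x0] := eqVneq x 0; first by rewrite rmorph0 !invr0 !mulr0.
have ex0 : emb x != 0 by rewrite fmorph_eq0.
have e u : 1 - u / emb x = - (u - emb x) / emb x by rewrite mulNr mulrBl divff // opprB.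
by rewrite !e !(nvf hN) !(nvN hN) zw.
Qed.

Definition eis j (z : C) := usum B (fun x => (z + emb x)^-1 ^+ j).

Lemma has_eis j z : Omega z -> has_usum B (fun x => (z + emb x)^-1 ^+ j.+1) (eis j.+1 z).
Proof.
move=> Oz; suff [s hs] : exists s, has_usum B (fun x => (z + emb x)^-1 ^+ j.+1) s.
  by rewrite /eis (has_usumP hs).
apply: has_usum_ex => e e0; pose M := N z + 1 + e^-1.
have e1 : 0 < e^-1 by rewrite invr_gt0.
apply: (@sub_finite_set _ _ _ _ (Bdisc M)) => x [Bx h]; split=> //.
rewrite leNgt; apply/negP => Mx.
have nz := nv_ge0 hN z; rewrite /M in Mx.
have zx : N z < N (emb x) by rewrite Cabs_emb; lra.
have : N ((z + emb x)^-1 ^+ j.+1) < e.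
  rewrite (nvX hN) (nvV hN) addrC (nvDl hN zx) Cabs_emb exprVn.
  rewrite invf_plt ?posrE ?exprn_gt0 //; last by lra.
  apply: (@lt_le_trans _ _ (Nf x)); first lra.
  by rewrite exprS ler_peMr ?exprn_ege1 ?(nv_ge0 hF) //; lra.
by rewrite ltNge h.
Qed.

Let eis_cvg j z : Omega z ->
  abs_cvg N (fun n => \sum_(v <- sV n) (z + v)^-1 ^+ j.+1) (eis j.+1 z).
Proof.
move=> Oz; apply: abs_cvg_ext (has_usum_seq (V := V) (has_eis j Oz) _ _).
- by move=> n; rewrite big_map.
- by move=> n x /VB.
- move=> x Bx; have [m hm] := ex_nat (nv_ge0 hF x); exists m => n mn.
  rewrite inV; apply/asboolP; split=> //.
  by rewrite (le_trans (ltW hm)) // ler_nat.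
Qed.

(** The limit of [fexp_Goss] over growing balls. That its coefficients converge is part of the
    claim; they do not depend on z, and the sample point [z0] serves to solve for them. *)
Lemma eis_Goss (z0 : C) : Omega z0 -> exists be : nat -> C, forall z a, Omega z ->
  eexp B z * eis a.+1 z = (a == 0%N)%:R + \sum_(i < a) be i * eis (a - i) z.
Proof.
move=> O0.
have [al hal] : {al : nat -> nat -> C & forall n (z : C) a,
  (forall v, v \in sV n -> z + v != 0) ->
  fexp (sV n) z * \sum_(v <- sV n) (z + v)^-1 ^+ a.+1 =
  (a == 0%N)%:R + \sum_(i < a) al n i * \sum_(v <- sV n) (z + v)^-1 ^+ (a - i)}.
  apply: (@choice _ _ (fun n (al : nat -> C) => forall (z : C) a,
    (forall v, v \in sV n -> z + v != 0) ->
    fexp (sV n) z * \sum_(v <- sV n) (z + v)^-1 ^+ a.+1 =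
    (a == 0%N)%:R + \sum_(i < a) al i * \sum_(v <- sV n) (z + v)^-1 ^+ (a - i))) => n.
  exact: (fexp_Goss (usV n) (sV0 n) (@sVB n)).
have nz n z : Omega z -> forall v, v \in sV n -> z + v != 0.
  move=> Oz _ /mapP[x _ ->]; have := Omega_neq (- x) Oz.
  by rewrite rmorphN opprK.
have sum_cvg a (F : nat -> nat -> C) (G : nat -> C) z : Omega z ->
    (forall i, (i < a)%N -> abs_cvg N (F^~ i) (G i)) -> forall b, (a <= b)%N ->
    abs_cvg N (fun n => \sum_(i < a) F n i * \sum_(v <- sV n) (z + v)^-1 ^+ (b - i))
      (\sum_(i < a) G i * eis (b - i) z).
  move=> Oz hF' b ab; apply: (abs_cvg_sum hN) => i _; apply: (abs_cvgM hN); first exact: hF'.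
  have : (0 < b - i)%N by rewrite subn_gt0 (leq_trans (ltn_ord i)).
  by case: (b - i)%N => // j _; exact: eis_cvg.
have [be hbe] : {be : nat -> C & forall i, abs_cvg N (al^~ i) (be i)}.
  apply: (@choice _ _ (fun i l => abs_cvg N (al^~ i) l)) => i.
  elim/ltn_ind: i => i IH.
  have [G hG] : {G : nat -> C & forall j, (j < i)%N -> abs_cvg N (al^~ j) (G j)}.
    apply: (@choice _ _ (fun j l => (j < i)%N -> abs_cvg N (al^~ j) l)) => j.
    by case: (ltnP j i) => [/IH[l hl]|_]; [exists l|exists 0].
  (* The identity with a = i + 1 contains the coefficient of index i times the sum of simple poles,
     and e times that sum is 1. Multiplying by e isolates the coefficient in terms of those already
     known to converge. *)
  eexists; apply: (@abs_cvg_ext _ _ _ (fun n => fexp (sV n) z0 *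
    (fexp (sV n) z0 * \sum_(v <- sV n) (z0 + v)^-1 ^+ i.+2
      - \sum_(j < i) al n j * \sum_(v <- sV n) (z0 + v)^-1 ^+ (i.+1 - j)))).
    move=> n; rewrite hal; last exact: nz.
    rewrite big_ord_recr /= subSnn add0r addrAC subrr add0r mulrCA.
    have := hal n z0 0%N (nz n _ O0); rewrite big_ord0 addr0 => ->.
    by rewrite mulr1.
  apply: (abs_cvgM hN (eexp_cvg z0)); apply: (abs_cvgB hN).
    by apply: (abs_cvgM hN (eexp_cvg z0)); exact: eis_cvg.
  exact: sum_cvg hG _ _.
exists be => z a Oz; apply: (abs_cvg_uniq hN (abs_cvgM hN (eexp_cvg z) (eis_cvg a Oz))).
apply: (@abs_cvg_ext _ _ _ (fun n => (a == 0%N)%:R +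
    \sum_(i < a) al n i * \sum_(v <- sV n) (z + v)^-1 ^+ (a - i))).
  by move=> n; rewrite hal //; exact: nz.
by apply: (abs_cvgD hN); [exact: abs_cvg_cst|apply: sum_cvg].
Qed.

End LatticeExponential.

(** * Power series in the cusp parameter *)

Lemma bernoulli_le (R : realType) (d : R) k : 0 <= d -> 1 + k%:R * d <= (1 + d) ^+ k.
Proof.
move=> d0; elim: k => [|k IH]; first by rewrite mul0r addr0 expr0.
apply: (@le_trans _ _ ((1 + d) * (1 + k%:R * d))); last first.
  by rewrite exprS ler_wpM2l // addr_ge0.
have : 0 <= k%:R * d * d by rewrite !mulr_ge0.
by rewrite -natr1; nra.
Qed.

Lemma pow_lt1_small (R : realType) (rho U e : R) : 0 <= rho -> rho < 1 -> 0 <= U ->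
  0 < e -> exists k, rho ^+ k * U < e.
Proof.
move=> r0 r1 U0 e0; have [->|nr] := eqVneq rho 0.
  by exists 1%N; rewrite expr1 mul0r.
have rp : 0 < rho by rewrite lt_def nr.
have [d [d0 dE]] : exists d, 0 < d /\ rho^-1 = 1 + d.
  exists (rho^-1 - 1); split; last by rewrite addrC subrK.
  by rewrite subr_gt0 invf_gt1.
have hU : 0 <= U / e / d by rewrite !mulr_ge0 // invr_ge0 ltW.
exists (Num.bound (U / e / d)); set k := Num.bound _.
have := archi_boundP hU; rewrite -/k ltr_pdivrMr // => hk.
have rk : 0 < rho ^+ k by rewrite exprn_gt0.
have : U / e < (rho ^+ k)^-1.
  rewrite -exprVn dE; apply: lt_le_trans (bernoulli_le k (ltW d0)).
  by apply: lt_trans hk _; rewrite ltrDr.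
by rewrite ltr_pdivrMr // ltr_pdivlMl.
Qed.

Section Interpolation.
Variables (R : realType) (L : fieldType) (N : L -> R).
Hypothesis hN : is_absval N.

(* Newton interpolation at points at mutual distance r. *)
Lemma interp_coef_le (r e : R) (s : seq L) (p : {poly L}) : 0 < r -> 0 <= e ->
  uniq s -> (forall x, x \in s -> N x <= r) ->
  (forall x y, x \in s -> y \in s -> x != y -> N (x - y) = r) ->
  (size p <= size s)%N -> (forall x, x \in s -> N p.[x] <= e) ->
  forall n, N p`_n * r ^+ n <= e.
Proof.
move=> r0; elim: s p e => [|a s IH] p e e0.
  by move=> _ _ _; rewrite leqn0 size_poly_eq0 => /eqP -> _ n; rewrite coef0 (nv0 hN) mul0r.
move=> /= /andP[as_ us] hr hd sp hp n.
have : root (p - p.[a]%:P) a by rewrite /root !hornerE subrr.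
move/factor_theorem => [p1 p1E].
have pE : p = p1 * ('X - a%:P) + p.[a]%:P by rewrite -p1E subrK.
have sp1 : (size p1 <= size s)%N.
  have [->|p10] := eqVneq p1 0; first by rewrite size_poly0.
  have : (size (p1 * ('X - a%:P))%R <= (size s).+1)%N.
    rewrite -p1E (leq_trans (size_polyD _ _)) // geq_max sp size_polyN.
    by rewrite (leq_trans (size_polyC_leq1 _)).
  by rewrite size_Mmonic ?monicXsubC // size_XsubC addn2.
have e1 : 0 <= e / r by rewrite divr_ge0 // ltW.
have hp1 : forall m, N p1`_m * r ^+ m <= e / r.
  apply: (IH p1 _ e1) => //.
  - by move=> x xs; apply: hr; rewrite in_cons xs orbT.
  - by move=> x y xs ys; apply: hd; rewrite in_cons ?xs ?ys orbT.
  - move=> x xs; have xa : x != a by apply: contraNneq as_ => <-.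
    rewrite ler_pdivlMr // -(hd x a) ?mem_head ?in_cons ?xs ?orbT // -(nvM hN).
    have -> : p1.[x] * (x - a) = p.[x] - p.[a].
      by have := congr1 (horner^~ x) p1E; rewrite !hornerE.
    by apply: (nvB_le hN); apply: hp; rewrite in_cons ?eqxx ?xs ?orbT.
have t1 : N (p1`_n * a) * r ^+ n <= e.
  rewrite (nvM hN) mulrAC; apply: (@le_trans _ _ (e / r * r)); last by rewrite divfK ?gt_eqF.
  apply: ler_pM; rewrite ?mulr_ge0 ?(nv_ge0 hN) ?exprn_ge0 ?(ltW r0) //.
  by apply: hr; exact: mem_head.
have rn : 0 < r ^+ n by rewrite exprn_gt0.
rewrite -ler_pdivlMr // pE mulrBr coefD coefB coefMC coefMX coefC.
rewrite -ler_pdivlMr // in t1.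
case: n t1 rn => [|n] t1 rn /=.
  apply: (nvD_le hN); last by rewrite expr0 divr1; apply: hp; exact: mem_head.
  by rewrite sub0r (nvN hN).
rewrite addr0; apply: (nvB_le hN) => //.
rewrite ler_pdivlMr // exprSr mulrA.
by rewrite -ler_pdivlMr.
Qed.

End Interpolation.

(** * Points of C_infty at prescribed distances *)

Section Circle.
Variables (R : realType) (Fq : finFieldType) (C : Cinfty R Fq).
Local Notation q := (#|Fq|%:R : R).
Local Notation Finf := (laurent Fq).
Local Notation N := (@Cabs R Fq C).
Local Notation Nf := (@absinf R Fq).
Local Notation emb := (Cemb C).
Let hN : is_absval N := Cabs_absval C.
Let hF : is_absval Nf := absinf_absval C.
Local Notation K := (Falg C).

Lemma Falg_split (p : {poly K}) : p \is monic -> exists s, p = \prod_(x <- s) ('X - x%:P).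
Proof.
move: {2}(size p) (leqnn (size p)) => n; elim: n p => [|n IH] p sp mp.
  by move: sp (monic_neq0 mp); rewrite leqn0 size_poly_eq0 => ->.
have [s1|s1] := eqVneq (size p) 1%N.
  exists [::]; rewrite big_nil; have pE := size1_polyC (eq_leq s1).
  by move/monicP: mp; rewrite pE lead_coefC => ->.
have [x /factor_theorem[p1 pE]] := PreClosedField.closed_rootP (@Falg_closed _ _ C) p s1.
have mp1 : p1 \is monic by move: mp; rewrite pE monicMr // monicXsubC.
have [|s p1E] := IH p1 _ mp1.
  by move: sp; rewrite pE size_Mmonic ?monicXsubC ?monic_neq0 // size_XsubC addn2.
by exists (x :: s); rewrite big_cons -p1E pE mulrC.
Qed.

(** Translation by 1 permutes [Fq], so adding q copies of 1 leaves the sum of all elements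
    unchanged. *)
Lemma card_natr0 (L : nzRingType) (f : {rmorphism laurent Fq -> L}) : #|Fq|%:R = 0 :> L.
Proof.
have h : #|Fq|%:R = 0 :> Fq.
  have /eqP : \sum_(x : Fq) (x + 1) = \sum_(x : Fq) x.
    rewrite [RHS](reindex (fun x : Fq => x + 1)) //; exists (fun x => x - 1) => x _.
      by rewrite addrK.
    by rewrite subrK.
  by rewrite big_split /= -subr_eq0 addrAC subrr add0r sumr_const => /eqP.
have fc n : n%:R = fps_const (n%:R : Fq) :> fps Fq.
  apply: fpsP => i; elim: n => [|n IH]; first by case: i.
  rewrite -natr1 fps_coefD IH fps_coef1 -natr1 /=.
  by case: ifP => _ //; rewrite addr0.
rewrite -(rmorph_nat f) -[#|Fq|%:R](rmorph_nat (@tofrac (fps Fq))) fc h.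
have -> : fps_const (0 : Fq) = 0 by [].
by rewrite !rmorph0.
Qed.

(* Nonzero roots of X^m - X for m a power of the characteristic; all of its
   roots form a field. *)
Lemma circle_roots n : exists s : seq C, [/\ uniq s, size s = n,
  forall x, x \in s -> N x = 1 &
  forall x y, x \in s -> y \in s -> x != y -> N (x - y) = 1].
Proof.
have [p pK] : exists p, p \in [pchar K].
  apply: (@natf0_pchar _ #|Fq|); first exact: ltnW (card_finNzRing_gt1 _).
  by apply/eqP; exact: (card_natr0 (Falg_emb C)).
have pp : prime p := pcharf_prime pK.
(* The exponent n + 1 leaves at least n nonzero roots. As m is 0 in the field, X^m - X has
   derivative -1, so its roots are distinct. *)
pose m := (p ^ n.+1)%N; have m1 : (1 < m)%N by rewrite -(exp1n n.+1) ltn_exp2r ?prime_gt1.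
pose P : {poly K} := 'X^m - 'X.
have sX : (size ('X : {poly K}) < size ('X^m : {poly K}))%N by rewrite size_polyX size_polyXn.
have sP : size P = m.+1 by rewrite size_polyDl size_polyXn // size_polyN size_polyX.
have mP : P \is monic by rewrite monicE lead_coefDl ?size_polyN // lead_coefXn.
have [s PE] := Falg_split mP.
have us : uniq s.
  rewrite -separable_prod_XsubC -PE unlock derivB derivXn derivX.
  have m0 : m%:R = 0 :> K by rewrite /m natrX (pcharf0 pK) expr0n.
  rewrite -mulr_natr -polyC_natr m0 polyC0 mulr0 sub0r -scaleN1r.
  by rewrite coprimepZr ?coprimep1 // oppr_eq0 oner_eq0.
have ss : size s = m by apply: succn_inj; rewrite -sP PE size_prod_XsubC.
have inS x : (x \in s) = (x ^+ m == x).
  by rewrite -root_prod_XsubC -PE /root !hornerE subr_eq0.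
have pm : [pchar K].-nat m by rewrite pnatX pnatE // pK.
have subS x y : x \in s -> y \in s -> x - y \in s.
  rewrite !inS => /eqP xm /eqP ym.
  have := exprDn_pchar (x - y) y pm; rewrite subrK xm ym => h.
  by apply/eqP; rewrite [in RHS]h addrK.
have mE : m = m.-2.+2 by case: (m) m1 => [|[|]].
have nS x : x \in s -> x != 0 -> N (Calg_emb C x) = 1.
  rewrite inS => /eqP xm x0; apply: (@nv_root1 _ _ _ hN _ m.-2).
  rewrite -rmorphXn (_ : x ^+ m.-2.+1 = 1) ?rmorph1 //.
  by apply: (mulfI x0); rewrite -exprS -mE xm mulr1.
pose s1 := [seq x <- s | x != 0].
have inS1 x : x \in take n [seq Calg_emb C x | x <- s1] ->
    exists2 y, x = Calg_emb C y & (y \in s) && (y != 0).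
  move=> /mem_take/mapP[y]; rewrite mem_filter => /andP[y0 ys] ->.
  by exists y => //; rewrite ys.
exists (take n [seq Calg_emb C x | x <- s1]); split.
- apply: take_uniq; rewrite map_inj_uniq ?filter_uniq //; exact: fmorph_inj.
- rewrite size_takel // size_map /s1 size_filter.
  have := count_predC (pred1 0) s; rewrite count_uniq_mem // ss.
  have -> : count (predC (pred1 0)) s = count (fun x => x != 0) s by apply: eq_count.
  have : (n.+1 < m)%N by rewrite ltn_expl // prime_gt1.
  by case: (0 \in s) => /=; lia.
- by move=> x /inS1[y -> /andP[ys y0]]; exact: nS.
- move=> x y /inS1[x' -> /andP[xs _]] /inS1[y' -> /andP[ys _]] xy.
  rewrite -rmorphB nS ?subS // subr_eq0.
  by apply: contraNneq xy => ->.
Qed.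

(* |y|^2 is an odd power of q. *)
Lemma circle_radius (M : R) : exists y : C, M < N y /\ forall x, N y != Nf x.
Proof.
have [m hm] := card_pow_gt Fq M.
pose c := Falg_emb C ((lpi Fq)^-1 ^+ m.*2.+1).
have [|x] := PreClosedField.closed_rootP (@Falg_closed _ _ C) ('X^2 - c%:P) _.
  by rewrite size_XnsubC.
rewrite /root !hornerE subr_eq0 => /eqP xc; exists (Calg_emb C x).
have q1 := cardq_gt1 R Fq; have q0 := cardq_gt0 R Fq.
have N2 : N (Calg_emb C x) ^+ 2 = q ^+ m.*2.+1.
  rewrite -(nvX hN) -rmorphXn xc -[Calg_emb C c]/(emb _) Cabs_emb (nvX hF) (nvV hF).
  by rewrite absinf_lpi invrK.
split.
  apply: lt_le_trans hm _; rewrite -(@ler_pXn2r _ 2) ?nnegrE ?(nv_ge0 hN) ?exprn_ge0 ?ltW //.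
  by rewrite N2 -exprM muln2 ltr_eXn2l // ltnSn.
move=> z; have [->|z0] := eqVneq z 0.
  rewrite (nv0 hF); apply/eqP => h; move/eqP: N2; rewrite h expr0n /= eq_sym.
  by rewrite expf_eq0 gt_eqF.
apply/eqP => h; move: N2; rewrite h absinf_neq0 // exprnP exprz_exp exprnP.
have q_neq1 : q != 1 by rewrite gt_eqF.
move/(ieexprIz q0 q_neq1); lia.
Qed.

End Circle.

Section CuspSeries.
Variables (R : realType) (Fq : finFieldType) (C : Cinfty R Fq).
Local Notation q := (#|Fq|%:R : R).
Local Notation Finf := (laurent Fq).
Local Notation N := (@Cabs R Fq C).
Local Notation Nf := (@absinf R Fq).
Local Notation emb := (Cemb C).
Let hN : is_absval N := Cabs_absval C.
Let hF : is_absval Nf := absinf_absval C.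
Variable B : set Finf.
Hypotheses (B0 : B 0) (BB : forall x y, B x -> B y -> B (x - y)).
Hypothesis Bdisc : forall M : R, finite_set [set x | B x /\ Nf x <= M].
Local Notation e := (@eexp R Fq C B).
Let t z := (e z)^-1.
Variable r : R.
Hypotheses (r0 : 0 < r) (hr : forall x, N (e (emb x)) * r < 1).

Let e_neq0 z : Omega z -> e z != 0.
Proof.
move=> Oz; rewrite -(nv_gt0 hN); apply: lt_le_trans (imabs_gt0 Oz) _.
exact: eexp_ge_imabs.
Qed.

(** Membership in the Tate algebra of the closed disc |t| <= r. The condition on the coefficients is
    kept apart from the convergence of values because it is what survives limits. *)
Definition tseries (c : nat -> C) (phi : C -> C) :=
  (forall d, 0 < d -> exists n0, forall n, (n0 <= n)%N -> N (c n) * r ^+ n < d) /\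
  forall z, Omega z -> N (e z)^-1 <= r ->
    csum (fun n => c n * (e z)^-1 ^+ n) (phi z).

Lemma tseries_ext c phi psi : (forall z, Omega z -> phi z = psi z) ->
  tseries c phi -> tseries c psi.
Proof. by move=> h [h1 h2]; split=> // z Oz tz; rewrite -h //; exact: h2. Qed.

Let tpow z n (a : C) : N (t z) <= r -> N (a * t z ^+ n) <= N a * r ^+ n.
Proof.
move=> tz; rewrite (nvM hN) (nvX hN) ler_wpM2l ?(nv_ge0 hN) //.
by rewrite lerXn2r ?nnegrE ?(nv_ge0 hN) // ltW.
Qed.

Lemma tseries_cst a : tseries (fun n => if n == 0%N then a else 0) (fun=> a).
Proof.
split=> [d d0|z Oz tz].
  by exists 1%N => -[|n] _ //=; rewrite (nv0 hN) mul0r.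
move=> d d0; exists 1%N => -[|n] _ //.
rewrite big_ord_recl /= expr0 mulr1 big1 ?addr0 ?subrr ?(nv0 hN) // => i _.
by rewrite mul0r.
Qed.

Lemma tseriesD c c' phi phi' : tseries c phi -> tseries c' phi' ->
  tseries (fun n => c n + c' n) (fun z => phi z + phi' z).
Proof.
move=> [h1 h2] [h1' h2']; split=> [d d0|z Oz tz].
  have [n hn] := h1 _ d0; have [m hm] := h1' _ d0; exists (n + m)%N => k nmk.
  have rk : 0 < r ^+ k by rewrite exprn_gt0.
  rewrite -ltr_pdivlMr //; apply: (nvD_lt hN); rewrite ltr_pdivlMr //.
    by apply: hn; rewrite (leq_trans _ nmk) ?leq_addr.
  by apply: hm; rewrite (leq_trans _ nmk) ?leq_addl.
apply: abs_cvg_ext (abs_cvgD hN (h2 _ Oz tz) (h2' _ Oz tz)) => n.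
by rewrite -big_split /=; apply: eq_bigr => i _; rewrite mulrDl.
Qed.

Lemma tseriesZ a c phi : tseries c phi ->
  tseries (fun n => a * c n) (fun z => a * phi z).
Proof.
move=> [h1 h2]; split=> [d d0|z Oz tz].
  have a0 : 0 < N a + 1 by rewrite ltr_wpDl ?(nv_ge0 hN).
  have [n hn] := h1 _ (divr_gt0 d0 a0); exists n => k /hn.
  rewrite ltr_pdivlMr // => h; apply: le_lt_trans h.
  rewrite (nvM hN) -mulrA [N a * _]mulrC ler_wpM2l ?ler_wpDr //.
  by rewrite mulr_ge0 ?(nv_ge0 hN) ?exprn_ge0 // ltW.
apply: abs_cvg_ext (abs_cvgZ hN a (h2 _ Oz tz)) => n.
by rewrite mulr_sumr; apply: eq_bigr => i _; rewrite mulrA.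
Qed.

(* t(z - x) = t(z) / (1 - e(x) t(z)), so that psi = t(z - x) phi satisfies
   psi = t phi + e(x) t psi. *)
Lemma tseries_mul_shift x c phi : tseries c phi ->
  exists d, d 0%N = 0 /\ tseries d (fun z => (e (z - emb x))^-1 * phi z).
Proof.
move=> [h1 h2]; pose E := e (emb x); pose rho := N E * r.
have rho0 : 0 <= rho by rewrite mulr_ge0 ?(nv_ge0 hN) // ltW.
pose d := fix d n := if n is n'.+1 then c n' + E * d n' else 0.
have hd : forall eps, 0 < eps -> exists n0, forall n, (n0 <= n)%N -> N (d n) * r ^+ n < eps.
  move=> eps eps0; have [n0 hn0] := h1 _ (divr_gt0 eps0 r0).
  have U0 : 0 <= N (d n0) * r ^+ n0 by rewrite mulr_ge0 ?(nv_ge0 hN) ?exprn_ge0 // ltW.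
  have [k hk] := pow_lt1_small rho0 (hr x) U0 eps0.
  (* Once |c n| r^n is small, each step of the recursion either lands below eps or is dominated by E
     * d n, which multiplies |d n| r^n by rho < 1. *)
  have key m : N (d (n0 + m)%N) * r ^+ (n0 + m) < eps \/
       N (d (n0 + m)%N) * r ^+ (n0 + m) <= rho ^+ m * (N (d n0) * r ^+ n0).
    elim: m => [|m IH]; first by right; rewrite addn0 expr0 mul1r.
    have s1 : N (c (n0 + m)%N) * r ^+ (n0 + m).+1 < eps.
      by rewrite exprSr mulrA -ltr_pdivlMr // hn0 // leq_addr.
    have s2 : N (E * d (n0 + m)%N) * r ^+ (n0 + m).+1 =
         rho * (N (d (n0 + m)%N) * r ^+ (n0 + m)).
      by rewrite (nvM hN) exprS /rho; ring.
    have rp : 0 < r ^+ (n0 + m).+1 by rewrite exprn_gt0.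
    rewrite addnS /=; have [lt|ge] := ltP (N (E * d (n0 + m)%N) * r ^+ (n0 + m).+1) eps.
      by left; rewrite -ltr_pdivlMr //; apply: (nvD_lt hN); rewrite ltr_pdivlMr.
    right; rewrite addrC (nvDl hN); last first.
      by rewrite -(ltr_pM2r rp) (lt_le_trans s1).
    rewrite s2 exprS -mulrA ler_wpM2l //; case: IH => // IH.
    move: ge; rewrite s2 leNgt => /negP[]; apply: le_lt_trans IH.
    apply: ler_piMl; last exact: ltW (hr x).
    by rewrite mulr_ge0 ?(nv_ge0 hN) ?exprn_ge0 // ltW.
  exists (n0 + k)%N => n nn; have nE : n = (n0 + (n - n0))%N.
    by rewrite subnKC // (leq_trans (leq_addr k n0)).
  have [|] := key (n - n0)%N; rewrite -nE // => h.
  apply: le_lt_trans h _; apply: le_lt_trans hk; apply: ler_wpM2r => //.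
  apply: ler_wiXn2l => //; first exact: ltW (hr x).
  by lia.
exists d; split=> //; split=> // z Oz tz; have ez := e_neq0 Oz.
have [s hs] : exists s, csum (fun n => d n * t z ^+ n) s.
  apply: (series_cvg hN); first exact: (@Ccomplete _ _ C).
  move=> eps /hd[n0 hn]; exists n0 => n /hn; exact: le_lt_trans (tpow _ _ tz).
suff -> : (e (z - emb x))^-1 * phi z = s by exact: hs.
have sE : s = t z * phi z + E * t z * s.
  apply: (abs_cvg_uniq hN (abs_cvg_shift hs)).
  apply: abs_cvg_ext (abs_cvgD hN (abs_cvgZ hN (t z) (h2 _ Oz tz))
    (abs_cvgZ hN (E * t z) hs)) => n.
  rewrite big_ord_recl /= mul0r add0r !mulr_sumr -big_split /=.
  by apply: eq_bigr => i _; rewrite exprS /t; ring.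
have ex : e (z - emb x) = e z - E by rewrite eexpB.
have exn : e z - E != 0 by rewrite -ex; apply: e_neq0; rewrite -rmorphN; exact: Omega_addr.
rewrite ex; apply: (mulfI exn); rewrite mulrA divff // mul1r.
apply: (mulfI (invr_neq0 ez)); rewrite -/(t z) {1}(_ : t z * phi z = s - E * t z * s).
  by rewrite /t mulrBl mulrBr mulrA mulVf // mul1r; ring.
by apply/eqP; rewrite eq_sym subr_eq -sE.
Qed.

(** Induction on the pole order: e(z - x) times the sum is a constant plus sums of lower order.
    Dividing by e(z - x) supplies a factor t, whence [c 0 = 0]. *)
Lemma tseries_eis (z0 : C) x j : Omega z0 ->
  exists c, c 0%N = 0 /\ tseries c (fun z => eis B j.+1 (z - emb x)).
Proof.
move=> O0; have [be hbe] := eis_Goss B0 BB Bdisc O0.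
elim/ltn_ind: j => j IH.
have OB (z : C) : Omega z -> Omega (z - emb x).
  by move=> Oz; rewrite -rmorphN; exact: Omega_addr.
have [c hc] : exists c, tseries c (fun z => (j == 0%N)%:R +
     \sum_(i < j) be i * eis B (j - i) (z - emb x)).
  suff [c hc] : exists c, tseries c (fun z =>
      \sum_(i < j) be i * eis B (j - i) (z - emb x)).
    by eexists; exact: tseriesD (tseries_cst _) hc.
  suff : forall k, (k <= j)%N -> exists c, tseries c (fun z =>
      \sum_(i < k) be i * eis B (j - i) (z - emb x)) by apply.
  elim=> [|k IHk] kj.
    by eexists; apply: tseries_ext (tseries_cst 0) => z _; rewrite big_ord0.
  have [c hc] := IHk (ltnW kj).
  have [|c' [_ hc']] := IH (j - k).-1.
    by rewrite prednK ?subn_gt0 // leq_subr.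
  eexists; apply: tseries_ext (tseriesD hc (tseriesZ (be k) hc')) => z Oz.
  by rewrite big_ord_recr /= prednK // subn_gt0.
have [d [d0 hd]] := tseries_mul_shift x hc; exists d; split=> //.
apply: tseries_ext hd => z Oz; rewrite -hbe ?mulKf //; first exact: e_neq0 (OB _ Oz).
exact: OB.
Qed.

Section Limit.
Variable ys : C -> Prop.
Hypothesis ysO : forall y, ys y -> Omega y.
Hypothesis ysN : forall y, ys y -> N (e y)^-1 = r.
Hypothesis ys_many : forall n, exists s : seq C, [/\ size s = n,
  uniq [seq (e y)^-1 | y <- s], forall y, y \in s -> ys y &
  forall y y', y \in s -> y' \in s -> (e y)^-1 != (e y')^-1 ->
    N ((e y)^-1 - (e y')^-1) = r].

(* Cauchy's estimate, with the maximum over the circle |t| = r replaced by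
   interpolation at arbitrarily many points of that circle. *)
Lemma tseries_coef_le c phi eps : 0 <= eps -> tseries c phi ->
  (forall y, ys y -> N (phi y) <= eps) -> forall n, N (c n) * r ^+ n <= eps.
Proof.
move=> eps0 [h1 h2] hy n; apply/ler_addgt0Pr => d d0.
have ed : 0 < eps + d by rewrite ltr_wpDl.
have [n0 hn0] := h1 _ ed; pose m := (n0 + n.+1)%N.
have [s [ss us sy hs]] := ys_many m.
have -> : c n = (\poly_(i < m) c i)`_n by rewrite coef_poly leq_addl.
apply: (interp_coef_le hN (s := [seq (e y)^-1 | y <- s])) => //; rewrite ?(ltW ed) //.
- by move=> _ /mapP[y /sy yy ->]; rewrite ysN.
- by move=> _ _ /mapP[y ys1 ->] /mapP[y' ys2 ->]; exact: hs.
- by rewrite size_map ss size_poly.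
- move=> _ /mapP[y /sy yy ->]; have hy' := h2 _ (ysO yy) _.
  have ty : N (e y)^-1 <= r by rewrite ysN.
  rewrite horner_poly -[X in N X]opprK (nvN hN) -[X in N X](addKr (phi y)) addrC.
  apply: (nvB_le hN); last by apply: le_trans (hy _ yy) _; rewrite lerDl ltW.
  apply: (series_tail_le hN (ltW ed) (hy' ty)) => k mk.
  apply: le_trans (tpow _ _ ty) _; apply: ltW; apply: hn0.
  by apply: leq_trans mk; rewrite leq_addr.
Qed.

(** Uniform closeness is asked for only on [ys]. There [tseries_coef_le] turns it into closeness of
    the coefficients weighted by r^n, uniformly in n; for other z with |t| <= r, pointwise
    convergence is enough to identify the value of the limit series. *)
Lemma tseries_lim (c : nat -> nat -> C) (phi : nat -> C -> C) (f : C -> C) (eps : nat -> R) :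
  (forall k, 0 <= eps k) ->
  (forall d, 0 < d -> exists k0, forall k, (k0 <= k)%N -> eps k < d) ->
  (forall k, tseries (c k) (phi k) /\ c k 0%N = 0) ->
  (forall k y, ys y -> N (phi k y - f y) <= eps k) ->
  (forall z, Omega z -> N (e z)^-1 <= r -> abs_cvg N (phi^~ z) (f z)) ->
  exists c', tseries c' f /\ c' 0%N = 0.
Proof.
move=> eps0 epsc hc hy hz.
have diff k l d n : 0 <= d -> eps k <= d -> eps l <= d -> N (c k n - c l n) * r ^+ n <= d.
  move=> d0 kd ld.
  have h : tseries (fun n => c k n + -1 * c l n) (fun z => phi k z + -1 * phi l z).
    by apply: tseriesD; [|apply: tseriesZ]; exact: (hc _).1.
  have h' y : ys y -> N (phi k y + -1 * phi l y) <= d.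
    move=> yy; rewrite mulN1r; apply: (nvT_le hN (y := f y)).
      by apply: le_trans kd; exact: hy.
    by rewrite (nvBC hN); apply: le_trans ld; exact: hy.
  by have := tseries_coef_le d0 h h' n; rewrite mulN1r.
have [c' hc'] : {c' : nat -> C & forall n, abs_cvg N (c^~ n) (c' n)}.
  apply: (@choice _ _ (fun n l => abs_cvg N (c^~ n) l)) => n.
  have rn : 0 < r ^+ n by rewrite exprn_gt0.
  apply: (@Ccomplete _ _ C) => d d0; have d2 : 0 < d * r ^+ n / 2 by rewrite divr_gt0 ?mulr_gt0.
  have [k0 hk0] := epsc _ d2; exists k0 => k l kk kl.
  rewrite -(ltr_pM2r rn); apply: (@le_lt_trans _ _ (d * r ^+ n / 2)).
    by apply: diff; rewrite ltW // hk0.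
  by rewrite gtr_pMr ?mulr_gt0 // invf_lt1 // ltr1n.
have close d : 0 < d -> exists k0, forall k n, (k0 <= k)%N -> N (c' n - c k n) * r ^+ n <= d.
  move=> d0; have [k0 hk0] := epsc _ d0; exists k0 => k n kk.
  have rn : 0 < r ^+ n by rewrite exprn_gt0.
  rewrite -ler_pdivlMr //; apply: (abs_cvg_le (n0 := k0) hN (hc' n)) => l kl.
  by rewrite ler_pdivlMr //; apply: diff; rewrite ltW // hk0.
exists c'; split; last first.
  apply: (abs_cvg_uniq hN (hc' 0%N)).
  by apply: abs_cvg_ext (abs_cvg_cst hN 0) => k; rewrite (hc k).2.
split=> [d d0|z Oz tz d d0].
  have d2 : 0 < d / 2 by rewrite divr_gt0.
  have [k0 hk0] := close _ d2; have [n0 hn0] := (hc k0).1.1 _ d0.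
  exists n0 => n nn; have rn : 0 < r ^+ n by rewrite exprn_gt0.
  rewrite -ltr_pdivlMr // -(subrK (c k0 n) (c' n)); apply: (nvD_lt hN).
    rewrite ltr_pdivlMr //; apply: le_lt_trans (hk0 _ _ (leqnn _)) _; lra.
  by rewrite ltr_pdivlMr // hn0.
have d2 : 0 < d / 2 by rewrite divr_gt0.
have [k0 hk0] := close _ d2; have [k1 hk1] := hz _ Oz tz _ d0.
set k := (k0 + k1)%N; have [n0 hn0] := (hc k).1.2 _ Oz tz _ d0.
exists n0 => n nn.
apply: (nvT_lt hN (y := \sum_(j < n) c k j * (e z)^-1 ^+ j)).
  rewrite -sumrB; apply: (@le_lt_trans _ _ (d / 2)); last lra.
  apply: (nv_sum_le hN); first exact: ltW.
  move=> i _; rewrite -mulrBl; apply: le_trans (tpow _ _ tz) _.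
  by apply: hk0; exact: leq_addr.
apply: (nvT_lt hN (y := phi k z)); first exact: hn0.
by apply: hk1; exact: leq_addl.
Qed.

End Limit.
End CuspSeries.

(** * The projective line *)

Section Matrices2.
Variable K : comUnitRingType.

Definition mx2 (a b c d : K) : 'M[K]_2 :=
  \matrix_(i, j) if i == 0 then if j == 0 then a else b else if j == 0 then c else d.

Lemma mx2E00 a b c d : mx2 a b c d 0 0 = a. Proof. by rewrite mxE. Qed.
Lemma mx2E01 a b c d : mx2 a b c d 0 1 = b. Proof. by rewrite mxE. Qed.
Lemma mx2E10 a b c d : mx2 a b c d 1 0 = c. Proof. by rewrite mxE. Qed.
Lemma mx2E11 a b c d : mx2 a b c d 1 1 = d. Proof. by rewrite mxE. Qed.
Definition mx2E := (mx2E00, mx2E01, mx2E10, mx2E11).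

Lemma ord2P (P : 'I_2 -> Prop) : P 0 -> P 1 -> forall i, P i.
Proof.
move=> P0 P1 [[|[|i]] //= h].
  by rewrite (_ : Ordinal h = 0) //; apply: val_inj.
by rewrite (_ : Ordinal h = 1) //; apply: val_inj.
Qed.

Lemma eq_mx2 (A B : 'M[K]_2) : A 0 0 = B 0 0 -> A 0 1 = B 0 1 ->
  A 1 0 = B 1 0 -> A 1 1 = B 1 1 -> A = B.
Proof.
by move=> h00 h01 h10 h11; apply/matrixP => i j; elim/ord2P: i; elim/ord2P: j.
Qed.

Lemma sum_ord2 (V : nmodType) (F : 'I_2 -> V) : \sum_i F i = F 0 + F 1.
Proof.
rewrite !big_ord_recl big_ord0 addr0; congr (F _ + F _); exact: val_inj.
Qed.

Lemma mulmx2 m n (A : 'M[K]_(m, 2)) (B : 'M[K]_(2, n)) i j : (A *m B) i j = A i 0 * B 0 j + A i 1 * B 1 j.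
Proof. by rewrite mxE sum_ord2. Qed.

Lemma det_mx2 (A : 'M[K]_2) : \det A = A 0 0 * A 1 1 - A 0 1 * A 1 0.
Proof.
rewrite (expand_det_row _ 0) sum_ord2 /cofactor !det_mx11 !mxE /=.
rewrite expr0 mul1r expr1 mulN1r mulrN.
by congr (A _ _ * A _ _ - A _ _ * A _ _); exact: val_inj.
Qed.

Lemma mulmx_id2 (A : 'M[K]_2) : A \in unitmx -> forall B, A *m B = 1%:M -> B = invmx A.
Proof. by move=> uA B AB; rewrite -[RHS]mulmx1 -AB mulKmx. Qed.

Lemma invmxM (A B : 'M[K]_2) : A \in unitmx -> B \in unitmx ->
  invmx (A *m B) = invmx B *m invmx A.
Proof.
move=> uA uB; symmetry; apply: mulmx_id2; first by rewrite unitmx_mul uA.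
by rewrite mulmxA mulmxK // mulmxV.
Qed.

Lemma invmx2 (A : 'M[K]_2) : A \in unitmx ->
  invmx A = (\det A)^-1 *: mx2 (A 1 1) (- A 0 1) (- A 1 0) (A 0 0).
Proof.
move=> uA; symmetry; apply: mulmx_id2 => //.
have dA : \det A \is a GRing.unit by rewrite -unitmxE.
have e : A *m mx2 (A 1 1) (- A 0 1) (- A 1 0) (A 0 0) = (\det A)%:M.
  by rewrite det_mx2; apply: eq_mx2; rewrite mulmx2 !mx2E !mxE /=; ring.
by rewrite -scalemxAr e scale_scalar_mx mulVr.
Qed.

End Matrices2.

Lemma mx2_apply_neq0 (K : fieldType) (g : 'M[K]_2) x y :
  g \in unitmx -> (x != 0) || (y != 0) ->
  (g 0 0 * x + g 0 1 * y != 0) || (g 1 0 * x + g 1 1 * y != 0).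
Proof.
move=> ug; rewrite -!negb_and; apply: contra => /andP[/eqP e0 /eqP e1].
pose w : 'cV_2 := \col_i if i == 0 then x else y.
have v0 : g *m w = 0.
  by apply/colP; apply: ord2P; rewrite !mxE sum_ord2 !mxE.
have v : w = 0 by rewrite -[w](mulKmx ug) v0 mulmx0.
have := congr1 (fun w : 'cV_2 => w 0 0) v; rewrite !mxE /= => ->.
have := congr1 (fun w : 'cV_2 => w 1 0) v; rewrite !mxE /= => ->.
by rewrite eqxx.
Qed.

Section ProjectiveLine.
Variable F : fieldType.

(** The point [[x : y]]; the pair (0, 0), which defines no point, is sent to infinity. *)
Definition topt (x y : F) : option F := if y == 0 then None else Some (x / y).

Lemma topt_eq (x y x' y' : F) : (x != 0) || (y != 0) -> (x' != 0) || (y' != 0) ->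
  x * y' = x' * y -> topt x y = topt x' y'.
Proof.
rewrite /topt; have [->|y0] := eqVneq y 0; have [->|y0'] := eqVneq y' 0 => //=.
- by rewrite mulr0 orbF => x0 _ /eqP; rewrite mulf_eq0 (negbTE x0) (negbTE y0').
- by rewrite mulr0 orbF => _ x0 /esym/eqP; rewrite mulf_eq0 (negbTE x0) (negbTE y0).
- by move=> _ _ e; congr Some; apply/eqP; rewrite eqr_div // e.
Qed.

(** Convertible with [mobius]. Over an abstract field the computations never unfold the construction
    of the fraction field. *)
Definition gmobius (g : 'M[F]_2) (x : option F) : option F :=
  let a := g 0 0 in let b := g 0 1 in let c := g 1 0 in let d := g 1 1 in
  match x with
  | None => if c == 0 then None else Some (a / c)
  | Some y => if c * y + d == 0 then None else Some ((a * y + b) / (c * y + d))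
  end.

Lemma gmobius_topt (g : 'M[F]_2) x y : (x != 0) || (y != 0) ->
  gmobius g (topt x y : option F) = topt (g 0 0 * x + g 0 1 * y) (g 1 0 * x + g 1 1 * y).
Proof.
rewrite /topt; have [->|y0] := eqVneq y 0 => /= [|_].
  rewrite orbF => x0; rewrite !mulr0 !addr0 mulf_eq0 (negbTE x0) orbF.
  by case: eqVneq => // c0; congr Some; rewrite -mulf_div divff // mulr1.
have e (u v : F) : u * (x / y) + v = (u * x + v * y) / y.
  by rewrite mulrDl mulfK // mulrA.
rewrite !e mulf_eq0 invr_eq0 (negbTE y0) orbF.
by case: eqVneq => // c0; congr Some; rewrite invf_div mulrA mulfVK.
Qed.

Lemma topt_ex (x : option F) : exists u v, (u != 0) || (v != 0) /\ x = topt u v .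
Proof.
case: x => [y|]; [exists y, 1|exists 1, 0].
  by rewrite oner_eq0 orbT /topt oner_eq0 divr1.
by rewrite oner_eq0 /topt eqxx.
Qed.

Lemma gmobiusM (g h : 'M[F]_2) x : h \in unitmx -> gmobius (g *m h) x = gmobius g (gmobius h x).
Proof.
move=> uh; have [u [v [uv ->]]] := topt_ex x.
rewrite !gmobius_topt ?mx2_apply_neq0 // !mulmx2.
congr topt; rewrite !mulrDr !mulrDl !mulrA; exact: addrACA.
Qed.

Lemma gmobius1 x : gmobius (1%:M : 'M[F]_2) x = x.
Proof.
have [u [v [uv ->]]] := topt_ex x.
by rewrite gmobius_topt // !mxE /= mulr1n mulr0n !mul1r !mul0r addr0 add0r.
Qed.

End ProjectiveLine.

Section Mobius.
Variable Fq : finFieldType.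
Local Notation F := (laurent Fq).
Implicit Types (g h : 'M[F]_2) (x : P1 Fq).

Lemma mobius_topt g (u v : F) : (u != 0) || (v != 0) ->
  mobius g (topt u v) = topt (g 0 0 * u + g 0 1 * v) (g 1 0 * u + g 1 1 * v).
Proof. exact: (@gmobius_topt F g u v). Qed.

Lemma mobiusM g h x : h \in unitmx -> mobius (g *m h) x = mobius g (mobius h x).
Proof. exact: (@gmobiusM F g h x). Qed.

Lemma mobius1 x : mobius (1%:M : 'M[F]_2) x = x.
Proof. exact: (@gmobius1 F x). Qed.

Lemma mobiusK g x : g \in unitmx -> mobius (invmx g) (mobius g x) = x.
Proof. by move=> ug; rewrite -mobiusM // mulVmx // mobius1. Qed.

Lemma mobiusKV g x : g \in unitmx -> mobius g (mobius (invmx g) x) = x.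
Proof. by move=> ug; rewrite -mobiusM ?unitmx_inv // mulmxV // mobius1. Qed.

End Mobius.

(** * The chordal distance and bounds for u(z; a, b) *)

Section Chord.
Variables (R : realType) (Fq : finFieldType) (C : Cinfty R Fq).
Local Notation q := (#|Fq|%:R : R).
Local Notation F := (laurent Fq).
Local Notation N := (@Cabs R Fq C).
Local Notation Nf := (@absinf R Fq).
Local Notation emb := (Cemb C).
Let hN : is_absval N := Cabs_absval C.
Let hF : is_absval Nf := absinf_absval C.

(* Homogeneous coordinates normalized by max(|x|, |y|) = 1. *)
Definition hom0 (x : P1 Fq) : F := if x is Some y then if Nf y <= 1 then y else 1 else 1.
Definition hom1 (x : P1 Fq) : F := if x is Some y then if Nf y <= 1 then 1 else y^-1 else 0.
Definition chord (x y : P1 Fq) : F := hom0 x * hom1 y - hom0 y * hom1 x.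

Lemma hom0_le1 x : Nf (hom0 x) <= 1.
Proof.
case: x => [y|]; last by rewrite -[hom0 None]/1 (nv1 hF).
by rewrite /hom0; case: (leP (Nf y) 1) => y1 //; rewrite (nv1 hF).
Qed.

Lemma hom1_le1 x : Nf (hom1 x) <= 1.
Proof.
case: x => [y|]; last by rewrite -[hom1 None]/0 (nv0 hF) ler01.
rewrite /hom1.
case: (leP (Nf y) 1) => y1; first by rewrite (nv1 hF).
by rewrite (nvV hF) invf_le1 ?(ltW y1) // (lt_trans ltr01).
Qed.

Lemma hom_neq0 x : (hom0 x != 0) || (hom1 x != 0).
Proof.
by case: x => [y|] /=; [case: ifP|]; rewrite oner_neq0 ?orbT.
Qed.

Lemma topt_hom x : topt (hom0 x) (hom1 x) = x.
Proof.
rewrite /topt; case: x => [y|] /=; last by rewrite eqxx.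
case: leP => y1; first by rewrite oner_eq0 divr1.
have y0 : y != 0 by rewrite -(nv_gt0 hF) (lt_trans ltr01).
by rewrite invr_eq0 (negbTE y0) div1r invrK.
Qed.

Lemma chord_neq0 x y : x <> y -> chord x y != 0.
Proof.
move=> xy; apply/eqP => /eqP; rewrite subr_eq0 => /eqP e; apply: xy.
rewrite -(topt_hom x) -(topt_hom y); apply: topt_eq; rewrite ?hom_neq0 //.
Qed.

Lemma chord_le1 x y : Nf (chord x y) <= 1.
Proof.
by apply: (nvB_le hF); rewrite (nvM hF) mulr_ile1 ?(nv_ge0 hF) ?hom0_le1 ?hom1_le1.
Qed.

Definition hden (z : C) x := emb (hom1 x) * z - emb (hom0 x).

Lemma hden_some (z : C) (y : F) : hden z (Some y) = emb (hom1 (Some y)) * (z - emb y).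
Proof.
rewrite /hden /=; case: leP => y1; first by rewrite rmorph1 !mul1r.
have y0 : y != 0 by rewrite -(nv_gt0 hF) (lt_trans ltr01).
by rewrite mulrBr -[emb y^-1 * emb y]rmorphM mulVf.
Qed.

Lemma hden_neq0 z x : Omega z -> hden z x != 0.
Proof.
move=> Oz; case: x => [y|]; last by rewrite /hden /= rmorph0 mul0r sub0r oppr_eq0 rmorph1 oner_eq0.
rewrite hden_some mulf_neq0 ?(Omega_neq _ Oz) // fmorph_eq0 /=.
case: leP => y1; first exact: oner_neq0.
by rewrite invr_eq0 -(nv_gt0 hF) (lt_trans ltr01).
Qed.

Lemma cinv_subE z x : Omega z -> cinv_sub z x = emb (hom1 x) / hden z x.
Proof.
move=> Oz; have := hden_neq0 x Oz; case: x => [y|] /=; last by rewrite rmorph0 mul0r.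
rewrite hden_some mulf_eq0 negb_or => /andP[h0 _].
by rewrite invfM mulrA divff // mul1r.
Qed.

Lemma ufunE z a b : Omega z ->
  ufun z a b = - emb (chord a b) / (hden z a * hden z b).
Proof.
move=> Oz; rewrite /ufun !cinv_subE //.
have := hden_neq0 a Oz; have := hden_neq0 b Oz.
rewrite /chord rmorphB !rmorphM /= /hden.
move: (emb (hom0 a)) (emb (hom1 a)) (emb (hom0 b)) (emb (hom1 b)) => a0 a1 b0 b1.
by move=> hb ha; field; rewrite ha hb.
Qed.

(** For |y| <= 1 the form is z - y, bounded through |z|_i. For |y| > 1 it is (z - y)/y: of absolute
    value 1 if |z| < |y|, and otherwise |y| <= |z| <= q^n costs a second factor [q ^- n]. *)
Lemma hden_ge n z x : Omega_n n z -> q ^- n * q ^- n <= N (hden z x).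
Proof.
move=> [zn iz]; have q0 := cardq_gt0 R Fq; have q1 := cardq_gt1 R Fq.
have qn : 0 < q ^- n by rewrite invr_gt0 exprn_gt0.
have qn1 : q ^- n <= 1 by rewrite invf_le1 ?exprn_gt0 // exprn_ege1 // ltW.
have le1 : q ^- n * q ^- n <= 1 by rewrite mulr_ile1 // ltW.
case: x => [y|]; last first.
  by rewrite /hden /= rmorph0 mul0r sub0r (nvN hN) rmorph1 (nv1 hN).
have iy : q ^- n <= N (z - emb y) := le_trans iz (imabs_le z y).
rewrite hden_some (nvM hN) Cabs_emb /hom1; case: (leP (Nf y) 1) => y1.
  by rewrite (nv1 hF) mul1r; apply: le_trans iy; rewrite ler_piMl // ltW.
have y0 : 0 < Nf y by apply: lt_trans y1.
rewrite (nvV hF); have [zy|yz] := ltP (N z) (Nf y).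
  by rewrite (nvBr hN) Cabs_emb // mulVf ?gt_eqF.
apply: ler_pM => //; rewrite ?(ltW qn) //.
rewrite lef_pV2 ?posrE ?exprn_gt0 //; exact: le_trans yz zn.
Qed.

(** The fourth power arises from two linear forms, each at least [q ^- n * q ^- n]. *)
Lemma ufun_le n z a b : Omega_n n z ->
  N (ufun z a b) <= Nf (chord a b) * (q ^+ n) ^+ 4.
Proof.
move=> Oz; have Oz' := Omega_nW Oz; rewrite ufunE // (nvf hN) (nvN hN) Cabs_emb.
apply: ler_wpM2l; first exact: (nv_ge0 hF).
have qn : 0 < q ^+ n by rewrite exprn_gt0 // cardq_gt0.
have h := ler_pM _ _ (hden_ge a Oz) (hden_ge b Oz).
rewrite -[(q ^+ n) ^+ 4]invrK lef_pV2 ?posrE ?invr_gt0 ?(exprn_gt0 _ qn) //; last first.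
  by rewrite (nv_gt0 hN) mulf_neq0 ?hden_neq0.
rewrite (nvM hN) (_ : ((q ^+ n) ^+ 4)^-1 = q ^- n * q ^- n * (q ^- n * q ^- n)).
  by apply: h; rewrite mulr_ge0 // invr_ge0 ltW.
by rewrite -exprVn; move: (_^-1) => w; ring.
Qed.

Lemma ufun_le_pow n z a b : Omega_n n z -> N (ufun z a b) <= (q ^+ n) ^+ 4.
Proof.
move=> Oz; apply: le_trans (ufun_le _ _ Oz) _.
by rewrite ler_piMl ?chord_le1 // exprn_ge0 // exprn_ge0 // ltW // cardq_gt0.
Qed.

End Chord.

(** * The tree *)

Lemma unitmx_prod (K : comUnitRingType) n (A B : 'M[K]_n) :
  A \in unitmx -> B \in unitmx -> A *m B \in unitmx.
Proof. by move=> uA uB; rewrite unitmx_mul uA. Qed.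

Lemma unitmx_factor (K : comUnitRingType) n (A B : 'M[K]_n) :
  A \in unitmx -> B \in unitmx -> exists D, D \in unitmx /\ B = A *m D.
Proof.
move=> uA uB; exists (invmx A *m B); rewrite mulKVmx //.
by rewrite unitmx_mul unitmx_inv uA.
Qed.

Section Tree.
Variable Fq : finFieldType.
Local Notation F := (laurent Fq).
Local Notation O := (fps Fq).
Local Notation M2 := 'M[F]_2.
Local Notation tof := (@tofrac O).
Local Notation X := (fpsX Fq).
Implicit Types (m g : M2) (h : 'M[O]_2).

Local Notation vtx m := (homothety_class (row_lattice m)).
Local Notation mxO h := (map_mx tof h).

Lemma Oinf_rv (v : 'rV[F]_2) : (forall j, Oinf (v 0 j)) ->
  exists w : 'rV[O]_2, v = map_mx tof w.
Proof.
move=> hv; have [f hf] : {f : 'I_2 -> O & forall j, tof (f j) = v 0 j}.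
  by apply: (@choice _ _ (fun j a => tof a = v 0 j)) => j; have [a _ ?] := hv j; exists a.
by exists (\row_j f j); apply/rowP => j; rewrite !mxE hf.
Qed.

Lemma row_latticeP m (x : 'rV[F]_2) :
  row_lattice m x <-> exists w : 'rV[O]_2, x = map_mx tof w *m m.
Proof.
split=> [[v hv <-]|[w ->]].
  by have [w ->] := Oinf_rv hv; exists w.
by exists (map_mx tof w) => // j; rewrite mxE; exists (w 0 j).
Qed.

Lemma row_lattice_sub h m : row_lattice (mxO h *m m) `<=` row_lattice m.
Proof.
move=> x /row_latticeP[w ->]; apply/row_latticeP; exists (w *m h).
by rewrite map_mxM mulmxA.
Qed.

Lemma row_lattice_unit h m : h \in unitmx -> row_lattice (mxO h *m m) = row_lattice m.
Proof.
move=> uh; apply/seteqP; split; first exact: row_lattice_sub.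
have {1}-> : m = mxO (invmx h) *m (mxO h *m m).
  by rewrite mulmxA -map_mxM mulVmx // map_mx1 mul1mx.
exact: row_lattice_sub.
Qed.

Lemma scale_row_lattice c m : scale_lattice c (row_lattice m) = row_lattice (c *: m).
Proof.
apply/seteqP; split=> [_ [x /row_latticeP[w ->] <-]|x /row_latticeP[w ->]].
  by apply/row_latticeP; exists w; rewrite scalemxAr.
by exists (map_mx tof w *m m); [apply/row_latticeP; exists w|rewrite scalemxAr].
Qed.

Lemma vtx_scale c m : c != 0 -> vtx (c *: m) = vtx m.
Proof.
move=> c0; apply/seteqP; split=> L [d /= d0 <-].
  exists (d * c); first by rewrite /= mulf_neq0.
  by rewrite !scale_row_lattice scalerA.
exists (d / c); first by rewrite /= mulf_neq0 ?invr_eq0.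
by rewrite !scale_row_lattice scalerA divfK.
Qed.

Lemma act_vtx g m : act_vertex g (vtx m) = vtx (m *m invmx g).
Proof.
have act_row m' : [set x *m invmx g | x in row_lattice m'] = row_lattice (m' *m invmx g).
  apply/seteqP; split=> [_ [x /row_latticeP[w ->] <-]|x /row_latticeP[w ->]].
    by apply/row_latticeP; exists w; rewrite mulmxA.
  by exists (map_mx tof w *m m'); [apply/row_latticeP; exists w|rewrite mulmxA].
apply/seteqP; split=> [_ [L [c /= c0 <-] <-]|L [c /= c0 <-]].
  by exists c => //; rewrite !scale_row_lattice act_row scalemxAl.
exists (scale_lattice c (row_lattice m)); first by exists c.
by rewrite !scale_row_lattice act_row scalemxAl.
Qed.

Lemma is_vertex_vtx m : m \in unitmx -> is_vertex (vtx m).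
Proof. by move=> um; exists (row_lattice m) => //; exists m. Qed.

Lemma vtx_self m : vtx m (row_lattice m).
Proof. by exists 1; rewrite /= ?oner_neq0 // scale_row_lattice scale1r. Qed.

Definition stepO : 'M[O]_2 := mx2 X 0 0 1.

Lemma mul_unit_inj m (v w : 'rV[F]_2) : m \in unitmx -> v *m m = w *m m -> v = w.
Proof. by move=> um /(congr1 (mulmx^~ (invmx m))); rewrite !mulmxK. Qed.

Lemma tof_inj : injective tof.
Proof. by move=> a b /eqP; rewrite tofrac_eq => /eqP. Qed.

Lemma fpsX_mul_neq1 (a : O) : X * a != 1.
Proof.
apply/eqP => /(congr1 (fun b : O => b 0%N)); rewrite fpsX_coef0 fps_coef1 => /eqP.
by rewrite eq_sym oner_eq0.
Qed.

Lemma stepO_unit : mxO stepO \in unitmx.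
Proof.
rewrite unitmxE det_map_mx unitfE tofrac_eq0 det_mx2 !mx2E mulr1 mulr0 subr0.
apply/eqP => /(congr1 (fun b : O => b 1%N)); rewrite fps_coef0 /= => /eqP.
by rewrite oner_eq0.
Qed.

Lemma adjacent_step m : m \in unitmx -> Defs.adjacent (vtx m) (vtx (mxO stepO *m m)).
Proof.
move=> um; split; first exact: is_vertex_vtx.
  by apply: is_vertex_vtx; exact: unitmx_prod stepO_unit um.
exists (row_lattice m), (row_lattice (mxO stepO *m m)).
have usm : mxO stepO *m m \in unitmx := unitmx_prod stepO_unit um.
have lpiE' (w : 'rV[O]_2) : lpi Fq *: map_mx tof w = map_mx tof (X *: w).
  by rewrite map_mxZ.
split.
- exact: vtx_self.
- exact: vtx_self.
- rewrite scale_row_lattice; split.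
    move=> x /row_latticeP[w ->]; apply/row_latticeP.
    exists (\row_j if j == 0 then w 0 0 else X * w 0 1).
    rewrite -scalemxAr scalemxAl lpiE' mulmxA -map_mxM; congr (map_mx _ _ *m _).
    by apply/rowP; apply: ord2P; rewrite !mxE sum_ord2 !mxE /=; ring.
  (* Strictness of the first inclusion: the second basis vector of L lies in L' but not in pi L. *)
  move=> h; have /h/row_latticeP[w] :
      row_lattice (mxO stepO *m m) (map_mx tof (\row_j (j == 1)%:R) *m m).
    apply/row_latticeP; exists (\row_j (j == 1)%:R); rewrite mulmxA -map_mxM.
    congr (map_mx _ _ *m _).
    by apply/rowP; apply: ord2P; rewrite !mxE sum_ord2 !mxE /=; ring.
  rewrite -scalemxAr scalemxAl lpiE' => /(mul_unit_inj um)/rowP/(_ 1).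
  rewrite !mxE /= => /tof_inj/esym/eqP; exact/negP/fpsX_mul_neq1.
- split; first exact: row_lattice_sub.
  (* Strictness of the second inclusion: the first basis vector of L does not lie in L'. *)
  move=> h; have /h/row_latticeP[w] : row_lattice m (map_mx tof (\row_j (j == 0)%:R) *m m).
    by apply/row_latticeP; exists (\row_j (j == 0)%:R).
  rewrite mulmxA => /(mul_unit_inj um); rewrite -map_mxM => /rowP/(_ 0).
  rewrite !mxE sum_ord2 !mxE /= mulr0 addr0 mulrC => /tof_inj/esym/eqP.
  exact/negP/fpsX_mul_neq1.
Qed.

Lemma fps_coef0M (a b : O) : (a * b) 0%N = a 0%N * b 0%N.
Proof. by rewrite fps_coefM big_ord_recl big_ord0 addr0. Qed.

(** Modulo pi the matrix is singular, so an invertible column operation makes its first column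
    divisible by pi; dividing that column by pi gives [h']. *)
Lemma singular_step h : (\det h) 0%N = 0 ->
  exists k h', k \in unitmx /\ h *m k = h' *m stepO.
Proof.
move=> d0; suff [k [uk k0 k1]] : exists k : 'M[O]_2, [/\ k \in unitmx,
    ((h *m k) 0 0) 0%N = 0 & ((h *m k) 1 0) 0%N = 0].
  exists k, (mx2 (Fps (fun n => (h *m k) 0 0 n.+1)) ((h *m k) 0 1)
                 (Fps (fun n => (h *m k) 1 0 n.+1)) ((h *m k) 1 1)); split=> //.
  move: k0 k1; move: (h *m k) => A k0 k1.
  apply: eq_mx2; rewrite mulmx2 !mx2E ?mulr0 ?mulr1 ?addr0 ?add0r //.
    by rewrite mulrC -fpsX_divP.
  by rewrite mulrC -fpsX_divP.
move: d0; rewrite det_mx2 fps_coefB !fps_coef0M.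
set p := h 0 0; set q := h 0 1; set r := h 1 0; set s := h 1 1 => d0.
have [q0|q0] := eqVneq (q 0%N) 0; last first.
  exists (mx2 1 0 (fps_const (- p 0%N / q 0%N)) 1); split.
  - by rewrite unitmxE det_mx2 !mx2E mul0r subr0 mulr1 unitr1.
  - by rewrite mulmx2 !mx2E mulr1 fps_coefD fps_coef0M /= mulrC divfK // subrr.
  - rewrite mulmx2 !mx2E mulr1 fps_coefD fps_coef0M /= -/r -/s.
    apply: (mulIf q0); rewrite mul0r mulrDl -mulrA divfK // mulrN.
    by move/eqP: d0; rewrite subr_eq0 => /eqP; rewrite [p _ * _]mulrC => ->; rewrite mulrC subrr.
have [s0|s0] := eqVneq (s 0%N) 0.
  exists (mx2 0 1 1 0); split.
  - by rewrite unitmxE det_mx2 !mx2E mul0r mulr1 sub0r unitrN unitr1.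
  - by rewrite mulmx2 !mx2E mulr1 mulr0 add0r.
  - by rewrite mulmx2 !mx2E mulr1 mulr0 add0r.
exists (mx2 1 0 (fps_const (- r 0%N / s 0%N)) 1); split.
- by rewrite unitmxE det_mx2 !mx2E mul0r subr0 mulr1 unitr1.
- rewrite mulmx2 !mx2E mulr1 fps_coefD fps_coef0M /= -/p -/q q0 mul0r addr0.
  by move: d0; rewrite q0 mul0r subr0 => /eqP; rewrite mulf_eq0 (negbTE s0) orbF => /eqP.
- by rewrite mulmx2 !mx2E mulr1 fps_coefD fps_coef0M /= mulrC divfK // subrr.
Qed.

(** Each use of [singular_step] lowers the valuation of the determinant by one. The factor [k] only
    changes the basis of the starting lattice, and [stepO] applied to the new basis gives a
    neighbour. *)
Lemma walk_vtx n (u : O) h m : m \in unitmx -> u \is a GRing.unit ->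
  \det h = X ^+ n * u -> walk n (vtx m) (vtx (mxO h *m m)).
Proof.
elim: n u h m => [|n IH] u h m um uu dh.
  by rewrite /= row_lattice_unit // unitmxE dh expr0 mul1r.
have [|k [h' [uk hk]]] := @singular_step h.
  by rewrite dh fpsX_pow_coef.
have dk : \det k \is a GRing.unit by rewrite -unitmxE.
have dh' : \det h' = X ^+ n * (u * \det k).
  have X0 : X != 0 by rewrite -tofrac_eq0 -lpiE lpi_neq0.
  apply: (mulIf X0); have := congr1 (fun A => \det A) hk.
  by rewrite /= !det_mulmx dh [\det stepO]det_mx2 !mx2E mulr1 mulr0 subr0 => <-; rewrite exprS; ring.
have mk : mxO k \in unitmx by rewrite unitmxE det_map_mx rmorph_unit.
have [m1 [um1 mE]] := unitmx_factor mk um.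
rewrite mE (row_lattice_unit m1 uk).
have -> : mxO h *m (mxO k *m m1) = mxO h' *m (mxO stepO *m m1).
  by rewrite !mulmxA -!map_mxM hk.
exists (vtx (mxO stepO *m m1)); first exact: adjacent_step.
have us : mxO stepO *m m1 \in unitmx := unitmx_prod stepO_unit um1.
by apply: IH us _ dh'; rewrite unitrM uu.
Qed.

End Tree.

(** * Geodesics and their distance from a vertex *)

Section Geodesics.
Variable Fq : finFieldType.
Local Notation F := (laurent Fq).
Local Notation O := (fps Fq).
Local Notation M2 := 'M[F]_2.
Local Notation tof := (@tofrac O).
Local Notation X := (fpsX Fq).
Local Notation vtx m := (homothety_class (row_lattice m)).
Local Notation mxO h := (map_mx tof h).
Implicit Types (m g : M2) (n : int).

Definition std_mx n : M2 :=
  \matrix_(i, j) if i != j then 0 else if i == 0 then lpi Fq ^ n else 1.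

Lemma std_mxE n : std_mx n = mx2 (lpi Fq ^ n) 0 0 1.
Proof. by apply: eq_mx2; rewrite !mxE. Qed.

Lemma std_mx0 : std_mx 0 = 1%:M.
Proof. by rewrite std_mxE; apply: eq_mx2; rewrite mx2E !mxE. Qed.

Lemma diag_mx2_mul (K : fieldType) (a b : K) : mx2 a 0 0 1 *m mx2 b 0 0 1 = mx2 (a * b) 0 0 1.
Proof. by apply: eq_mx2; rewrite mulmx2 !mx2E; ring. Qed.

Lemma diag_mx2_unit (K : fieldType) (a : K) : a != 0 -> mx2 a 0 0 1 \in unitmx.
Proof. by move=> a0; rewrite unitmxE det_mx2 !mx2E mulr1 mulr0 subr0 unitfE. Qed.

Definition swap_mx (K : comUnitRingType) : 'M[K]_2 := mx2 0 1 1 0.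

Lemma swap_mxK (K : comUnitRingType) : swap_mx K *m swap_mx K = 1%:M.
Proof. by apply: eq_mx2; rewrite mulmx2 !mx2E !mxE /=; ring. Qed.

Lemma swap_mx_unit (K : comUnitRingType) : swap_mx K \in unitmx.
Proof. by case: (mulmx1_unit (swap_mxK K)). Qed.

Lemma invmx_swap (K : comUnitRingType) : invmx (swap_mx K) = swap_mx K.
Proof. by symmetry; apply: mulmx_id2; [exact: swap_mx_unit | exact: swap_mxK]. Qed.

Lemma diag_swap (K : fieldType) (a : K) : a != 0 ->
  mx2 a 0 0 1 *m swap_mx K = swap_mx K *m (a *: mx2 a^-1 0 0 1).
Proof.
by move=> a0; apply: eq_mx2; rewrite !mulmx2 !mxE /=; field.
Qed.

Lemma mxO_stepO : mxO (stepO Fq) = mx2 (lpi Fq) 0 0 1.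
Proof. by apply: eq_mx2; rewrite !mxE /= ?tofrac0 ?tofrac1. Qed.

Lemma std_mx_step n : std_mx (n + 1) = mxO (stepO Fq) *m std_mx n.
Proof.
by rewrite mxO_stepO !std_mxE diag_mx2_mul expfzDr ?lpi_neq0 // expr1z mulrC.
Qed.

Lemma lpiz_neq0 n : lpi Fq ^ n != 0.
Proof. by rewrite expfz_neq0 ?lpi_neq0. Qed.

Lemma std_mx_unit n : std_mx n \in unitmx.
Proof. by rewrite std_mxE; apply: diag_mx2_unit; exact: lpiz_neq0. Qed.

(** If the two lattices were homothetic with ratio c, the second basis vector would force c to be
    integral, and the first would make 1 a multiple of c pi^2. *)
Lemma std_mx_neq2 n m : m \in unitmx ->
  vtx (std_mx n *m m) <> vtx (std_mx (n + 2) *m m).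
Proof.
move=> um e; have := vtx_self (std_mx n *m m); rewrite e => -[c /= c0].
rewrite scale_row_lattice => Le.
pose S := mxO (stepO Fq *m stepO Fq).
have sE : std_mx (n + 2) = S *m std_mx n.
  by rewrite (_ : n + 2 = n + 1 + 1) ?std_mx_step ?mulmxA -?map_mxM // -addrA.
have us := unitmx_prod (std_mx_unit n) um.
have {Le} : row_lattice (c *: (S *m (std_mx n *m m))) = row_lattice (std_mx n *m m).
  by rewrite -Le sE mulmxA.
move: (std_mx n *m m) us => A us Le {e}.
have [w1 h1] : exists w : 'rV[O]_2, map_mx tof (\row_j (j == 0)%:R) *m A = map_mx tof w *m (c *: (S *m A)).
  by apply/row_latticeP; rewrite Le; apply/row_latticeP; exists (\row_j (j == 0)%:R).
have [w2 h2] : exists w : 'rV[O]_2, map_mx tof (\row_j (j == 1)%:R) *m (c *: (S *m A)) = map_mx tof w *m A.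
  by apply/row_latticeP; rewrite -Le; apply/row_latticeP; exists (\row_j (j == 1)%:R).
have SE : S = mx2 (tof (X * X)) 0 0 1.
  rewrite /S; apply: eq_mx2; rewrite mxE mulmx2 !mx2E ?mulr0 ?mul0r ?mulr1 ?addr0 ?add0r ?tofrac0 ?tofrac1 //.
move: h1 h2; rewrite -!scalemxAr !scalemxAl !mulmxA.
move=> /(mul_unit_inj us)/(congr1 (fun v : 'rV_2 => v 0 0)) h1.
move=> /(mul_unit_inj us)/(congr1 (fun v : 'rV_2 => v 0 1)) h2.
have {h2} cE : c = tof (w2 0 1).
  by move: h2; rewrite SE mulmx2 !mxE /= tofrac1 !mulr1 mulr0 add0r.
move: h1; rewrite /= SE mulmx2 !mxE /= mulr0 addr0 cE -!tofracM => /tof_inj/esym/eqP.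
have -> : w2 0 1 * w1 0 0 * (X * X) = X * (w2 0 1 * w1 0 0 * X) by ring.
exact/negP/fpsX_mul_neq1.
Qed.

Lemma act_std_vertex g n : act_vertex g (@std_vertex Fq n) = vtx (std_mx n *m invmx g).
Proof. exact: act_vtx. Qed.

Lemma geodesic_line g a b : g \in unitmx -> mobius g None = b ->
  mobius g (Some 0) = a -> geodesic a b (vtx (invmx g)).
Proof.
move=> ug gb ga; exists (fun n => vtx (std_mx n *m invmx g)), 0.
have ug' : invmx g \in unitmx by rewrite unitmx_inv.
split; last by rewrite std_mx0 mul1mx.
split=> [n|n||].
- rewrite std_mx_step -mulmxA; apply: adjacent_step.
  exact: unitmx_prod (std_mx_unit n) ug'.
- exact: std_mx_neq2.
- have us := swap_mx_unit F; exists (g *m swap_mx F); split.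
  + exact: (unitmx_prod ug us).
  + rewrite (mobiusM _ _ us) -ga; congr mobius.
    by rewrite /mobius !mx2E oner_eq0 mul0r.
  + exists 0%N, 0%N => n; rewrite addn0 act_std_vertex (invmxM ug us) invmx_swap.
    (* The negative half of the line is the image of the standard ray under g times the swap: the
       swap inverts pi^n up to a scalar, which a homothety class ignores, and the swap itself lies
       in GL_2(O). *)
    have ds : mx2 (lpi Fq ^ n%:Z) 0 0 1 *m swap_mx F =
        swap_mx F *m (lpi Fq ^ n%:Z *: mx2 (lpi Fq ^ n%:Z)^-1 0 0 1).
      exact: (diag_swap (lpiz_neq0 n%:Z)).
    rewrite mulmxA (std_mxE n%:Z) ds -scalemxAr -scalemxAl.
    rewrite (vtx_scale _ (lpiz_neq0 n%:Z)) -mulmxA.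
    have <- : mxO (swap_mx O) = swap_mx F.
      by apply: eq_mx2; rewrite !mxE /= ?tofrac0 ?tofrac1.
    by rewrite (row_lattice_unit _ (swap_mx_unit O)) std_mxE invr_expz.
- exists g; split; [exact: ug|exact: gb|].
  by exists 0%N, 0%N => n; rewrite addn0 act_std_vertex.
Qed.

Variables (R : realType) (C : Cinfty R Fq).
Local Notation q := (#|Fq|%:R : R).
Let hF : is_absval (@absinf R Fq) := absinf_absval C.

(* The vertex [h g^-1], with [h] the adjugate of the matrix whose columns are
   the normalized coordinates of [g^-1 b] and [g^-1 a], lies on the geodesic,
   and [det h] is the chord. *)
Lemma dist_geodesic_le g (a b : P1 Fq) k : g \in unitmx -> a <> b ->
  q ^- k <= absinf R (chord R (mobius (invmx g) a) (mobius (invmx g) b)) ->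
  dist_le (act_vertex g (vtx 1%:M)) (geodesic a b) k.
Proof.
move=> ug ab hk; have ug' : invmx g \in unitmx by rewrite unitmx_inv.
set a' := mobius _ a in hk *; set b' := mobius _ b in hk *.
have ga : mobius g a' = a := mobiusKV a ug.
have gb : mobius g b' = b := mobiusKV b ug.
have ab' : a' <> b' by move=> e; apply: ab; rewrite -ga -gb e.
have c0 := chord_neq0 C ab'.
have int x : exists u v : O, tof u = hom0 R x /\ tof v = hom1 R x.
  have [u _ hu] := absinf_le1 (hom0_le1 C x); have [v _ hv] := absinf_le1 (hom1_le1 C x).
  by exists u, v.
have [a0 [a1 [a0E a1E]]] := int a'; have [b0 [b1 [b0E b1E]]] := int b'.
pose P : 'M[O]_2 := mx2 b0 a0 b1 a1.
pose h : 'M[O]_2 := mx2 a1 (- a0) (- b1) b0.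
have dE : \det (mxO P) = - chord R a' b'.
  rewrite det_map_mx det_mx2 !mx2E /chord -a0E -a1E -b0E -b1E -!tofracM -tofracB -tofracN.
  by congr tof; ring.
have dP : \det (mxO P) != 0 by rewrite dE oppr_eq0.
have uP : mxO P \in unitmx by rewrite unitmxE unitfE.
have hP : invmx (mxO P) = (\det (mxO P))^-1 *: mxO h.
  rewrite (invmx2 uP); congr (_ *: _); apply: eq_mx2; rewrite !mxE /= ?tofracN; reflexivity.
have uG := unitmx_prod ug uP.
have GN : mobius (g *m mxO P) None = b.
  rewrite (mobiusM _ _ uP) -gb; congr mobius; rewrite -[RHS](topt_hom C b') /topt -b0E -b1E.
  by rewrite /mobius !mxE.
have G0 : mobius (g *m mxO P) (Some 0) = a.
  rewrite (mobiusM _ _ uP) -ga; congr mobius; rewrite -[RHS](topt_hom C a') /topt -a0E -a1E.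
  by rewrite /mobius !mxE /= !mulr0 !add0r.
exists (vtx (invmx (g *m mxO P))); first exact: (geodesic_line uG GN G0).
rewrite (invmxM ug uP) hP -scalemxAl (vtx_scale _ (invr_neq0 dP)).
rewrite act_vtx mul1mx.
have dh : \det h = \det P by rewrite !det_mx2 !mx2E; ring.
have dP0 : \det P != 0 by move: dP; rewrite det_map_mx tofrac_eq0.
have [n [u [uu dPE]]] := fps_unit_mod dP0.
exists n; last by apply: (walk_vtx ug' uu); rewrite dh.
move: hk; rewrite -(nvN hF) -dE det_map_mx dPE /= tofracM tofracXn mulrC -lpiE [lpi Fq ^+ n]exprnP (absinf_unit _ _ uu).
rewrite -exprnN lef_pV2 ?posrE ?exprn_gt0 ?cardq_gt0 // ler_eXn2l //; exact: cardq_gt1.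
Qed.

End Geodesics.

(** * The ring [Fq[T]] and arithmetic groups *)

(** The form in which finiteness of a coset space is used below: a finite list of
    representatives. *)
Lemma finite_image_reps (T : eqType) (U : choiceType) (D : set T) (f : T -> U) :
  finite_set (f @` D) -> exists s : seq T, (forall y, y \in s -> D y) /\
    forall x, D x -> exists2 y, y \in s & f y = f x.
Proof.
move=> fin; pose S := fset_set (f @` D).
have inS u : (u \in S) = `[< (f @` D) u >] by rewrite in_fset_set // in_setE.
have {inS} hS : forall u, u \in (S : seq U) -> exists2 x, D x & f x = u.
  by move=> u; rewrite inS => /asboolP[x Dx <-]; exists x.
have hD x : D x -> f x \in (S : seq U).
  by move=> Dx; rewrite in_fset_set // in_setE; exists x.
have [s [sD hs]] : exists s : seq T, (forall y, y \in s -> D y) /\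
    forall u, u \in (S : seq U) -> exists2 y, y \in s & f y = u.
  elim: (S : seq U) hS => [|u r IH] hr; first by exists [::].
  have [|s [sD hs]] := IH; first by move=> v vr; apply: hr; rewrite in_cons vr orbT.
  have [x Dx fx] := hr u (mem_head _ _); exists (x :: s); split.
    by move=> y; rewrite in_cons => /orP[/eqP ->|/sD].
  move=> v; rewrite in_cons => /orP[/eqP ->|/hs[y ys <-]].
    by exists x; rewrite ?mem_head.
  by exists y; rewrite // in_cons ys orbT.
by exists s; split=> // x Dx; exact: hs (hD _ Dx).
Qed.

Lemma frac_step (K : fieldType) (c x w p : K) m : x != 0 ->
  (c + x * w) / x ^+ m.+1 - (c * x ^- m.+1 + p) = w / x ^+ m - p.
Proof.
move=> x0; rewrite mulrDl opprD addrACA subrr add0r exprS invfM mulrACA divff //.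
by rewrite mul1r.
Qed.

Section PolynomialRing.
Variables (R : realType) (Fq : finFieldType) (C : Cinfty R Fq).
Local Notation q := (#|Fq|%:R : R).
Local Notation F := (laurent Fq).
Local Notation Nf := (@absinf R Fq).
Let hF : is_absval Nf := absinf_absval C.

Lemma fps_const_is_zmod_morphism : zmod_morphism (@fps_const Fq).
Proof. by move=> x y; apply: fpsP => n; rewrite fps_coefB /=; case: ifP => _; rewrite ?subr0. Qed.
Lemma fps_const_is_monoid_morphism : monoid_morphism (@fps_const Fq).
Proof. by split=> // x y; rewrite fps_constM. Qed.
HB.instance Definition _ := GRing.isZmodMorphism.Build Fq (fps Fq) (@fps_const Fq)
  fps_const_is_zmod_morphism.
HB.instance Definition _ := GRing.isMonoidMorphism.Build Fq (fps Fq) (@fps_const Fq)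
  fps_const_is_monoid_morphism.

Let cst : {rmorphism Fq -> F} := (@tofrac (fps Fq)) \o (@fps_const Fq).

Let AinfE p : Ainf p = (map_poly cst p).[(lpi Fq)^-1].
Proof.
rewrite horner_coef size_map_poly /Ainf; apply: eq_bigr => i _.
by rewrite coef_map.
Qed.

Lemma AinfD : {morph @Ainf Fq : p p' / p + p'}.
Proof. by move=> p p'; rewrite !AinfE rmorphD hornerD. Qed.
Lemma AinfB : {morph @Ainf Fq : p p' / p - p'}.
Proof. by move=> p p'; rewrite !AinfE rmorphB hornerD hornerN. Qed.
Lemma AinfM : {morph @Ainf Fq : p p' / p * p'}.
Proof. by move=> p p'; rewrite !AinfE rmorphM hornerM. Qed.
Lemma AinfC (c : Fq) : Ainf c%:P = lconst c.
Proof. by rewrite AinfE map_polyC hornerC. Qed.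
Lemma AinfX : Ainf ('X : {poly Fq}) = (lpi Fq)^-1.
Proof. by rewrite AinfE map_polyX hornerX. Qed.
Lemma Ainf0 : @Ainf Fq 0 = 0. Proof. by rewrite AinfE rmorph0 horner0. Qed.
Lemma Ainf1 : @Ainf Fq 1 = 1. Proof. by rewrite AinfE rmorph1 hornerC. Qed.

Lemma absinf_Ainf (p : {poly Fq}) : p != 0 -> Nf (Ainf p) = q ^+ (size p).-1.
Proof.
elim/poly_ind: p => [|p c IH]; first by rewrite eqxx.
have [->|p0] := eqVneq p 0.
  rewrite mul0r add0r polyC_eq0 => c0.
  by rewrite AinfC (absinf_lconst R c0) size_polyC c0 expr0.
move=> _; rewrite AinfD AinfM AinfX AinfC size_MXaddC (negbTE p0) /=.
have T : Nf (Ainf p * (lpi Fq)^-1) = q ^+ (size p).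
  rewrite (nvM hF) (nvV hF) absinf_lpi invrK IH // -exprSr prednK //.
  by rewrite lt0n size_poly_eq0.
rewrite (nvDl hF) T //; have q1 := cardq_gt1 R Fq.
have [->|c0] := eqVneq c 0.
  rewrite /lconst rmorph0 -/(cst 0) ?rmorph0 ?(nv0 hF) ?tofrac0 ?(nv0 hF).
  by rewrite exprn_gt0 // cardq_gt0.
by rewrite (absinf_lconst R c0) exprn_egt1 // size_poly_eq0.
Qed.

Lemma absinf_Ainf_ge1 (p : {poly Fq}) : p != 0 -> 1 <= Nf (Ainf p).
Proof. by move=> p0; rewrite absinf_Ainf // exprn_ege1 // ltW // cardq_gt1. Qed.

Lemma Ainf_eq0 (p : {poly Fq}) : (Ainf p == 0) = (p == 0).
Proof.
have [->|p0] := eqVneq p 0; first by rewrite Ainf0 eqxx.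
by apply/negbTE; rewrite -(nv_gt0 hF) (lt_le_trans ltr01) // absinf_Ainf_ge1.
Qed.

Lemma Ainf_inj : injective (@Ainf Fq).
Proof. by move=> p p' e; apply/eqP; rewrite -subr_eq0 -Ainf_eq0 AinfB e subrr. Qed.

Lemma Ainf_discrete (M : R) : finite_set [set x | exists p : {poly Fq}, x = Ainf p /\ Nf x <= M].
Proof.
have [n hn] := card_pow_gt Fq M.
pose P (f : {ffun 'I_n.+1 -> Fq}) : F := Ainf (\poly_(i < n.+1) f (inord i)).
apply: (@sub_finite_set _ _ (P @` [set` enum {ffun 'I_n.+1 -> Fq}])); last first.
  by apply: finite_image; exact: finite_seq.
move=> _ [p [-> pM]]; exists [ffun i : 'I_n.+1 => p`_i]; first by rewrite /= mem_enum.
rewrite /P; congr Ainf; apply/polyP => i; rewrite coef_poly ffunE.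
case: ltnP => h; first by rewrite inordK.
rewrite nth_default //; have [->|p0] := eqVneq p 0; first by rewrite size_poly0.
move: (le_lt_trans pM hn); rewrite absinf_Ainf // ltr_eXn2l ?cardq_gt1 //.
move=> h'; have sp : (0 < size p)%N by rewrite lt0n size_poly_eq0.
move: (size p) h' sp h => k h' sp h. lia.
Qed.

(** The polynomial part of x, peeled off one coefficient at a time by induction on the order of the
    pole. *)
Lemma Ainf_approx (x : F) : exists p : {poly Fq}, Nf (x - Ainf p) <= 1.
Proof.
have [->|x0] := eqVneq x 0; first by exists 0; rewrite Ainf0 subr0 (nv0 hF).
have [w _ ->] := lval_decomp x0; case: (lval x) => n.
  exists 0; rewrite Ainf0 subr0 -exprnP lpiE -tofracXn -tofracM.
  exact: absinf_tofrac.
rewrite NegzE -exprnN; elim: n.+1 w => {x x0} [|m IH] w.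
  by exists 0; rewrite Ainf0 subr0 expr0 invr1 mulr1; exact: absinf_tofrac.
pose c := w 0%N; have [p hp] := IH (Fps (fun n => w n.+1)); exists (c *: 'X^(m.+1) + p).
have -> : w = fps_const c + fpsX Fq * Fps (fun n => w n.+1).
  apply: fpsP => -[|i]; rewrite fps_coefD ?fpsX_coef0 ?fpsX_coefS /= ?addr0 ?add0r //.
have AX k : Ainf ('X^k : {poly Fq}) = (lpi Fq) ^- k.
  elim: k => [|k IHk]; first by rewrite !expr0 Ainf1 invr1.
  by rewrite !exprS AinfM IHk AinfX invfM.
move: hp; rewrite -mul_polyC AinfD AinfM AinfC AX tofracD tofracM.
by rewrite (@frac_step F (tofrac (fps_const c)) (lpi Fq) _ _ _ (lpi_neq0 Fq)).
Qed.

Lemma Fsub_mul (x y : F) : Fsub x -> Fsub y -> Fsub (x * y).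
Proof.
move=> [p [d [d0 ->]]] [p' [d' [d0' ->]]]; exists (p * p'), (d * d').
by rewrite mulf_neq0 // !AinfM mulf_div.
Qed.

Lemma Fsub_sub (x y : F) : Fsub x -> Fsub y -> Fsub (x - y).
Proof.
move=> [p [d [d0 ->]]] [p' [d' [d0' ->]]]; exists (p * d' - p' * d), (d * d').
rewrite mulf_neq0 // !AinfB !AinfM; split=> //.
by rewrite -mulNr addf_div ?Ainf_eq0 // mulNr.
Qed.

Lemma Fsub_inv (x : F) : Fsub x -> Fsub x^-1.
Proof.
move=> [p [d [d0 ->]]]; have [->|p0] := eqVneq p 0.
  by exists 0, 1; rewrite oner_neq0 !Ainf0 mul0r invr0 mul0r.
by exists d, p; rewrite p0 invf_div.
Qed.

Lemma Fsub0 : @Fsub Fq 0.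
Proof. by exists 0, 1; rewrite oner_neq0 Ainf0 mul0r. Qed.

Lemma Fsub_denom (s : seq F) : (forall x, x \in s -> Fsub x) ->
  exists2 d : {poly Fq}, d != 0 & forall x, x \in s -> exists p, Ainf d * x = Ainf p.
Proof.
elim: s => [|x s IH] h; first by exists 1; rewrite ?oner_neq0.
have [|d d0 hd] := IH; first by move=> y ys; apply: h; rewrite in_cons ys orbT.
have [p [d' [d0' xE]]] := h x (mem_head _ _); exists (d * d'); first by rewrite mulf_neq0.
move=> y; rewrite in_cons => /orP[/eqP ->|/hd[p' hp']].
  exists (d * p); rewrite xE !AinfM -mulrA; congr (_ * _).
  by rewrite mulrC divfK // Ainf_eq0.
exists (d' * p'); by rewrite !AinfM -hp' mulrA [Ainf d * _]mulrC.
Qed.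

End PolynomialRing.

(** * Unipotent elements fixing a cusp *)

Section UnipotentConjugates.
Variable K : fieldType.
Implicit Types (nu g : 'M[K]_2) (x y : K).

Definition unimx x : 'M[K]_2 :=
  \matrix_(i, j) if i == j then 1 else if i == 0 then x else 0.

(** The unipotent group fixing [nu oo], parametrized additively. It equals [1 + x * cnilp nu], so
    its entries are affine in x; this links translations to polynomial entries. *)
Definition cunip nu x := nu *m unimx x *m invmx nu.
Definition cnilp nu := nu *m mx2 0 1 0 0 *m invmx nu.

Lemma unimxE x : unimx x = 1%:M + x *: mx2 0 1 0 0.
Proof. by apply: eq_mx2; rewrite !mxE /=; ring. Qed.

Lemma unimxD x y : unimx x *m unimx y = unimx (x + y).
Proof. by apply: eq_mx2; rewrite mulmx2 !mxE /=; ring. Qed.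

Lemma unimx0 : unimx 0 = 1%:M.
Proof. by apply: eq_mx2; rewrite !mxE. Qed.

Lemma unimx_det x : \det (unimx x) = 1.
Proof. by rewrite det_mx2 !mxE /=; ring. Qed.

Lemma unimx_unit x : unimx x \in unitmx.
Proof. by rewrite unitmxE unimx_det unitr1. Qed.

Lemma cunipD nu x y : nu \in unitmx -> cunip nu x *m cunip nu y = cunip nu (x + y).
Proof. by move=> un; rewrite /cunip !mulmxA mulmxKV // -[nu *m _ *m _]mulmxA unimxD. Qed.

Lemma cunip0 nu : nu \in unitmx -> cunip nu 0 = 1%:M.
Proof. by move=> un; rewrite /cunip unimx0 mulmx1 mulmxV. Qed.

Lemma cunipE nu x : nu \in unitmx -> cunip nu x = 1%:M + x *: cnilp nu.
Proof.
move=> un; rewrite /cunip unimxE mulmxDr mulmx1 mulmxDl mulmxV //.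
by rewrite -scalemxAr -scalemxAl.
Qed.

Lemma cunip_entry nu x i j : nu \in unitmx ->
  cunip nu x i j = (i == j)%:R + x * cnilp nu i j.
Proof. by move=> un; rewrite cunipE // mxE [X in X + _]mxE [X in _ + X]mxE. Qed.

Lemma cunipK nu x : nu \in unitmx -> cunip nu x *m nu = nu *m unimx x.
Proof. by move=> un; rewrite /cunip mulmxKV. Qed.

Lemma cunip_det nu x : nu \in unitmx -> \det (cunip nu x) = 1.
Proof.
move=> un; rewrite /cunip !det_mulmx unimx_det mulr1 -det_mulmx mulmxV //.
exact: det1.
Qed.

Lemma cunip_unit nu x : nu \in unitmx -> cunip nu x \in unitmx.
Proof. by move=> un; rewrite unitmxE cunip_det // unitr1. Qed.

Lemma cunipN nu x : nu \in unitmx -> invmx (cunip nu x) = cunip nu (- x).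
Proof.
move=> un; symmetry; apply: mulmx_id2; first exact: cunip_unit.
by rewrite cunipD // subrr cunip0.
Qed.

Lemma cnilp_neq0 nu : nu \in unitmx -> exists i j, cnilp nu i j != 0.
Proof.
move=> un; apply: contrapT => h.
have n0 : cnilp nu = 0.
  apply/matrixP => i j; rewrite [RHS]mxE; apply/eqP/negbNE/negP => n0.
  by apply: h; exists i, j.
have e : cnilp nu *m nu = nu *m mx2 0 1 0 0 by rewrite /cnilp mulmxKV.
have : mx2 0 1 0 0 = 0 :> 'M[K]_2.
  by rewrite -[LHS](mulKmx un) -e n0 mul0mx mulmx0.
by move/matrixP/(_ 0 1)/eqP; rewrite !mxE oner_eq0.
Qed.

Lemma cnilpE nu i j : cnilp nu i j = nu i 0 * invmx nu 1 j.
Proof. by rewrite /cnilp !mulmx2 !mx2E; ring. Qed.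

Lemma cunip_eq nu g x : nu \in unitmx -> invmx nu *m g *m nu = unimx x -> g = cunip nu x.
Proof. by move=> un e; rewrite /cunip -e !mulmxA mulmxV // mul1mx mulmxK. Qed.

Lemma cunip_conjK nu x : nu \in unitmx -> invmx nu *m cunip nu x *m nu = unimx x.
Proof. by move=> un; rewrite -mulmxA cunipK // mulKmx. Qed.

Lemma cunip_sub nu x y : nu \in unitmx ->
  cunip nu x *m invmx (cunip nu y) = cunip nu (x - y).
Proof. by move=> un; rewrite cunipN // cunipD. Qed.

Lemma cunip_quot nu k x y : nu \in unitmx -> cunip nu x = k *m cunip nu y ->
  cunip nu (x - y) = k.
Proof. by move=> un e; rewrite -cunip_sub // e mulmxK ?cunip_unit. Qed.

End UnipotentConjugates.

Section Cosets.
Variable Fq : finFieldType.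
Local Notation M2 := 'M[laurent Fq]_2.
Implicit Types H G : set M2.

Lemma rcoset2_eq H (g g' : M2) : H 1%:M -> rcoset2 H g = rcoset2 H g' ->
  exists2 h, H h & g = h *m g'.
Proof.
move=> H1 e; have : rcoset2 H g g by exists 1%:M => //; rewrite mul1mx.
by rewrite e => -[h Hh <-]; exists h.
Qed.

Lemma rcoset2_mul H h (g : M2) : is_subgroup H -> H h -> rcoset2 H (h *m g) = rcoset2 H g.
Proof.
move=> [HU H1 HM HV] Hh; apply/seteqP; split=> [_ [k Hk <-]|_ [k Hk <-]].
  by exists (k *m h); [exact: HM|rewrite mulmxA].
exists (k *m invmx h); first by apply: HM => //; exact: HV.
by rewrite mulmxA mulmxKV //; exact: HU.
Qed.

End Cosets.

Lemma addKr_sub (V : zmodType) (a b c : V) : a = b + c -> c = a - b.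
Proof. by move=> ->; rewrite addrAC subrr add0r. Qed.

Section Lattices.
Variables (R : realType) (Fq : finFieldType) (C : Cinfty R Fq).
Local Notation F := (laurent Fq).
Local Notation Nf := (@absinf R Fq).
Let hF : is_absval Nf := absinf_absval C.

(** Up to the finitely many translations in [s], the set lies in A/mu, and A has finitely many
    elements of bounded absolute value. *)
Lemma lattice_discrete (B : set F) (s : seq F) (mu : F) (M : R) : mu != 0 ->
  (forall x, B x -> exists2 y, y \in s & exists p, (x - y) * mu = Ainf p) ->
  finite_set [set x | B x /\ Nf x <= M].
Proof.
(* The sum over [s] bounds every single representative, so [M'] bounds |x - y| |mu| for all of
   them. *)
move=> m0 hs; pose M' := (Num.max M (\sum_(y <- s) Nf y)) * Nf mu.
pose A := [set x | exists p : {poly Fq}, x = Ainf p /\ Nf x <= M'].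
have finA : finite_set A := Ainf_discrete C M'.
have finI : finite_set ((fun yz : F * F => yz.1 + yz.2 / mu) @` ([set` s] `*` A)).
  by apply: finite_image; apply: finite_setX; [exact: finite_seq|exact: finA].
apply: sub_finite_set finI => x [/hs[y ys [p pE]] xM].
exists (y, (x - y) * mu); last by rewrite [LHS]/= (mulfK m0) addrC subrK.
split; first exact: ys.
exists p; split; first exact: pE.
rewrite [(_, _).2]/= (nvM hF); apply: ler_wpM2r; first exact: (nv_ge0 hF).
apply: (nvB_le hF); rewrite le_max; apply/orP; first by left.
right; rewrite (big_rem y ys) [X in _ <= X]/= lerDl.
by apply: sumr_ge0 => w _; exact: (nv_ge0 hF).
Qed.

(** Any x is within |d| of the lattice dA, and dA differs from [B] by finitely many
    representatives. *)
Lemma lattice_cocompact (B : set F) (d : {poly Fq}) (s : seq {poly Fq}) : d != 0 ->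
  (forall p, exists2 p', p' \in s & B (Ainf (d * p) - Ainf (d * p'))) ->
  exists M, forall x : F, exists2 b, B b & Nf (x - b) <= M.
Proof.
move=> d0 hs; pose x p := Ainf (d * p).
have Ad0 : Ainf d != 0 by rewrite (Ainf_eq0 C).
exists (Num.max (Nf (Ainf d)) (\sum_(p <- s) Nf (x p))) => y.
have [p hp] := Ainf_approx C (y / Ainf d); have [p' ps Bp] := hs p.
exists (x p - x p'); first exact: Bp.
have -> : y - (x p - x p') = (y - x p) + x p' by rewrite opprB addrA addrAC.
apply: (nvD_le hF); rewrite le_max; apply/orP; [left|right].
  have -> : y - x p = Ainf d * (y / Ainf d - Ainf p).
    by rewrite mulrBr mulrCA divff // mulr1 /x AinfM.
  by rewrite (nvM hF) ler_piMr ?(nv_ge0 hF).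
rewrite (big_rem p' ps) [X in _ <= X]/= lerDl.
by apply: sumr_ge0 => w _; exact: (nv_ge0 hF).
Qed.

End Lattices.

Section CuspTranslations.
Variables (R : realType) (Fq : finFieldType) (C : Cinfty R Fq).
Local Notation F := (laurent Fq).
Local Notation M2 := 'M[F]_2.
Local Notation Nf := (@absinf R Fq).
Let hF : is_absval Nf := absinf_absval C.
Variables (G : set M2) (nu : M2).
Hypotheses (hG : is_subgroup G) (un : nu \in unitmx).
Local Notation B := (cusp_translations G nu).

Lemma cusp_translationsP x : B x <-> G (cunip nu x).
Proof.
split=> [[g Gg e]|Gx]; first by rewrite -(cunip_eq un e).
exists (cunip nu x); first exact: Gx.
exact: (cunip_conjK x un).
Qed.

Lemma cusp_translations0 : B 0.
Proof. by apply/cusp_translationsP; rewrite (cunip0 un); case: hG. Qed.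

Lemma cusp_translationsB x y : B x -> B y -> B (x - y).
Proof.
move=> /cusp_translationsP Gx /cusp_translationsP Gy; apply/cusp_translationsP.
rewrite -(cunip_sub _ _ un); case: hG => _ _ GM GV.
by apply: (GM _ _ Gx); exact: (GV _ Gy).
Qed.

Hypothesis comm : commensurable G (GL2A Fq).

Lemma GL2A_1 : GL2A Fq 1%:M.
Proof.
exists 1%:M; first exact: unitmx1.
apply: eq_mx2; rewrite !mxE /= ?Ainf1 ?Ainf0 //.
Qed.

Let K := G `&` GL2A Fq.
Let K1 : K 1%:M.
Proof. by split; [case: hG|exact: GL2A_1]. Qed.

Let cunip_coset x y : rcoset2 K (cunip nu x) = rcoset2 K (cunip nu y) -> K (cunip nu (x - y)).
Proof.
by move=> /(rcoset2_eq K1)[k Kk e]; rewrite (cunip_quot un e).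
Qed.

(** Finite index in [G] gives finitely many classes of translations modulo those with [cunip nu x]
    in GL_2(A). For the latter a nonzero entry mu of the nilpotent part makes x mu a polynomial. *)
Lemma cusp_translations_discrete (M : R) : finite_set [set x | B x /\ Nf x <= M].
Proof.
have fin : finite_set ((fun x => rcoset2 K (cunip nu x)) @` B).
  apply: (@sub_finite_set _ _ (rcosets2 K G)); last exact: comm.1.
  by move=> _ [x /cusp_translationsP Gx <-]; exists (cunip nu x).
have [s [sB hs]] := finite_image_reps fin.
have [mu [m0 hmu]] : exists mu : F, mu != 0 /\
    forall x, GL2A Fq (cunip nu x) -> exists p, x * mu = Ainf p.
  have [i [j m0]] := cnilp_neq0 un; exists (cnilp nu i j); split; first exact: m0.
  move=> x [P _ PE]; have : Ainf (P i j) = cunip nu x i j by rewrite -PE mxE.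
  rewrite (cunip_entry _ _ _ un) => h.
  have [d dE] : exists d : {poly Fq}, (i == j)%:R = Ainf d.
    by case: (i == j); [exists 1; rewrite Ainf1|exists 0; rewrite Ainf0].
  by exists (P i j - d); rewrite AinfB -dE; exact: addKr_sub h.
by apply: (lattice_discrete C M m0) => x Bx; have [y ys e] := hs _ Bx;
   exists y; [exact: ys|exact: hmu _ (cunip_coset (esym e)).2].
Qed.

(** Rationality of nu gives a common denominator d of the nilpotent part, so translations in dA lie
    in GL_2(A). Finite index in GL_2(A) then leaves finitely many classes of dA modulo [B]. *)
Lemma cusp_translations_cocompact : GL2F nu ->
  exists M, forall x : F, exists2 b, B b & Nf (x - b) <= M.
Proof.
move=> [_ nuF]; have nuVF i j : Fsub (invmx nu i j).
  have nuN i' j' : Fsub (- nu i' j').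
    by rewrite -sub0r; apply: (Fsub_sub C); [exact: Fsub0|exact: nuF].
  rewrite (invmx2 un) mxE; apply: Fsub_mul.
    apply: Fsub_inv; rewrite det_mx2.
    by apply: (Fsub_sub C); apply: Fsub_mul.
  by rewrite mxE; case: (i == 0); case: (j == 0).
have cF i j : Fsub (cnilp nu i j).
  rewrite cnilpE; exact: Fsub_mul (nuF _ _) (nuVF _ _).
have [d d0 hd] : exists2 d : {poly Fq}, d != 0 &
    forall i j, exists p : {poly Fq}, Ainf d * cnilp nu i j = Ainf p.
  have [|d d0 hd] := @Fsub_denom R _ C [seq cnilp nu ij.1 ij.2 | ij : 'I_2 * 'I_2].
    by move=> _ /mapP[ij _ ->].
  exists d => // i j; apply: hd; apply/mapP; exists (i, j) => //.
  by rewrite mem_enum.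
have [P PE] : exists P : 'M[{poly Fq}]_2, forall i j, Ainf d * cnilp nu i j = Ainf (P i j).
  have [f hf] : {f : 'I_2 * 'I_2 -> {poly Fq} &
      forall ij, Ainf d * cnilp nu ij.1 ij.2 = Ainf (f ij)}.
    apply: (@choice _ _ (fun ij p => Ainf d * cnilp nu ij.1 ij.2 = Ainf p)) => ij.
    exact: hd.
  by exists (\matrix_(i, j) f (i, j)) => i j; rewrite mxE -(hf (i, j)).
pose x (p : {poly Fq}) := Ainf (d * p).
have cx p : GL2A Fq (cunip nu (x p)).
  pose Q : 'M[{poly Fq}]_2 := 1%:M + p *: P.
  have QE : map_mx (@Ainf Fq) Q = cunip nu (x p).
    apply/matrixP => i j; rewrite (cunip_entry _ _ _ un) /x AinfM -mulrA mulrCA PE.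
    rewrite [LHS]mxE [Q i j]mxE AinfD [(p *: P) i j]mxE AinfM; congr (_ + _).
    by rewrite mxE; case: (i == j); rewrite ?Ainf1 ?Ainf0.
  exists Q => //=.
  have dQ : Ainf (\det Q) = 1.
    rewrite -[RHS](cunip_det (x p) un) -QE !det_mx2 AinfB !AinfM.
    by congr (_ * _ - _ * _); rewrite [RHS]mxE.
  have -> : (Q \in unitmx) = (\det Q \is a GRing.unit) by rewrite unitmxE.
  by rewrite (_ : \det Q = 1) ?unitr1 //; apply: (Ainf_inj C); rewrite dQ Ainf1.
have fin : finite_set ((fun p => rcoset2 K (cunip nu (x p))) @` setT).
  apply: (@sub_finite_set _ _ (rcosets2 K (GL2A Fq))); last exact: comm.2.
  by move=> _ [p _ <-]; exists (cunip nu (x p)).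
have [s [_ hs]] := finite_image_reps fin.
apply: (lattice_cocompact C d0 (s := s)) => p.
have [p' ps e] := hs p Logic.I; exists p'; first exact: ps.
by apply/cusp_translationsP; have [] := cunip_coset (esym e).
Qed.

End CuspTranslations.

(** * Determinants of elements of Gamma *)

Section Determinants.
Variables (R : realType) (Fq : finFieldType) (C : Cinfty R Fq).
Local Notation F := (laurent Fq).
Local Notation M2 := 'M[F]_2.
Local Notation Nf := (@absinf R Fq).
Let hF : is_absval Nf := absinf_absval C.
Variables (G : set M2).
Hypotheses (hG : is_subgroup G).

Lemma absinf_det_GL2A g : GL2A Fq g -> Nf (\det g) = 1.
Proof.
move=> [P uP <-]; have uP' : P \in unitmx := uP.
have d1 : \det P * (\det P)^-1 = 1 by apply: mulrV; rewrite -unitmxE.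
have e : Nf (Ainf (\det P)) * Nf (Ainf (\det P)^-1) = 1.
  by rewrite -(nvM hF) -AinfM d1 Ainf1 (nv1 hF).
have -> : \det (map_mx (@Ainf Fq) P) = Ainf (\det P).
  by rewrite !det_mx2 AinfB !AinfM; congr (_ * _ - _ * _); rewrite [LHS]mxE.
have nz (p p' : {poly Fq}) : p * p' = 1 -> p != 0.
  by move=> h; apply/eqP => p0; move/eqP: h; rewrite p0 mul0r eq_sym oner_eq0.
have h1 := absinf_Ainf_ge1 C (nz _ _ d1).
have h2 : 1 <= Nf (Ainf (\det P)^-1).
  by apply: (absinf_Ainf_ge1 C); apply: (nz _ (\det P)); rewrite mulrC.
apply/eqP; rewrite eq_le h1 andbT -e; apply: ler_peMr => //.
exact: (nv_ge0 hF).
Qed.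

(** Pigeonhole on the powers of g: two of them differ by an element of GL_2(A), whose determinant
    has absolute value 1, so a positive power of |det g| is 1. *)
Lemma det_commensurable g : commensurable G (GL2A Fq) -> G g -> Nf (\det g) = 1.
Proof.
case: hG => GU G1 GM _ comm Gg; pose K := G `&` GL2A Fq.
have Gn n : G (g ^+ n) by elim: n => [|n IH]; [rewrite expr0|rewrite exprS; exact: GM].
have K1 : K 1%:M by split; [exact: G1|exact: GL2A_1].
have fin : finite_set ((fun n => rcoset2 K (g ^+ n)) @` setT).
  apply: (@sub_finite_set _ _ (rcosets2 K G)); last exact: comm.1.
  by move=> _ [n _ <-]; exists (g ^+ n); [exact: Gn|].
have [s [_ hs]] := finite_image_reps fin.
(* This n exceeds every representative in [s], so the one congruent to n is a strictly smaller
   exponent. *)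
pose n := (\sum_(y <- s) y).+1; have [y ys e] := hs n Logic.I.
have yn : (y < n)%N by rewrite /n ltnS (big_rem y ys) leq_addr.
have [k [_ Ak] ke] := rcoset2_eq K1 (esym e).
have detX j : \det (g ^+ j) = \det g ^+ j.
  by elim: j => [|j IH]; [rewrite !expr0 det1|rewrite !exprS -IH; exact: det_mulmx].
have := congr1 (fun A : M2 => Nf (\det A)) ke.
rewrite [LHS]/= [RHS]/= det_mulmx (nvM hF) (absinf_det_GL2A Ak) mul1r !detX !(nvX hF).
have d0 : 0 < Nf (\det g) by rewrite (nv_gt0 hF) -unitfE -unitmxE; exact: GU.
rewrite -(subnK (ltnW yn)) exprD -[RHS]mul1r => /(mulIf _) h.
have /eqP := h (lt0r_neq0 (exprn_gt0 y d0)).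
rewrite pexpr_eq1 ?(ltW d0) //; last by rewrite subn_gt0.
by move/eqP.
Qed.

(** Lagrange's theorem for the group of determinants: multiplication by det g permutes it, so the
    product of its elements absorbs the power. *)
Lemma det_card_exp g : G g -> (\det g) ^+ det_card G = 1.
Proof.
move=> Gg; case: hG => GU G1 GM GV.
have d0 : \det g != 0 by rewrite -unitfE -unitmxE; exact: GU.
(* For an infinite set [fset_set] is empty, and the exponent is 0. *)
have [fin|inf] := pselect (finite_set (det_set G)); last first.
  by rewrite /det_card /fset_set; case: pselect => // _; rewrite cardfs0 expr0.
pose S := fset_set (det_set G).
have inS x : (x \in S) = `[< det_set G x >] by rewrite in_fset_set // in_setE.
have pS : perm_eq [seq \det g * x | x <- S] S.
  apply: uniq_perm; rewrite ?map_inj_uniq ?fset_uniq //; first exact: mulfI.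
  move=> x; apply/mapP/idP => [[y yS ->]|].
    move: yS; rewrite !inS => /asboolP[h Gh <-]; apply/asboolP.
    by exists (g *m h); [exact: GM|rewrite det_mulmx].
  rewrite inS => /asboolP[h Gh <-]; exists (\det (invmx g *m h)).
    by rewrite inS; apply/asboolP; exists (invmx g *m h) => //; apply: GM => //; exact: GV.
  by rewrite -det_mulmx mulKVmx //; exact: GU.
have S0 : \prod_(x <- S) x != 0.
  rewrite prodf_seq_neq0; apply/allP => x /=; rewrite inS => /asboolP[h Gh <-].
  by rewrite -unitfE -unitmxE; exact: GU.
apply: (mulIf S0); rewrite mul1r -[RHS](perm_big _ pS) /= big_map big_split /=.
congr (_ * _); rewrite big_const_seq count_predT iter_mulr mulr1.
by rewrite /det_card.
Qed.

End Determinants.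

(** * Terms of the Poincare series *)

Section UnitRows.
Variables (K : fieldType) (g : 'M[K]_2).
Hypothesis ug : g \in unitmx.

Let d0 : g 0 0 * g 1 1 - g 0 1 * g 1 0 != 0.
Proof. by rewrite -det_mx2 -unitfE -unitmxE. Qed.

Lemma unitmx_row1 : (- g 1 1 != 0) || (g 1 0 != 0).
Proof.
rewrite oppr_eq0; apply: contraNT d0; rewrite negb_or !negbK => /andP[/eqP -> /eqP ->].
by rewrite !mulr0 subrr.
Qed.

Lemma unitmx_rows x : (x * g 1 1 - g 0 1 != 0) || (g 0 0 - x * g 1 0 != 0).
Proof.
apply: contraNT d0; rewrite negb_or !negbK !subr_eq0 => /andP[/eqP <- /eqP ->].
by apply/eqP; ring.
Qed.

Lemma det_unitmx_neq0 : \det g != 0.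
Proof. by rewrite -unitfE -unitmxE. Qed.

End UnitRows.

Section FieldIdentities.
Variable K : fieldType.
Implicit Types a b c d x z u v : K.

Lemma homography_sub a b c d x z p q : c * z + d != 0 -> p = a - x * c -> q = x * d - b ->
  (a * z + b) / (c * z + d) - x = (p * z - q) / (c * z + d).
Proof. by move=> j0 -> ->; field. Qed.

Lemma homography_inv_sub a b c d z u v U V D : c * z + d != 0 -> D = a * d - b * c ->
  D != 0 -> U = a * u + b * v -> V = c * u + d * v -> v * z - u != 0 ->
  V / (V * ((a * z + b) / (c * z + d)) - U) =
  (c * z + d) ^+ 2 / D * (v / (v * z - u)) - c * (c * z + d) / D.
Proof.
move=> j0 DE D0 UE VE w0.
have -> : V * ((a * z + b) / (c * z + d)) - U = D * (v * z - u) / (c * z + d).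
  by rewrite DE UE VE; field.
have -> : V = (c * z + d) * v - c * (v * z - u) by rewrite VE; ring.
by move: j0 w0 {UE VE DE}; move: (c * z + d) (v * z - u) => J w j0 w0; field; rewrite D0 j0 w0.
Qed.

End FieldIdentities.

Section MobiusU.
Variables (R : realType) (Fq : finFieldType) (C : Cinfty R Fq).
Local Notation F := (laurent Fq).
Local Notation M2 := 'M[F]_2.
Local Notation N := (@Cabs R Fq C).
Local Notation emb := (Cemb C).
Let hN : is_absval N := Cabs_absval C.
Implicit Types (g : M2) (z : C).

Lemma CembD x y : emb (x + y) = emb x + emb y. Proof. exact: rmorphD. Qed.
Lemma CembB x y : emb (x - y) = emb x - emb y. Proof. exact: rmorphB. Qed.
Lemma CembM x y : emb (x * y) = emb x * emb y. Proof. exact: rmorphM. Qed.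
Lemma CembN x : emb (- x) = - emb x. Proof. exact: rmorphN. Qed.
Lemma CembV x : emb x^-1 = (emb x)^-1. Proof. exact: fmorphV. Qed.
Lemma Cemb0 : emb 0 = 0. Proof. exact: rmorph0. Qed.
Lemma Cemb_eq0 x : (emb x == 0) = (x == 0). Proof. exact: fmorph_eq0. Qed.

Lemma Omega_lin z (u v : F) : Omega z -> (u != 0) || (v != 0) -> emb v * z - emb u != 0.
Proof.
move=> Oz; have [->|v0] := eqVneq v 0.
  by rewrite orbF Cemb0 mul0r sub0r oppr_eq0 Cemb_eq0.
move=> _; have ev : emb v != 0 by rewrite Cemb_eq0.
rewrite (_ : _ - _ = emb v * (z - emb (u / v))); last first.
  by rewrite mulrBr CembM CembV [emb u / _]mulrC (mulVKf ev).
by rewrite mulf_neq0 ?(Omega_neq _ Oz).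
Qed.

Lemma cinv_sub_topt z (u v : F) : Omega z -> (u != 0) || (v != 0) ->
  cinv_sub z (topt u v) = emb v / (emb v * z - emb u).
Proof.
move=> Oz uv; have := Omega_lin Oz uv; rewrite /topt; have [->|v0] := eqVneq v 0.
  by move=> _; rewrite [LHS]/= Cemb0 mul0r.
have ev : emb v != 0 by rewrite Cemb_eq0.
move=> h; rewrite [LHS]/= CembM CembV.
apply: (mulIf h); rewrite (divfK h).
have -> : emb v * z - emb u = emb v * (z - emb u / emb v).
  by rewrite mulrBr [emb u / _]mulrC (mulVKf ev).
have h' : z - emb u / emb v != 0 by rewrite -CembV -CembM; exact: (Omega_neq _ Oz).
by rewrite mulrCA (mulVf h') mulr1.
Qed.

Lemma jfactor_neq0 g z : g \in unitmx -> Omega z -> jfactor g z != 0.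
Proof.
move=> ug Oz; rewrite /jfactor -[emb (g 1 1)]opprK -CembN.
exact: (Omega_lin Oz (unitmx_row1 ug)).
Qed.

Lemma emb_det_neq0 g : g \in unitmx -> emb (\det g) != 0.
Proof. by move=> ug; rewrite Cemb_eq0 det_unitmx_neq0. Qed.

Lemma emb_det g : emb (\det g) = emb (g 0 0) * emb (g 1 1) - emb (g 0 1) * emb (g 1 0).
Proof. by rewrite det_mx2 CembB !CembM. Qed.

Lemma cmobius_Omega g z : g \in unitmx -> Omega z -> Omega (cmobius g z).
Proof.
move=> ug Oz; apply: OmegaP => x; have j0 := jfactor_neq0 ug Oz.
have d0 := emb_det_neq0 ug.
have p0 : emb (g 0 0 - x * g 1 0) * z - emb (x * g 1 1 - g 0 1) != 0.
  exact: (Omega_lin Oz (unitmx_rows ug x)).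
have e : cmobius g z - emb x =
    (emb (g 0 0 - x * g 1 0) * z - emb (x * g 1 1 - g 0 1)) / jfactor g z.
  apply: (homography_sub j0); first by exact: etrans (CembB _ _) (congr1 _ (congr1 _ (CembM _ _))).
  by exact: etrans (CembB _ _) (congr1 (fun y => y - _) (CembM _ _)).
by rewrite e mulf_neq0 ?invr_neq0.
Qed.

(** The correction term does not depend on x; it cancels in the difference that defines [ufun],
    which thus has weight 2. *)
Lemma cinv_sub_mobius g z x : g \in unitmx -> Omega z ->
  cinv_sub (cmobius g z) (mobius g x) =
  jfactor g z ^+ 2 / emb (\det g) * cinv_sub z x - emb (g 1 0) * jfactor g z / emb (\det g).
Proof.
move=> ug Oz; have [u [v [uv ->]]] := @topt_ex F x.
rewrite (mobius_topt _ uv).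
have uv' := mx2_apply_neq0 ug uv.
rewrite (cinv_sub_topt Oz uv) (cinv_sub_topt (cmobius_Omega ug Oz) uv').
apply: (homography_inv_sub (jfactor_neq0 ug Oz) (emb_det g) (emb_det_neq0 ug) _ _
  (Omega_lin Oz uv)).
  by exact: etrans (CembD _ _) (congr2 _ (CembM _ _) (CembM _ _)).
by exact: etrans (CembD _ _) (congr2 _ (CembM _ _) (CembM _ _)).
Qed.

Lemma ufun_mobius g z x y : g \in unitmx -> Omega z ->
  ufun (cmobius g z) (mobius g x) (mobius g y) =
  jfactor g z ^+ 2 / emb (\det g) * ufun z x y.
Proof.
move=> ug Oz; rewrite /ufun !cinv_sub_mobius //.
by rewrite opprB addrA subrK mulrBr.
Qed.

End MobiusU.

Lemma term_arith (K : fieldType) (x y u v : K) (l : int) : y != 0 ->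
  x ^ l * (u * v) = y ^ (- l) * u * ((x * y) ^ l * v).
Proof.
move=> y0; have e : y ^ (- l) * y ^ l = 1 by rewrite -expfzDr // addNr expr0z.
rewrite expfzMl; move: e; move: (y ^ (- l)) (y ^ l) (x ^ l) => s t w e.
by rewrite (_ : s * u * (w * t * v) = (s * t) * (w * (u * v))); [rewrite e mul1r|ring].
Qed.

Lemma prod_scale (K : comNzRingType) (r : nat) (k : 'I_r -> nat) (A G : 'I_r -> K) J :
  (forall i, A i ^+ k i = J ^+ k i * G i ^+ k i) ->
  \prod_(i < r) A i ^+ k i = J ^+ (\sum_(i < r) k i) * \prod_(i < r) G i ^+ k i.
Proof.
by move=> h; rewrite (eq_bigr _ (fun i _ => h i)) big_split /= prodrXr.
Qed.

Lemma mobius_inv_factor (Fq : finFieldType) (g h : 'M[laurent Fq]_2) x :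
  g \in unitmx -> h \in unitmx ->
  mobius (invmx g) x = mobius h (mobius (invmx (g *m h)) x).
Proof.
move=> ug uh; have ugi : invmx g \in unitmx := etrans (unitmx_inv g) ug.
rewrite (invmxM ug uh) (mobiusM _ _ ugi); symmetry; exact: mobiusKV.
Qed.

Section Term.
Variables (R : realType) (Fq : finFieldType) (C : Cinfty R Fq).
Local Notation F := (laurent Fq).
Local Notation M2 := 'M[F]_2.
Local Notation q := (#|Fq|%:R : R).
Local Notation N := (@Cabs R Fq C).
Local Notation Nf := (@absinf R Fq).
Local Notation emb := (Cemb C).
Let hN : is_absval N := Cabs_absval C.
Let hF : is_absval Nf := absinf_absval C.
Variables (r : nat) (k : 'I_r -> nat) (l : int) (a b : 'I_r -> P1 Fq).
Implicit Types (g h : M2) (z : C).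
Local Notation term := (@poincare_term R Fq C r k l a b).
Local Notation K := (\sum_(i < r) k i)%N.

Lemma term_mobius g h z : g \in unitmx -> h \in unitmx -> Omega z ->
  term g (cmobius h z) =
  emb (\det h) ^ (- l) * (jfactor h z ^+ 2 / emb (\det h)) ^+ K * term (g *m h) z.
Proof.
move=> ug uh Oz; set J := _ / _.
have e x : mobius (invmx g) x = mobius h (mobius (invmx (g *m h)) x).
  exact: mobius_inv_factor.
have U i : ufun (cmobius h z) (mobius (invmx g) (a i)) (mobius (invmx g) (b i)) ^+ k i =
    J ^+ k i * ufun z (mobius (invmx (g *m h)) (a i)) (mobius (invmx (g *m h)) (b i)) ^+ k i.
  apply: etrans (exprMn _ _ _); congr (_ ^+ _).
  exact: etrans (congr2 _ (e (a i)) (e (b i))) (ufun_mobius _ _ uh Oz).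
have P : \prod_(i < r) ufun (cmobius h z) (mobius (invmx g) (a i)) (mobius (invmx g) (b i)) ^+ k i =
    J ^+ K * \prod_(i < r) ufun z (mobius (invmx (g *m h)) (a i)) (mobius (invmx (g *m h)) (b i)) ^+ k i.
  exact: (prod_scale U).
have dE : emb (\det (g *m h)) = emb (\det g) * emb (\det h).
  by rewrite det_mulmx; exact: CembM.
refine (etrans (congr1 (fun w => emb (\det g) ^ l * w) P) _).
refine (etrans (term_arith (emb (\det g)) _ _ l (emb_det_neq0 C uh)) _).
exact: (congr1 (fun w => emb (\det h) ^ (- l) * J ^+ K * (w ^ l * _)) (esym dE)).
Qed.

End Term.

Lemma act_vertexM (Fq : finFieldType) (g h m : 'M[laurent Fq]_2) :
  g \in unitmx -> h \in unitmx ->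
  act_vertex g (act_vertex h (homothety_class (row_lattice m))) =
  act_vertex (g *m h) (homothety_class (row_lattice m)).
Proof. by move=> ug uh; rewrite !act_vtx (invmxM ug uh) mulmxA. Qed.

(** * Terms indexed by cosets and condition (P) *)

Section CosetTerms.
Variables (R : realType) (Fq : finFieldType) (C : Cinfty R Fq).
Local Notation F := (laurent Fq).
Local Notation M2 := 'M[F]_2.
Local Notation q := (#|Fq|%:R : R).
Local Notation N := (@Cabs R Fq C).
Local Notation Nf := (@absinf R Fq).
Local Notation emb := (Cemb C).
Let hN : is_absval N := Cabs_absval C.
Let hF : is_absval Nf := absinf_absval C.
Variables (G H : set M2) (r : nat) (k : 'I_r -> nat) (l : int) (a b : 'I_r -> P1 Fq).
Hypotheses (hG : is_subgroup G) (pd : poincare_data G H k l a b).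
Implicit Types (g h nu : M2) (z : C) (c : set M2).
Local Notation term := (@poincare_term R Fq C r k l a b).
Local Notation K := (\sum_(i < r) k i)%N.
Local Notation D := (rcosets2 H G).

Let GU g : G g -> g \in unitmx. Proof. by case: hG => h _ _ _ /h. Qed.
Let GM g h : G g -> G h -> G (g *m h). Proof. by case: hG => _ _ hm _; exact: hm. Qed.
Let HG h : H h -> G h. Proof. by move=> Hh; exact: (pd_sub pd Hh). Qed.

Lemma coset_repr c : D c -> G (xget 1%:M c) /\ c = rcoset2 H (xget 1%:M c).
Proof.
move=> [g Gg <-]; have [HU H1 _ _] := pd_group pd.
have : rcoset2 H g (xget 1%:M (rcoset2 H g)).
  by apply: (@xgetI _ _ _ g); exists 1%:M; [exact: H1|exact: mul1mx].
move: (xget _ _) => g' [h Hh <-]; split; first exact: GM (HG Hh) Gg.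
by rewrite (rcoset2_mul _ (pd_group pd) Hh).
Qed.

Lemma mobius_invmx_fix h x : h \in unitmx -> mobius h x = x -> mobius (invmx h) x = x.
Proof. by move=> uh e; rewrite -{1}e; exact: mobiusK. Qed.

Lemma mobius_inv_mul h g x : h \in unitmx -> g \in unitmx -> mobius h x = x ->
  mobius (invmx (h *m g)) x = mobius (invmx g) x.
Proof.
move=> uh ug e; have uhi : invmx h \in unitmx := etrans (unitmx_inv h) uh.
exact: (etrans (congr1 (fun m => mobius m x) (invmxM uh ug))
  (etrans (mobiusM _ _ uhi) (congr1 _ (mobius_invmx_fix uh e)))).
Qed.

(** Independence of the coset representative: (det h)^l = 1, and h fixes all the points [a i] and
    [b i]. *)
Lemma term_H h g z : H h -> g \in unitmx -> term (h *m g) z = term g z.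
Proof.
move=> Hh ug; have uh := GU (HG Hh); rewrite /poincare_term.
have dE : emb (\det (h *m g)) ^ l = emb (\det g) ^ l.
  have e : emb (\det (h *m g)) = emb (\det h) * emb (\det g).
    by rewrite det_mulmx; exact: CembM.
  have e1 : emb (\det h) ^ l = 1.
    by rewrite -(rmorph1 emb) -(pd_det pd Hh); symmetry; exact: fmorphXz.
  by rewrite e expfzMl e1 mul1r.
refine (congr2 (fun x y : C => x * y) dE _); apply: eq_bigr => i _.
have [fa fb] := pd_fix pd i Hh.
exact: (congr1 (fun w : C => w ^+ k i)
  (congr2 (ufun z) (mobius_inv_mul uh ug fa) (mobius_inv_mul uh ug fb))).
Qed.

(** Shifting by [nu] lets one estimate cover the series and its slash translates. *)
Definition cterm nu c z := term (xget 1%:M c *m nu) z.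

Lemma cterm_coset g nu z : G g -> nu \in unitmx -> cterm nu (rcoset2 H g) z = term (g *m nu) z.
Proof.
move=> Gg un; have [_ H1 _ _] := pd_group pd; rewrite /cterm.
have : rcoset2 H g (xget 1%:M (rcoset2 H g)).
  by apply: (@xgetI _ _ _ g); exists 1%:M; [exact: H1|exact: mul1mx].
move: (xget _ _) => g' [h Hh <-]; rewrite -mulmxA.
exact: (term_H z Hh (unitmx_prod (GU Gg) un)).
Qed.

Definition chord_ge nu n g := forall i : 'I_r,
  q ^- n <= Nf (chord R (mobius (invmx (g *m nu)) (a i)) (mobius (invmx (g *m nu)) (b i))).

Definition near_cosets nu n : set (set M2) := rcosets2 H [set g | G g /\ chord_ge nu n g].

Hypothesis hP : conditionP G H a b.

(* Condition (P) at the vertex [nu v_0]. *)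
Lemma near_cosets_finite nu n : nu \in unitmx -> finite_set (near_cosets nu n).
Proof.
move=> un; pose v := act_vertex nu (homothety_class (row_lattice (1%:M : M2))).
have vv : is_vertex v.
  rewrite /v act_vtx; apply: is_vertex_vtx.
  exact: unitmx_prod (unitmx1 _ _) (etrans (unitmx_inv nu) un).
apply: sub_finite_set (hP n vv) => _ [g [Gg hg] <-]; exists g => //; split; first exact: Gg.
move=> i; have := dist_geodesic_le C (unitmx_prod (GU Gg) un) (pd_ab pd (i := i)) (hg i).
by rewrite /v (act_vertexM _ (GU Gg) un).
Qed.

Lemma near_cosets_sub nu n : near_cosets nu n `<=` D.
Proof. by move=> _ [g [Gg _] <-]; exists g. Qed.

Hypothesis det1 : forall g, G g -> Nf (\det g) = 1.

(** Outside [near_cosets] some chord is below [q ^- n]. Since [k i0 >= 1], that factor occurs and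
    yields [q ^- n]; all others are at most [Q]. As |det g| = 1, only |det nu| enters the constant,
    which is therefore independent of n and c. *)
Lemma cterm_le nu m : nu \in unitmx -> exists2 A : R, 0 <= A &
  forall n c z, D c -> ~ near_cosets nu n c -> Omega_n m z -> N (cterm nu c z) <= A * q ^- n.
Proof.
move=> un; pose Q := (q ^+ m) ^+ 4.
have q1 : 1 <= q by exact: ltW (cardq_gt1 R Fq).
have Q1 : 1 <= Q by rewrite exprn_ege1 // exprn_ege1.
have Q0 : 0 <= Q by apply: le_trans Q1.
pose dl := Nf (\det nu) ^ l.
have dl0 : 0 <= dl by apply: exprz_ge0; exact: (nv_ge0 hF).
exists (dl * Q ^+ K); first by rewrite mulr_ge0 // exprn_ge0.
move=> n c z Dc nc Oz; have [Gg cE] := coset_repr Dc.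
set g := xget _ _ in Gg cE; rewrite /cterm -/g.
have [i0 hi0] : exists i, Nf (chord R (mobius (invmx (g *m nu)) (a i)) (mobius (invmx (g *m nu)) (b i))) < q ^- n.
  apply: contrapT => h; apply: nc; exists g; last by rewrite -cE.
  split; first exact: Gg.
  by move=> i; rewrite leNgt; apply/negP => h'; apply: h; exists i.
rewrite /poincare_term (nvM hN) (nvXz hN) Cabs_emb.
have -> : Nf (\det (g *m nu)) ^ l = dl by rewrite det_mulmx (nvM hF) (det1 Gg) mul1r.
rewrite -mulrA; apply: ler_wpM2l; first exact: dl0.
rewrite (nv_prod hN) (bigD1 i0) //= -(prodrXr Q) [X in _ <= X * _](bigD1 i0) //=.
rewrite mulrAC; apply: ler_pM; first exact: (nv_ge0 hN).
- by apply: prodr_ge0 => i _; exact: (nv_ge0 hN).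
- have := pd_k pd i0; case: (k i0) => // k0 _; rewrite !(nvX hN) !exprS.
  rewrite mulrAC; apply: ler_pM.
  + exact: (nv_ge0 hN).
  + by apply: exprn_ge0; exact: (nv_ge0 hN).
  + apply: (le_trans (ufun_le _ _ Oz)); rewrite mulrC; apply: ler_wpM2l; first exact: Q0.
    exact: ltW.
  + by apply: lerXn2r; rewrite ?nnegrE ?(nv_ge0 hN) //; exact: ufun_le_pow.
- apply: ler_prod => i _; rewrite (nv_ge0 hN) /= (nvX hN).
  by apply: lerXn2r; rewrite ?nnegrE ?(nv_ge0 hN) //; exact: ufun_le_pow.
Qed.

Lemma cterm_small nu m e : nu \in unitmx -> 0 < e -> exists n, forall n', (n <= n')%N ->
  forall c z, D c -> ~ near_cosets nu n' c -> Omega_n m z -> N (cterm nu c z) < e.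
Proof.
move=> un e0; have [A A0 hA] := cterm_le m un.
have [n hn] := scaled_card_powN_lt Fq A0 e0; exists n => n' nn' c z Dc nc Oz.
exact: le_lt_trans (hA _ _ _ Dc nc Oz) (hn _ nn').
Qed.

Lemma cterm_vanishing nu z (E : set (set M2)) : nu \in unitmx -> Omega z -> E `<=` D ->
  vanishing E (fun c => cterm nu c z).
Proof.
move=> un Oz ED e e0; have [m Om] := Omega_n_ex Oz.
have [n hn] := cterm_small m un e0.
apply: sub_finite_set (near_cosets_finite n un) => c [/ED Dc ec].
apply: contrapT => nc; have := hn n (leqnn _) c z Dc nc Om.
by rewrite ltNge ec.
Qed.

Definition cseries nu z := usum D (fun c => cterm nu c z).

Lemma has_cseries nu z : nu \in unitmx -> Omega z -> has_usum D (fun c => cterm nu c z) (cseries nu z).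
Proof.
move=> un Oz; have [s hs] := has_usum_ex (cterm_vanishing un Oz (@subset_refl _ D)).
by rewrite /cseries (has_usumP hs).
Qed.

End CosetTerms.

Section DifferencesOfSums.
Variables (R : realType) (Fq : finFieldType) (C : Cinfty R Fq).
Local Notation N := (@Cabs R Fq C).
Let hN : is_absval N := Cabs_absval C.
Variable I : choiceType.
Implicit Types (D : set I) (t : I -> C) (s : C) (e : R).

Lemma vanishing_sub D D' t : D' `<=` D -> vanishing D t -> vanishing D' t.
Proof.
by move=> DD h e e0; apply: sub_finite_set (h e e0) => i [/DD Di ei].
Qed.

Lemma has_usum_diff D D' t s s' e : 0 <= e -> D' `<=` D ->
  has_usum D t s -> has_usum D' t s' -> (forall i, D i -> ~ D' i -> N (t i) <= e) ->
  N (s - s') <= e.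
Proof.
move=> e0 DD h h' small.
have [u hu] : exists u, has_usum (D `\` D') t u.
  by apply: has_usum_ex; apply: vanishing_sub (has_usum_vanishing h) => i [].
have hs : has_usum (D' `|` (D `\` D')) t (s' + u).
  apply: has_usumU => //; apply/seteqP; split=> i //= [Di [_ nDi]]; exact: nDi.
have DE : D' `|` (D `\` D') = D.
  apply/seteqP; split=> i => [[/DD|[]]|] // Di.
  by have [|] := pselect (D' i); [left|right].
rewrite DE in hs; rewrite (has_usum_uniq h hs) addrAC subrr add0r.
by apply: (has_usum_le e0 hu) => i [Di nDi]; exact: small.
Qed.

Lemma has_usum_fin (S : {fset I}) t : has_usum [set` S] t (\sum_(i <- S) t i).
Proof.
move=> e e0; exists S; split=> //; first by rewrite subrr (nv0 hN).
by move=> i /= -> .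
Qed.

End DifferencesOfSums.

(** * Rigidity and invariance *)

Section Rational.
Variables (R : realType) (Fq : finFieldType) (C : Cinfty R Fq).
Local Notation F := (laurent Fq).

(** One pair of polynomials for all of Omega, so a finite partial sum serves on every affinoid at
    once. *)
Definition rational_on_Omega (f : C -> C) := exists p q : {poly C},
  forall z, Omega z -> q.[z] != 0 /\ f z = p.[z] / q.[z].

Lemma rational_cst c : rational_on_Omega (fun=> c).
Proof. by exists c%:P, 1 => z _; rewrite !hornerE oner_eq0 divr1. Qed.

Lemma rationalD f g : rational_on_Omega f -> rational_on_Omega g ->
  rational_on_Omega (fun z => f z + g z).
Proof.
move=> [p [d h]] [p' [d' h']]; exists (p * d' + p' * d), (d * d') => z Oz.
have [d0 fz] := h z Oz; have [d0' gz] := h' z Oz.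
by rewrite !hornerE mulf_neq0 // fz gz addf_div.
Qed.

Lemma rationalM f g : rational_on_Omega f -> rational_on_Omega g ->
  rational_on_Omega (fun z => f z * g z).
Proof.
move=> [p [d h]] [p' [d' h']]; exists (p * p'), (d * d') => z Oz.
have [d0 fz] := h z Oz; have [d0' gz] := h' z Oz.
by rewrite !hornerE mulf_neq0 // fz gz mulf_div.
Qed.

Lemma rationalX f n : rational_on_Omega f -> rational_on_Omega (fun z => f z ^+ n).
Proof.
move=> hf; elim: n => [|n IH]; first exact: rational_cst.
have [p [d h]] := rationalM hf IH; exists p, d => z /h; by rewrite exprS.
Qed.

Lemma rational_sum (I : Type) (s : seq I) (f : I -> C -> C) :
  (forall i, rational_on_Omega (f i)) -> rational_on_Omega (fun z => \sum_(i <- s) f i z).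
Proof.
move=> hf; elim: s => [|i s IH].
  by have [p [d h]] := rational_cst 0; exists p, d => z /h; rewrite big_nil.
have [p [d h]] := rationalD (hf i) IH; exists p, d => z /h; by rewrite big_cons.
Qed.

Lemma rational_prod (I : Type) (s : seq I) (f : I -> C -> C) :
  (forall i, rational_on_Omega (f i)) -> rational_on_Omega (fun z => \prod_(i <- s) f i z).
Proof.
move=> hf; elim: s => [|i s IH].
  by have [p [d h]] := rational_cst 1; exists p, d => z /h; rewrite big_nil.
have [p [d h]] := rationalM (hf i) IH; exists p, d => z /h; by rewrite big_cons.
Qed.

Lemma rational_cinv_sub (x : P1 Fq) : rational_on_Omega (fun z => cinv_sub z x).
Proof.
case: x => [y|]; last exact: rational_cst.
exists 1%:P, ('X - (Cemb C y)%:P) => z Oz; rewrite hornerXsubC hornerC.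
split; first exact: (Omega_neq y Oz).
by rewrite div1r.
Qed.

Lemma rational_ufun (x y : P1 Fq) : rational_on_Omega (fun z => ufun z x y).
Proof.
have h := rationalM (rational_cst (-1)) (rational_cinv_sub x).
have [p [d h']] := rationalD (rational_cinv_sub y) h.
by exists p, d => z /h'; rewrite mulN1r.
Qed.

Lemma rational_term r (k : 'I_r -> nat) l (a b : 'I_r -> P1 Fq) g :
  rational_on_Omega (@poincare_term R Fq C r k l a b g).
Proof.
apply: rationalM; first exact: rational_cst.
by apply: rational_prod => i; apply: rationalX; exact: rational_ufun.
Qed.

End Rational.

Section Slash.
Variables (R : realType) (Fq : finFieldType) (C : Cinfty R Fq).
Local Notation F := (laurent Fq).
Local Notation M2 := 'M[F]_2.
Local Notation N := (@Cabs R Fq C).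
Local Notation Nf := (@absinf R Fq).
Local Notation emb := (Cemb C).
Let hN : is_absval N := Cabs_absval C.
Variables (G H : set M2) (r : nat) (k : 'I_r -> nat) (l : int) (a b : 'I_r -> P1 Fq).
Hypotheses (hG : is_subgroup G) (pd : poincare_data G H k l a b).
Hypothesis hP : conditionP G H a b.
Hypothesis det1 : forall g, G g -> Nf (\det g) = 1.
Implicit Types (g h nu : M2) (z : C) (c : set M2).
Local Notation term := (@poincare_term R Fq C r k l a b).
Local Notation K := (\sum_(i < r) k i)%N.
Local Notation D := (rcosets2 H G).
Local Notation f := (poincare_series C G H k l a b).
Local Notation fnu := (@cseries R Fq C G H r k l a b).
Local Notation ct := (@cterm R Fq C r k l a b).

Let GU g : G g -> g \in unitmx. Proof. by case: hG => h _ _ _ /h. Qed.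
Let GM g h : G g -> G h -> G (g *m h). Proof. by case: hG => _ _ hm _; exact: hm. Qed.

Lemma cseries1 z : fnu 1%:M z = f z.
Proof.
have e c : ct 1%:M c z = term (xget 1%:M c) z.
  exact: (congr1 (fun g => term g z) (mulmx1 _)).
exact: (congr1 (usum D) (funext e)).
Qed.

Lemma has_poincare_series z : Omega z -> has_usum D (fun c => ct 1%:M c z) (f z).
Proof. by move=> Oz; rewrite -cseries1; exact: (has_cseries hG pd hP det1 (unitmx1 _ _) Oz). Qed.

Lemma slash_arith (u j P : C) (m : int) : u != 0 -> j != 0 ->
  u ^ m / j ^+ (2 * K) * (u ^ (- l) * (j ^+ 2 / u) ^+ K * P) = u ^ (m - l - K%:Z) * P.
Proof.
move=> u0 j0; rewrite !expfzDr // -exprnN expr_div_n -exprM.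
have J0 : j ^+ (2 * K) != 0 by rewrite expf_neq0.
have U0 : u ^+ K != 0 by rewrite expf_neq0.
move: (j ^+ (2 * K)) (u ^+ K) (u ^ m) (u ^ (- l)) J0 U0 => J U A B J0 U0.
by field; rewrite J0 U0.
Qed.

(** The exponent m - l - K explains the type: l comes from (det g)^l, and K from the 1/det that each
    factor [ufun] contributes. *)
Lemma slash_poincare_series nu z m : nu \in unitmx -> Omega z ->
  slash (2 * K) m f nu z = emb (\det nu) ^ (m - l - K%:Z) * fnu nu z.
Proof.
move=> un Oz; have Oz' := cmobius_Omega un Oz.
have h1 := has_poincare_series Oz'.
have h2 := has_usumZ (emb (\det nu) ^ (- l) * (jfactor nu z ^+ 2 / emb (\det nu)) ^+ K)
  (has_cseries hG pd hP det1 un Oz).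
have h3 := has_usum_ext (t' := fun c => ct 1%:M c (cmobius nu z)) _ h2.
have e : f (cmobius nu z) =
    emb (\det nu) ^ (- l) * (jfactor nu z ^+ 2 / emb (\det nu)) ^+ K * fnu nu z.
  apply: (has_usum_uniq h1); apply: h3 => c Dc.
  have [Gg _] := coset_repr hG pd Dc.
  apply: etrans (esym (term_mobius _ _ _ _ (GU Gg) un Oz)) _.
  exact: (congr1 (fun g => term g (cmobius nu z)) (esym (mulmx1 _))).
rewrite /slash e; exact: (slash_arith _ _ (emb_det_neq0 C un) (jfactor_neq0 un Oz)).
Qed.

Definition cact h c : set M2 := [set x *m h | x in c].

Lemma cact_rcoset g h : cact h (rcoset2 H g) = rcoset2 H (g *m h).
Proof.
apply/seteqP; split=> [_ [_ [x Hx <-] <-]|_ [x Hx <-]].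
  by exists x => //; rewrite mulmxA.
by exists (x *m g); [exists x|rewrite mulmxA].
Qed.

Lemma cactM g h c : cact h (cact g c) = cact (g *m h) c.
Proof.
apply/seteqP; split=> [_ [_ [x cx <-] <-]|_ [x cx <-]].
  by exists x => //; rewrite mulmxA.
by exists (x *m g); [exists x|rewrite mulmxA].
Qed.

Lemma cact1 c : cact 1%:M c = c.
Proof.
apply/seteqP; split=> [_ [x cx <-]|x cx]; first by rewrite mulmx1.
by exists x => //; rewrite mulmx1.
Qed.

Lemma cactK g c : g \in unitmx -> cact (invmx g) (cact g c) = c.
Proof. by move=> ug; rewrite cactM (mulmxV ug) cact1. Qed.

Lemma cact_D g c : G g -> D c -> D (cact g c).
Proof. by move=> Gg [x Gx <-]; rewrite cact_rcoset; exists (x *m g) => //; exact: GM. Qed.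

Lemma cterm_cact h nu c z : G h -> nu \in unitmx -> D c ->
  ct nu (cact h c) z = ct (h *m nu) c z.
Proof.
move=> Gh un [g Gg <-]; rewrite cact_rcoset.
rewrite (cterm_coset hG pd z (GM Gg Gh) un).
by rewrite (cterm_coset hG pd z Gg (unitmx_prod (GU Gh) un)) mulmxA.
Qed.

(** Right multiplication by g permutes the cosets H g', and it carries the terms of one series to
    those of the other. *)
Lemma cseries_invariant g z : G g -> Omega z -> fnu g z = f z.
Proof.
move=> Gg Oz; have h := has_cseries hG pd hP det1 (GU Gg) Oz.
apply: has_usum_uniq (has_poincare_series Oz).
have DE : cact g @` D = D.
  have Ggi : G (invmx g) by case: hG => _ _ _; exact.
  apply/seteqP; split=> [_ [c Dc <-]|c Dc]; first exact: cact_D.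
  exists (cact (invmx g) c); first exact: cact_D.
  by rewrite cactM (mulVmx (GU Gg)) cact1.
rewrite -DE; apply: has_usum_image.
  by move=> c c' _ _ /(congr1 (cact (invmx g))); rewrite !(cactK _ (GU Gg)).
apply: has_usum_ext h => c Dc; rewrite [RHS](cterm_cact z Gg (unitmx1 _ _) Dc).
by rewrite mulmx1.
Qed.

Lemma poincare_series_rigid : rigid_holomorphic f.
Proof.
move=> m e e0; have u1 := unitmx1 F 2.
have [n hn] := cterm_small C hG pd det1 m u1 (divr_gt0 e0 (ltr0Sn R 1)).
have fin := near_cosets_finite C hG pd hP n u1.
pose S := fset_set (near_cosets R G H a b 1%:M n).
have SE : [set` S] = near_cosets R G H a b 1%:M n by rewrite fset_setK.
have rat : rational_on_Omega (fun z => \sum_(c <- S) ct 1%:M c z).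
  by apply: rational_sum => c; exact: rational_term.
have [p [d hpd]] := rat; exists p, d => z Oz.
have Oz' := Omega_nW Oz; have [d0 <-] := hpd z Oz'; split; first exact: d0.
apply: (@le_lt_trans _ _ (e / 2)); last by lra.
have e2 : 0 <= e / 2 by lra.
apply: (has_usum_diff e2 _ (has_poincare_series Oz') (has_usum_fin S _)).
  by rewrite SE; exact: near_cosets_sub.
move=> c Dc; rewrite SE => nc; apply: ltW.
exact: (hn n (leqnn _) c z Dc nc Oz).
Qed.

End Slash.

(** * Expansion at a cusp *)

Lemma factor1_drop (K : fieldType) (d j S T : K) (l : int) n : d = 1 -> j = 1 ->
  S = d ^ (- l) * (j ^+ 2 / d) ^+ n * T -> S = T.
Proof. by move=> -> -> ->; rewrite exp1rz !expr1n divr1 expr1n !mul1r. Qed.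

Lemma coset_quot (K : fieldType) (nu g h : 'M[K]_2) x y : nu \in unitmx ->
  g *m cunip nu x = h *m (g *m cunip nu y) -> g *m cunip nu (x - y) = h *m g.
Proof.
by move=> un e; rewrite -cunip_sub // mulmxA e -[LHS]mulmxA mulmxK ?cunip_unit.
Qed.

Lemma coset_quot_unimx (K : fieldType) (nu g h : 'M[K]_2) x y : nu \in unitmx ->
  g *m cunip nu x = h *m (g *m cunip nu y) -> g *m nu *m unimx (x - y) = h *m (g *m nu).
Proof.
by move=> un e; rewrite -mulmxA -cunipK // [LHS]mulmxA (coset_quot un e) [RHS]mulmxA.
Qed.

Lemma cunip_shift (K : fieldType) (nu g : 'M[K]_2) x : nu \in unitmx ->
  g *m nu *m unimx x = g *m cunip nu x *m nu.
Proof. by move=> un; rewrite -mulmxA -cunipK // [LHS]mulmxA. Qed.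

Section PartialFractions.
Variables (R : realType) (Fq : finFieldType) (C : Cinfty R Fq).
Local Notation F := (laurent Fq).
Local Notation emb := (Cemb C).

(** Combinations of poles of order at least 1 at points of F_infty. Constants are excluded: a
    constant could not be summed over an infinite group of translations, and each pole contributes
    an expansion without constant term. Equality is demanded on Omega only. *)
Inductive pfrac : (C -> C) -> Prop :=
| Pfrac_pole (x : F) j : pfrac (fun z => (z - emb x)^-1 ^+ j.+1)
| PfracD f g : pfrac f -> pfrac g -> pfrac (fun z => f z + g z)
| PfracZ c f : pfrac f -> pfrac (fun z => c * f z)
| Pfrac_ext f g : (forall z, Omega z -> f z = g z) -> pfrac f -> pfrac g.

Lemma pfrac_mul_pole f (y : F) : pfrac f -> pfrac (fun z => f z * (z - emb y)^-1).
Proof.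
elim=> {f} [x j|f g _ IHf _ IHg|c f _ IH|f g fg _ IH].
- have [->|xy] := eqVneq x y.
    by apply: Pfrac_ext (Pfrac_pole y j.+1) => z _; rewrite exprSr.
  have e0 : emb x - emb y != 0 by rewrite -CembB Cemb_eq0 subr_eq0.
  (* Trades the product of two distinct simple poles for their difference; applied repeatedly, it
     lowers the pole order at x until the poles separate. *)
  have pf z : Omega z -> (z - emb x)^-1 * (z - emb y)^-1 =
      (emb x - emb y)^-1 * ((z - emb x)^-1 - (z - emb y)^-1).
    move=> Oz; have zx := Omega_neq x Oz; have zy := Omega_neq y Oz.
    move: (emb x) (emb y) zx zy e0 => u v zx zy e0.
    have -> : (z - u)^-1 - (z - v)^-1 = (u - v) / ((z - u) * (z - v)).
      by field; rewrite zx zy.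
    by rewrite mulKf // invfM.
  elim: j => [|j IH].
    apply: Pfrac_ext (PfracZ (emb x - emb y)^-1
      (PfracD (Pfrac_pole x 0) (PfracZ (-1) (Pfrac_pole y 0)))) => z Oz.
    by rewrite !expr1 mulN1r pf.
  apply: Pfrac_ext (PfracZ (emb x - emb y)^-1
    (PfracD (Pfrac_pole x j.+1) (PfracZ (-1) IH))) => z Oz.
  rewrite [X in _ = X * _]exprSr -[RHS]mulrA (pf z Oz) [in LHS]exprSr; ring.
- by apply: Pfrac_ext (PfracD IHf IHg) => z _; rewrite mulrDl.
- by apply: Pfrac_ext (PfracZ c IH) => z _; rewrite mulrA.
- by apply: Pfrac_ext IH => z Oz; rewrite fg.
Qed.

Lemma pfrac0 : pfrac (fun=> 0).
Proof. by apply: Pfrac_ext (PfracZ 0 (Pfrac_pole 0 0)) => z _; rewrite mul0r. Qed.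

Lemma pfrac_mul_cinv f (x : P1 Fq) : pfrac f -> pfrac (fun z => f z * cinv_sub z x).
Proof.
case: x => [y|] h; first exact: pfrac_mul_pole.
by apply: Pfrac_ext pfrac0 => z _; rewrite mulr0.
Qed.

Lemma pfrac_mul_ufun f (x y : P1 Fq) : pfrac f -> pfrac (fun z => f z * ufun z x y).
Proof.
move=> h; apply: Pfrac_ext (PfracD (pfrac_mul_cinv y h) (PfracZ (-1) (pfrac_mul_cinv x h))).
by move=> z _; rewrite /ufun mulrBr mulN1r.
Qed.

Lemma pfrac_mul_ufunX f (x y : P1 Fq) n : pfrac f -> pfrac (fun z => f z * ufun z x y ^+ n).
Proof.
move=> h; elim: n => [|n IH]; first by apply: Pfrac_ext h => z _; rewrite mulr1.
by apply: Pfrac_ext (pfrac_mul_ufun x y IH) => z _; rewrite exprSr mulrA.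
Qed.

Lemma pfrac_ufun (x y : P1 Fq) : pfrac (fun z => ufun z x y).
Proof.
have pc p : pfrac (fun z => cinv_sub z p).
  case: p => [u|]; last exact: pfrac0.
  by apply: Pfrac_ext (Pfrac_pole u 0) => z _; rewrite expr1.
apply: Pfrac_ext (PfracD (pc y) (PfracZ (-1) (pc x))) => z _.
by rewrite mulN1r.
Qed.

Lemma pfrac_mul_prod (I : Type) (s : seq I) (P : pred I) f (x y : I -> P1 Fq) n : pfrac f ->
  pfrac (fun z => f z * \prod_(i <- s | P i) ufun z (x i) (y i) ^+ n i).
Proof.
elim: s f => [|i s IH] f h.
  by apply: Pfrac_ext h => z _; rewrite big_nil mulr1.
case Pi: (P i); last by apply: Pfrac_ext (IH _ h) => z _; rewrite big_cons Pi.
apply: Pfrac_ext (IH _ (pfrac_mul_ufunX (x i) (y i) (n i) h)) => z _.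
by rewrite big_cons Pi mulrA.
Qed.

Lemma pfrac_term r (k : 'I_r -> nat) l (a b : 'I_r -> P1 Fq) g : (0 < r)%N ->
  (forall i, 0 < k i)%N -> pfrac (@poincare_term R Fq C r k l a b g).
Proof.
move=> r0 k0; pose i0 := Ordinal r0; pose x i := mobius (invmx g) (a i).
pose y i := mobius (invmx g) (b i).
(* Since the constant 1 is not in [pfrac], the product is started from an actual factor, which
   [0 < r] and [0 < k i] provide. *)
have h1 : pfrac (fun z => ufun z (x i0) (y i0) ^+ k i0).
  have := k0 i0; case: (k i0) => // n _.
  apply: Pfrac_ext (pfrac_mul_ufunX (x i0) (y i0) n (pfrac_ufun (x i0) (y i0))) => z _.
  by rewrite exprS.
have h2 := pfrac_mul_prod (index_enum 'I_r) (fun i => i != i0) x y k h1.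
apply: Pfrac_ext (PfracZ (Cemb C (\det g) ^ l) h2) => z _.
refine (congr1 (fun w => Cemb C (\det g) ^ l * w) _).
by rewrite [RHS](bigD1 i0).
Qed.

Lemma term_unimx r (k : 'I_r -> nat) l (a b : 'I_r -> P1 Fq) g (x : F) z :
  g \in unitmx -> Omega z ->
  poincare_term k l a b (g *m unimx x) z = poincare_term k l a b g (z + emb x).
Proof.
move=> ug Oz; have ux := unimx_unit x.
have J : jfactor (unimx x) z = 1.
  by rewrite /jfactor !mxE /= Cemb0 mul0r add0r; exact: rmorph1.
have e1 : emb 1 = 1 by exact: rmorph1.
have cz : cmobius (unimx x) z = z + emb x.
  by rewrite /cmobius J divr1 !mxE /= e1 mul1r.
have d1 : emb (\det (unimx x)) = 1 by rewrite unimx_det.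
have h := term_mobius k l a b ug ux Oz.
exact: etrans (esym (factor1_drop d1 J h)) (congr1 _ cz).
Qed.

End PartialFractions.

Section Orbits.
Variables (R : realType) (Fq : finFieldType) (C : Cinfty R Fq).
Local Notation F := (laurent Fq).
Local Notation M2 := 'M[F]_2.
Local Notation N := (@Cabs R Fq C).
Local Notation Nf := (@absinf R Fq).
Local Notation emb := (Cemb C).
Variable B : set F.
Hypotheses (B0 : B 0) (BB : forall x y, B x -> B y -> B (x - y)).
Hypothesis Bdisc : forall M : R, finite_set [set x | B x /\ Nf x <= M].
Variable rad : R.
Hypotheses (rad0 : 0 < rad) (hrad : forall x, N (eexp B (emb x)) * rad < 1).
Variable z0 : C.
Hypothesis O0 : Omega z0.

(** Summation over translations is linear, so induction on [pfrac] reduces to a single pole, that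
    is, to a shifted Eisenstein sum. *)
Lemma orbit_tseries f : pfrac f -> exists cs phi, [/\ cs 0%N = 0, tseries B rad cs phi &
  forall z, Omega z -> has_usum B (fun x => f (z + emb x)) (phi z)].
Proof.
elim=> {f} [x j|f g _ [c [p [c0 hc hp]]] _ [c' [p' [c0' hc' hp']]]
  |a f _ [c [p [c0 hc hp]]]|f g fg _ [c [p [c0 hc hp]]]].
- have [c [c0 hc]] := tseries_eis B0 BB Bdisc rad0 hrad x j O0.
  exists c; eexists; split; [exact: c0|exact: hc|] => z Oz.
  have Ozx : Omega (z - emb x) by rewrite -CembN; exact: Omega_addr.
  by apply: has_usum_ext (has_eis Bdisc j Ozx) => y _; rewrite addrAC.
- exists (fun n => c n + c' n); eexists; split; last first.
  + by move=> z Oz; exact: has_usumD (hp z Oz) (hp' z Oz).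
  + exact: tseriesD.
  + by rewrite c0 c0' addr0.
- exists (fun n => a * c n); eexists; split; last first.
  + by move=> z Oz; exact: has_usumZ (hp z Oz).
  + exact: tseriesZ.
  + by rewrite c0 mulr0.
- exists c, p; split; [exact: c0|exact: hc|] => z Oz.
  by apply: has_usum_ext (hp z Oz) => x _; rewrite fg //; exact: Omega_addr.
Qed.

Variables (G H : set M2) (r : nat) (k : 'I_r -> nat) (l : int) (a b : 'I_r -> P1 Fq).
Hypotheses (hG : is_subgroup G) (pd : poincare_data G H k l a b).
Variable nu : M2.
Hypotheses (un : nu \in unitmx) (BG : forall x, B x -> G (cunip nu x)).
Local Notation D := (rcosets2 H G).
Local Notation ct := (@cterm R Fq C r k l a b).

Let GU g : G g -> g \in unitmx. Proof. by case: hG => h _ _ _ /h. Qed.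

Lemma mobius_unimx_fix (x : F) (p : P1 Fq) : x != 0 -> mobius (unimx x) p = p -> p = None.
Proof.
move=> x0; case: p => [y|] //; rewrite /mobius !mxE /= mul0r add0r oner_eq0 divr1 mul1r.
by move=> [/eqP]; rewrite -subr_eq0 addrAC subrr add0r (negbTE x0).
Qed.

(* [H] fixes the two distinct points [a i] and [b i], while a nontrivial
   unipotent matrix fixes only one. *)
Lemma cact_inj c x y : D c -> B x -> B y ->
  cact (cunip nu x) c = cact (cunip nu y) c -> x = y.
Proof.
move=> [g Gg <-] Bx By; rewrite !cact_rcoset => e.
have [HU H1 _ _] := pd_group pd; have [h Hh he] := rcoset2_eq H1 e.
apply/eqP; rewrite -subr_eq0; apply: contraT => xy.
pose i := Ordinal (pd_r pd); have [fa fb] := pd_fix pd i Hh.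
have ug := GU Gg; have ugn := unitmx_prod ug un.
have hE := coset_quot_unimx un he.
have fix_ p : mobius h p = p -> mobius (unimx (x - y)) (mobius (invmx (g *m nu)) p) =
    mobius (invmx (g *m nu)) p.
  move=> hp; have uV : invmx (g *m nu) \in unitmx := etrans (unitmx_inv _) ugn.
  have e1 := congr1 (fun m => mobius m (mobius (invmx (g *m nu)) p)) hE.
  have e2 : mobius (g *m nu) (mobius (unimx (x - y)) (mobius (invmx (g *m nu)) p)) = p.
    apply: etrans (esym (mobiusM _ _ (unimx_unit _))) _; apply: etrans e1 _.
    apply: etrans (mobiusM _ _ ugn) _; apply: etrans (congr1 (mobius h) (mobiusKV _ ugn)) hp.
  exact: etrans (esym (mobiusK (mobius (unimx (x - y)) (mobius (invmx (g *m nu)) p)) ugn))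
    (congr1 (mobius (invmx (g *m nu))) e2).
have na := mobius_unimx_fix xy (fix_ _ fa); have nb := mobius_unimx_fix xy (fix_ _ fb).
case: (pd_ab pd (i := i)).
have inj p : mobius (invmx (g *m nu)) p = None -> p = mobius (g *m nu) None.
  by move=> e1; exact: etrans (esym (mobiusKV p ugn)) (congr1 (mobius (g *m nu)) e1).
exact: etrans (inj _ na) (esym (inj _ nb)).
Qed.

Definition corbit c := (fun x => cact (cunip nu x) c) @` B.

Lemma corbit_tseries c : D c -> exists cs phi, [/\ cs 0%N = 0, tseries B rad cs phi &
  forall z, Omega z -> has_usum (corbit c) (fun c' => ct nu c' z) (phi z)].
Proof.
move=> Dc; have Dc' := Dc; move: Dc' => [g Gg gE].
have ugn := unitmx_prod (GU Gg) un.
have [cs [phi [cs0 h1 h2]]] := orbit_tseries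
  (pfrac_term C l a b (g *m nu) (pd_r pd) (pd_k pd)).
exists cs, phi; split; [exact: cs0|exact: h1|] => z Oz.
apply: has_usum_image.
  move=> x y; rewrite !in_setE => Bx By; exact: cact_inj Dc Bx By.
apply: has_usum_ext (h2 z Oz) => x Bx; rewrite [RHS]/= -gE cact_rcoset.
have [_ _ GM _] := hG.
apply: etrans (esym (term_unimx k l a b x ugn Oz)) _.
apply: etrans (esym (cterm_coset hG pd z (GM _ _ Gg (BG Bx)) un)).
exact: (congr1 (fun m => poincare_term k l a b m z) (cunip_shift g x un)).
Qed.

Definition corbits (s : set (set M2)) : set (set M2) :=
  [set c | exists2 c', s c' & corbit c' c].

(** Two orbits coincide or are disjoint, so a coset added to the list either brings nothing new or
    adds its expansion. *)
Lemma corbits_tseries (s : seq (set M2)) : (forall c, c \in s -> D c) ->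
  exists cs phi, [/\ cs 0%N = 0, tseries B rad cs phi & forall z, Omega z ->
    has_usum (corbits [set` s]) (fun c' => ct nu c' z) (phi z)].
Proof.
elim: s => [|c s IH] hs.
  eexists; exists (fun=> 0); split; [|exact: tseries_cst|] => // z Oz.
  rewrite (_ : corbits _ = set0); first exact: has_usum_set0.
  by apply/seteqP; split=> c' // [c].
have [|cs [phi [c0 h1 h2]]] := IH.
  by move=> c' c's; apply: hs; rewrite in_cons c's orbT.
have Dc := hs c (mem_head _ _).
have sE : corbits [set` c :: s] = corbit c `|` corbits [set` s].
  apply/seteqP; split=> c'.
    move=> [c1]; rewrite /= in_cons => /orP[/eqP ->|c1s] h; first by left.
    by right; exists c1.
  move=> [h|[c1 /= c1s h]]; first by exists c; rewrite //= mem_head.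
  by exists c1; rewrite //= in_cons c1s orbT.
have [[c1 c1s [x Bx xc]]|nc] := pselect (corbits [set` s] c).
  exists cs, phi; split=> // z Oz; rewrite sE (_ : _ `|` _ = corbits [set` s]); first exact: h2.
  apply/seteqP; split=> c'; last by right.
  move=> [[y By yc]|//].
  exists c1; first exact: c1s.
  exists (x + y); first by rewrite -[y]opprK; apply: BB => //; rewrite -sub0r; exact: BB.
  by rewrite -yc -xc cactM (cunipD _ _ un).
have [cs' [phi' [c0' h1' h2']]] := corbit_tseries Dc.
exists (fun n => cs' n + cs n), (fun z => phi' z + phi z); split.
- by rewrite c0 c0' addr0.
- exact: tseriesD.
move=> z Oz; rewrite sE; apply: has_usumU (h2' z Oz) (h2 z Oz).
apply/seteqP; split=> c' // [[x Bx xc] [c1 c1s [y By yc]]]; apply: nc.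
exists c1; first exact: c1s.
exists (y - x); first exact: BB.
rewrite -(cunip_sub _ _ un) -cactM yc -xc.
exact: (cactK _ (cunip_unit x un)).
Qed.

End Orbits.

(** * Sample points near the cusp *)

Section CirclePoints.
Variables (R : realType) (Fq : finFieldType) (C : Cinfty R Fq).
Local Notation q := (#|Fq|%:R : R).
Local Notation F := (laurent Fq).
Local Notation N := (@Cabs R Fq C).
Local Notation Nf := (@absinf R Fq).
Local Notation emb := (Cemb C).
Let hN : is_absval N := Cabs_absval C.
Let hF : is_absval Nf := absinf_absval C.
Variable B : set F.
Hypotheses (B0 : B 0) (BB : forall x y, B x -> B y -> B (x - y)).
Hypothesis Bdisc : forall M : R, finite_set [set x | B x /\ Nf x <= M].
Variable y : C.
Hypotheses (y1 : 1 <= N y) (yF : forall x, N y != Nf x).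

(** All unit multiples of [y], so that differences of distinct points (x - x') y are again of this
    kind. As |y| is not a value of F_infty, |w - x| is the maximum of |y| and |x|, the same for all
    such w. *)
Definition circle_pt (w : C) := exists2 s, N s = 1 & w = s * y.

Let cpN w x : circle_pt w -> N (w - emb x) = Num.max (N y) (Nf x).
Proof.
move=> [s s1 ->]; have Ny : N (s * y) = N y by rewrite (nvM hN) s1 mul1r.
have [yx|xy] := ltP (N y) (Nf x).
  by rewrite (nvBr hN) ?Cabs_emb ?Ny // max_r // ltW.
have xy' : Nf x < N y by rewrite lt_def yF xy.
by rewrite (nvBl hN) ?Cabs_emb ?Ny // max_l.
Qed.

Let y_pt : circle_pt y. Proof. by exists 1; rewrite ?(nv1 hN) ?mul1r. Qed.

Lemma circle_pt_Omega w : circle_pt w -> Omega w.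
Proof.
move=> wc; apply: OmegaP => x; rewrite -(nv_gt0 hN) (cpN _ wc) lt_max.
by rewrite (lt_le_trans ltr01 y1).
Qed.

Lemma circle_pt_imabs w : circle_pt w -> N y <= imabs w.
Proof. by move=> wc; apply: imabs_ge => x; rewrite (cpN _ wc) le_max lexx. Qed.

Lemma circle_pt_Omega_n : exists n, forall w, circle_pt w -> Omega_n n w.
Proof.
have [n hn] := card_pow_gt Fq (N y); exists n => w wc; split.
  by have := cpN 0 wc; rewrite Cemb0 subr0 (nv0 hF) max_l ?(nv_ge0 hN) // => ->; exact: ltW.
apply: le_trans (circle_pt_imabs wc); apply: le_trans y1.
by rewrite invf_le1 ?exprn_gt0 ?cardq_gt0 // exprn_ege1 // ltW // cardq_gt1.
Qed.

Lemma circle_pt_eexp w : circle_pt w -> N (eexp B w) = N (eexp B y).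
Proof.
move=> wc; apply: (eexp_norm_eq B0 Bdisc) => x.
by rewrite (cpN x wc) (cpN x y_pt).
Qed.

Let ey0 : eexp B y != 0.
Proof.
rewrite -(nv_gt0 hN); apply: lt_le_trans (eexp_ge_imabs B0 BB Bdisc y).
by apply: imabs_gt0; exact: circle_pt_Omega y_pt.
Qed.

Lemma circle_pt_many n : exists s : seq C, [/\ size s = n,
  uniq [seq (eexp B w)^-1 | w <- s], forall w, w \in s -> circle_pt w &
  forall w w', w \in s -> w' \in s -> (eexp B w)^-1 != (eexp B w')^-1 ->
    N ((eexp B w)^-1 - (eexp B w')^-1) = N (eexp B y)^-1].
Proof.
have [s [us ss s1 sd]] := circle_roots C n.
(* By additivity e(x y) - e(x' y) = e((x - x') y), and x - x' is a unit. *)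
have ed x x' : x \in s -> x' \in s -> x != x' ->
    N (eexp B (x * y) - eexp B (x' * y)) = N (eexp B y).
  move=> xs xs' xx; rewrite -(eexpB B0 BB Bdisc) -mulrBl; apply: circle_pt_eexp.
  by exists (x - x'); rewrite ?sd.
have cp x : x \in s -> circle_pt (x * y) by move=> xs; exists x; rewrite ?s1.
have nz x : x \in s -> eexp B (x * y) != 0.
  by move=> xs; rewrite -(nv_gt0 hN) (circle_pt_eexp (cp x xs)) (nv_gt0 hN).
exists [seq x * y | x <- s]; split.
- by rewrite size_map.
- rewrite -map_comp map_inj_in_uniq // => x x' xs xs' /= /invr_inj e.
  apply/eqP; apply: contraT => xx; have := ed x x' xs xs' xx.
  by rewrite e subrr (nv0 hN) => /esym/eqP; rewrite (nv_eq0 hN) (negbTE ey0).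
- by move=> _ /mapP[x xs ->]; exact: cp.
- move=> _ _ /mapP[x xs ->] /mapP[x' xs' ->] e.
  have xx : x != x' by apply: contraNneq e => ->.
  have -> : (eexp B (x * y))^-1 - (eexp B (x' * y))^-1 =
      - (eexp B (x * y) - eexp B (x' * y)) / (eexp B (x * y) * eexp B (x' * y)).
    by field; rewrite !nz.
  rewrite (nvf hN) (nvN hN) (nvM hN) (ed x x') // (circle_pt_eexp (cp x xs)).
  rewrite (circle_pt_eexp (cp x' xs')).
  have e0 : N (eexp B y) != 0 by rewrite (nv_eq0 hN).
  by rewrite (nvV hN) invfM mulrA divff // mul1r.
Qed.

End CirclePoints.

Section CuspBehaviour.
Variables (R : realType) (Fq : finFieldType) (C : Cinfty R Fq).
Local Notation F := (laurent Fq).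
Local Notation M2 := 'M[F]_2.
Local Notation N := (@Cabs R Fq C).
Local Notation Nf := (@absinf R Fq).
Local Notation emb := (Cemb C).
Let hN : is_absval N := Cabs_absval C.
Variables (G H : set M2) (r : nat) (k : 'I_r -> nat) (l : int) (a b : 'I_r -> P1 Fq).
Hypotheses (hG : is_subgroup G) (pd : poincare_data G H k l a b).
Hypothesis hP : conditionP G H a b.
Hypothesis det1 : forall g, G g -> Nf (\det g) = 1.
Local Notation K := (\sum_(i < r) k i)%N.
Local Notation D := (rcosets2 H G).
Local Notation f := (poincare_series C G H k l a b).
Local Notation ct := (@cterm R Fq C r k l a b).

Lemma poincare_series_cusp nu m : commensurable G (GL2A Fq) -> GL2F nu ->
  order_at_cusp_ge 1 G (2 * K) m f nu.
Proof.
move=> comm nuF; have un : nu \in unitmx := nuF.1.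
pose B := cusp_translations G nu.
have B0 : B 0 := cusp_translations0 hG un.
have BB : forall x y, B x -> B y -> B (x - y) := fun x y => cusp_translationsB hG un (x := x) (y := y).
have Bdisc : forall M : R, finite_set [set x | B x /\ Nf x <= M].
  by move=> M; exact: (cusp_translations_discrete C hG un comm M).
have BG : forall x, B x -> G (cunip nu x).
  by move=> x Bx; exact: (proj1 (cusp_translationsP G un x) Bx).
have [M0 hM0] := cusp_translations_cocompact C hG un comm nuF.
have [K' hK'] := eexp_bounded C B0 BB Bdisc hM0.
(* |y| > 1 keeps the circle away from F_infty, and |y| > [K'] makes |e(y)| exceed every |e(x)|,
   which is the condition on the radius. *)
have [y [yM yF]] := circle_radius C (Num.max 1 K').
have y1 : 1 <= N y by apply: le_trans (ltW yM); rewrite le_max lexx.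
have yK : K' < N y by apply: le_lt_trans yM; rewrite le_max lexx orbT.
have yp : circle_pt y y by exists 1; rewrite ?(nv1 hN) ?mul1r.
have Oy : Omega y := circle_pt_Omega y1 yF yp.
have eyy : N y <= N (eexp B y).
  apply: le_trans (circle_pt_imabs yF yp) _; exact: (eexp_ge_imabs B0 BB Bdisc).
have ey0 : 0 < N (eexp B y) by apply: lt_le_trans eyy; apply: lt_le_trans y1.
pose rad := (N (eexp B y))^-1.
have rad0 : 0 < rad by rewrite invr_gt0.
have hrad x : N (eexp B (emb x)) * rad < 1.
  rewrite /rad ltr_pdivrMr // mul1r; apply: le_lt_trans (hK' x) _.
  exact: lt_le_trans yK eyy.
have ysN w : circle_pt y w -> N (eexp B w)^-1 = rad.
  by move=> wc; rewrite (nvV hN) (circle_pt_eexp B0 Bdisc yF wc).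
have many n : exists s : seq C, [/\ size s = n,
  uniq [seq (eexp B w)^-1 | w <- s], forall w, w \in s -> circle_pt y w &
  forall w w', w \in s -> w' \in s -> (eexp B w)^-1 != (eexp B w')^-1 ->
    N ((eexp B w)^-1 - (eexp B w')^-1) = rad].
  have [s [h1 h2 h3 h4]] := circle_pt_many B0 BB Bdisc y1 yF n; exists s; split=> //.
  by move=> w w' ws ws' ww; rewrite h4 // (nvV hN).
(* One affinoid contains all circle points, so the constant [A] is uniform over them. *)
have [n1 hn1] := circle_pt_Omega_n y1 yF.
have [A A0 hA] := cterm_le C hG pd det1 n1 un.
pose S n := fset_set (near_cosets R G H a b nu n).
have SE n : [set` S n] = near_cosets R G H a b nu n.
  by rewrite fset_setK //; exact: (near_cosets_finite C hG pd hP n un).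
have SD n c : c \in (S n : seq _) -> D c.
  move=> cS; suff: near_cosets R G H a b nu n c by apply: near_cosets_sub.
  by rewrite -SE.
(* The near cosets are enlarged to the union of their [B]-orbits, so that the partial sums have
   expansions in t; the omitted cosets are still far ones. *)
have [cs hcs] : {cs : nat -> nat -> C & forall n, exists phi, [/\ cs n 0%N = 0,
    tseries B rad (cs n) phi & forall z, Omega z ->
    has_usum (corbits B nu [set` (S n : seq _)]) (fun c' => ct nu c' z) (phi z)]}.
  apply: (@choice _ _ (fun n cs => exists phi, [/\ cs 0%N = 0,
    tseries B rad cs phi & forall z, Omega z ->
    has_usum (corbits B nu [set` (S n : seq _)]) (fun c' => ct nu c' z) (phi z)])) => n.
  exact: (corbits_tseries B0 BB Bdisc rad0 hrad Oy hG pd un BG (@SD n)).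
have [phi hphi] := choice hcs.
pose fnu := @cseries R Fq C G H r k l a b nu.
have orbD n : corbits B nu [set` (S n : seq _)] `<=` D.
  move=> c [c' /= c'S [x Bx <-]]; apply: (cact_D hG (BG _ Bx)); exact: SD c'S.
have notorb n c : ~ corbits B nu [set` (S n : seq _)] c -> ~ near_cosets R G H a b nu n c.
  move=> nc; rewrite -SE => cS; apply: nc; exists c; first exact: cS.
  by exists 0; [exact: B0|rewrite (cunip0 un) cact1].
have [c' [hc' c'0]] : exists c', tseries B rad c' fnu /\ c' 0%N = 0.
  apply: (tseries_lim rad0 (circle_pt_Omega y1 yF) ysN many
    (c := cs) (phi := phi) (eps := fun n => A * #|Fq|%:R ^- n)).
  - by move=> n; rewrite mulr_ge0 // invr_ge0 exprn_ge0 // ltW // cardq_gt0.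
  - by move=> d d0; exact: (scaled_card_powN_lt Fq A0 d0).
  - by move=> n; have [h0 h1 _] := hphi n; split.
  - move=> n w wc; have Ow := circle_pt_Omega y1 yF wc; have [_ _ h2] := hphi n.
    rewrite (nvBC hN); apply: (has_usum_diff _ (@orbD n) (has_cseries hG pd hP det1 un Ow) (h2 w Ow)).
      by rewrite mulr_ge0 // invr_ge0 exprn_ge0 // ltW // cardq_gt0.
    move=> c Dc nc; exact: (hA n c w Dc (notorb _ _ nc) (hn1 w wc)).
  (* Away from the circle the affinoid, and with it the rate of convergence, may depend on z. *)
  - move=> z Oz _ e e0; have [n2 Oz2] := Omega_n_ex Oz.
    have e2 : 0 < e / 2 by lra.
    have [n3 hn3] := cterm_small C hG pd det1 n2 un e2.
    exists n3 => n nn; have [_ _ h2] := hphi n.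
    apply: (@le_lt_trans _ _ (e / 2)); last lra.
    rewrite (nvBC hN); apply: (has_usum_diff (ltW e2) (@orbD n) (has_cseries hG pd hP det1 un Oz) (h2 z Oz)).
    move=> c Dc nc; apply: ltW; exact: (hn3 n nn c z Dc (notorb _ _ nc) Oz2).
have [h1 h2] := tseriesZ rad0 (emb (\det nu) ^ (m - l - K%:Z)) hc'.
(* The bound rad^-1 suffices since |e(z)| >= |z|_i forces |t| <= rad. *)
exists (fun n => emb (\det nu) ^ (m - l - K%:Z) * c' n), rad, rad^-1; split.
- exact: rad0.
- move=> x xr; apply: (series_cvg hN); first exact: (@Ccomplete _ _ C).
  move=> e /h1[n hn]; exists n => j /hn; apply: le_lt_trans.
  rewrite (nvM hN) (nvX hN); apply: ler_wpM2l; first exact: (nv_ge0 hN).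
  by apply: lerXn2r; rewrite ?nnegrE ?(nv_ge0 hN) // ltW.
- move=> z Oz Mz; rewrite (slash_poincare_series hG pd hP det1 m un Oz).
  apply: h2; first exact: Oz.
  have ez : rad^-1 < N (eexp B z) := lt_le_trans Mz (eexp_ge_imabs B0 BB Bdisc z).
  have ri : 0 < rad^-1 by rewrite invr_gt0.
  by rewrite (nvV hN) -[rad]invrK lef_pV2 ?posrE ?(ltW ez) // (lt_trans ri).
- by case=> // _; rewrite c'0 mulr0.
Qed.

End CuspBehaviour.

(** Makes the choice of integer lift immaterial. If the set of determinants is infinite, the modulus
    is 0 and the congruence is an equality. *)
Lemma det_pow_eq1 (Fq : finFieldType) (G : set 'M[laurent Fq]_2) (g : 'M[laurent Fq]_2)
    (m n : int) : is_subgroup G -> G g ->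
  (m = n %[mod (det_card G)%:Z])%Z -> \det g ^ (m - n) = 1.
Proof.
move=> hG Gg /eqP; rewrite eqz_mod_dvd => /dvdzP[s ->].
by rewrite mulrC -exprz_exp -exprnP (det_card_exp hG Gg) exp1rz.
Qed.

Theorem corollary4p1p1 (R : realType) (Fq : finFieldType) (C : Cinfty R Fq)
    (G H : set 'M[laurent Fq]_2) (r : nat) (k : 'I_r -> nat) (l : int)
    (a b : 'I_r -> P1 Fq) :
  odd #|Fq| ->
  is_subgroup G ->
  commensurable G (GL2A Fq) \/
    [/\ discrete_subgroup G,
        cocompact G,
        center2 G = [set g | G g /\ is_scalar_mx g]
      & forall x, det_set G x -> exists2 c : Fq, c != 0 & x = lconst c] ->
  poincare_data G H k l a b ->
  conditionP G H a b ->
  forall m : int, (m = (\sum_(i < r) k i)%N%:Z + l %[mod (det_card G)%:Z])%Z ->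
  cusp_form G (2 * \sum_(i < r) k i)%N m (poincare_series C G H k l a b).
Proof.
move=> _ hG cases pd hP m hm.
(* Commensurability gives this by pigeonhole on powers; in the cocompact case the determinants are
   nonzero constants. *)
have det1 g : G g -> absinf R (\det g) = 1.
  case: cases => [comm Gg|[_ _ _ detG] Gg]; first exact: (det_commensurable C hG comm Gg).
  by have [c c0 ->] := detG _ (imageP _ Gg); exact: absinf_lconst.
have cusp : order_at_cusps_ge 1 G (2 * \sum_(i < r) k i) m (poincare_series C G H k l a b).
  by move=> comm nu nuF; exact: (poincare_series_cusp C hG pd hP det1 m comm nuF).
split; last exact: cusp.
split.
- exact: (poincare_series_rigid C hG pd hP det1).
- move=> g z Gg Oz; have ug : g \in unitmx by case: hG => GL _ _ _; exact: GL.
  rewrite (slash_poincare_series hG pd hP det1 m ug Oz).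
  rewrite (cseries_invariant hG pd hP det1 Gg Oz) -addrA -opprD [l + _]addrC.
  have e : Cemb C (\det g) ^ (m - ((\sum_(i < r) k i)%N%:Z + l)) = 1.
    by rewrite -fmorphXz (det_pow_eq1 hG Gg hm) rmorph1.
  by rewrite e mul1r.
(* The expansion that vanishes to order 1 also witnesses holomorphy at the cusp. *)
- move=> comm nu nuF; have [c [rho [M [h1 h2 h3 _]]]] := cusp comm nu nuF.
  by exists c, rho, M.
Qed.
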